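(* Let $q>\frac N2$, let $f\in L^q(\Omega)$ be a nonnegative function with $f\not\equiv0$, and let $\sigma$ be the radius of convergence associated with $\{a_m\}$, i.e. $\limsup_{m\to+\infty}\sqrt[m]{a_m}=\frac1\sigma$. Suppose that $$ \sum_{m=1}^{\infty}a_m\sigma^m<+\infty . $$ Then there exists a positive number $\Lambda_f$ such that the problem $$ \begin{cases} -\sum_{m=1}^{\infty}\mathrm{div}\,(A_m(x)\nabla u^m)=\lambda f & \text{in }\Omega,\\ u=0 & \text{on }\partial\Omega, \end{cases} $$ does not admit any weak solution if $\lambda>\Lambda_f$.
   Context: $\Omega$ is a bounded open set of $\mathbb{R}^N$, $N\ge 1$. $A$ is a (measurable) function on $\mathbb{R}^N$ with values in the symmetric $N\times N$ real matrices such that, for some constants $0<\alpha\le\beta$, $\alpha|\xi|^2\le A(x)\xi\cdot\xi$ for a.e. $x\in\Omega$ and all $\xi\in\mathbb{R}^N$, $\xi\ne0$, and $|A(x)|\le\beta$ for a.e. $x\in\Omega$. $\{a_m\}_{m\ge1}$ is a sequence of nonnegative real numbers with $a_1\ne0$ and $a_m\ne0$ for infinitely many $m>1$, and $A_m(x):=a_mA(x)$. The radius of convergence $\sigma\in[0,+\infty]$ is defined by $\limsup_{m\to\infty}\sqrt[m]{a_m}=1/\sigma$, with $\sigma=0$ if the limsup is $+\infty$ and $\sigma=+\infty$ if it is $0$; for $\sigma=+\infty$ the sum $\sum a_m\sigma^m$ is understood to be $+\infty$. $L^q(\Omega)$ is the usual Lebesgue space ($q\ge1$). Weak solution of the problem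 with right-hand side $g$ (here $g=\lambda f$): a nonnegative function $u\in H^1_0(\Omega)\cap L^\infty(\Omega)$ such that $\sum_{m=1}^{\infty}\int_\Omega A_m(x)\nabla u^m\cdot\nabla\varphi\,dx=\int_\Omega g\varphi\,dx$ for every $\varphi\in H^1_0(\Omega)$. *)

(* Defs.v *)
From HB Require Import structures.
From mathcomp Require Import all_boot all_order all_algebra.
From mathcomp Require Import all_classical all_reals all_analysis.
Set Implicit Arguments.
Unset Strict Implicit.
Unset Printing Implicit Defensive.
Import Order.TTheory GRing.Theory Num.Theory.
Import numFieldNormedType.Exports.
Local Open Scope classical_set_scope.
Local Open Scope ring_scope.

(* R^n is 'rV[R]_n. Its measurable sets form the sigma-algebra generated by the
   coordinates, as for n.-tuple; these are the Borel sets of R^n. *)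
Section measurable_rV.
Variables (R : realType) (n : nat).

Definition rV_coord (i : 'I_n) (v : 'rV[R]_n) : R := v ord0 i.

Let rV_set0 : g_sigma_preimage rV_coord set0.
Proof. exact: sigma_algebra0. Qed.

Let rV_setC A : g_sigma_preimage rV_coord A -> g_sigma_preimage rV_coord (~` A).
Proof. exact: sigma_algebraC. Qed.

Let rV_bigcup (F : (set 'rV[R]_n)^nat) :
  (forall i, g_sigma_preimage rV_coord (F i)) ->
  g_sigma_preimage rV_coord (\bigcup_i F i).
Proof. exact: sigma_algebra_bigcup. Qed.

HB.instance Definition _ := @isMeasurable.Build default_measure_display
  'rV[R]_n (g_sigma_preimage rV_coord) rV_set0 rV_setC rV_bigcup.

End measurable_rV.

Lemma measurable_rV_coord (R : realType) n (i : 'I_n) :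
  measurable_fun [set: 'rV[R]_n] (rV_coord i).
Proof.
move=> _ Y mY; rewrite setTI; apply: sub_sigma_algebra => /=.
rewrite -bigcup_seq/=; exists i => /=; first by rewrite mem_index_enum.
by exists Y => //; rewrite setTI.
Qed.

Lemma measurable_fun_rVP (R : realType) d (T : measurableType d) n
    (f : T -> 'rV[R]_n) :
  (forall i, measurable_fun [set: T] (rV_coord i \o f)) ->
  measurable_fun [set: T] f.
Proof.
move=> mf; have sub : g_sigma_preimage (@rV_coord R n) `<=`
    [set A | measurable (f @^-1` A)].
  apply: smallest_sub.
    split => /=; first by rewrite preimage_set0.
    - by move=> A mA; rewrite setTD -preimage_setC; exact: measurableC.
    - by move=> F mF; rewrite preimage_bigcup; exact: bigcup_measurable.
  rewrite -bigcup_seq => A [i _ [B mB <-]] /=.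
  by rewrite setTI -comp_preimage -[X in measurable X]setTI; exact: mf.
by move=> _ A mA; rewrite setTI; exact: sub.
Qed.

(* Lebesgue measure on R^n, by recursion on n: the image of the product of
   the n-dimensional measure with the one-dimensional one under
   R^n x R -> R^(n+1). *)
Section lebesgue_rV.
Variable R : realType.

Definition rcons_rV n (p : 'rV[R]_n * measurableTypeR R) : 'rV[R]_n.+1 :=
  \row_j (if unlift ord_max j is Some k then p.1 ord0 k else p.2).

Lemma measurable_rcons_rV n : measurable_fun setT (@rcons_rV n).
Proof.
apply: measurable_fun_rVP => i.
have [k ->|->] := unliftP ord_max i.
- rewrite (_ : _ \o _ = rV_coord k \o fst).
    exact: (measurableT_comp (@measurable_rV_coord R n k)).
  by apply/funext => p; rewrite /rV_coord /= mxE liftK.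
- rewrite (_ : _ \o _ = snd)//.
  by apply/funext => p; rewrite /rV_coord /= mxE unlift_none.
Qed.

HB.instance Definition _ n := isMeasurableFun.Build _ _ _ _ (@rcons_rV n)
  (@measurable_rcons_rV n).

Section step.
Variables (n : nat) (mu : {measure set 'rV[R]_n -> \bar R}).

Definition lebesgue_rV_step : set 'rV[R]_n.+1 -> \bar R :=
  pushforward (mu \x (@lebesgue_measure R))%E (@rcons_rV n).

Let prodmu : {measure set ('rV[R]_n * measurableTypeR R) -> \bar R} :=
  (mu \x (@lebesgue_measure R))%E.

Let step0 : lebesgue_rV_step set0 = 0%E.
Proof. exact: (@measure0 _ _ _ (pushforward prodmu (@rcons_rV n))). Qed.

Let step_ge0 A : (0 <= lebesgue_rV_step A)%E.
Proof. exact: (@measure_ge0 _ _ _ (pushforward prodmu (@rcons_rV n))). Qed.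

Let step_sigma_additive : semi_sigma_additive lebesgue_rV_step.
Proof.
exact: (@measure_semi_sigma_additive _ _ _ (pushforward prodmu (@rcons_rV n))).
Qed.

HB.instance Definition _ := isMeasure.Build _ _ _ lebesgue_rV_step
  step0 step_ge0 step_sigma_additive.

End step.

Fixpoint lebesgue_rV n : {measure set 'rV[R]_n -> \bar R} :=
  match n with
  | 0 => dirac (0 : 'rV[R]_0)
  | n'.+1 => lebesgue_rV_step (lebesgue_rV n')
  end.

End lebesgue_rV.

Lemma lebesgue_rV_box (R : realType) n (a b : 'I_n -> R) :
  (forall i, a i <= b i) ->
  lebesgue_rV R n [set v | forall i, v ord0 i \in `[a i, b i]] =
  (\prod_i (b i - a i))%:E.
Proof.
elim: n a b => [|n IH] a b ab.
  by rewrite big_ord0 /= /dirac indicE mem_set//; case.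
rewrite big_ord_recr /= EFinM -IH// /lebesgue_rV_step /pushforward.
pose w := widen_ord (leqnSn n).
have wE i : w i = lift ord_max i.
  by apply/val_inj; rewrite /= /bump leqNgt ltn_ord.
set B := [set v : 'rV[R]_n | forall i, v ord0 i \in `[a (w i), b (w i)]].
have mB : measurable B.
  rewrite (_ : B = \bigcap_(i in [set: 'I_n])
                     (@rV_coord R n i @^-1` `[a (w i), b (w i)])).
    apply: fin_bigcap_measurable => // i _.
    by rewrite -[X in measurable X]setTI; exact: measurable_rV_coord.
  by apply/seteqP; split => v /= H i; [move=> _|]; exact: H.
set C := _ @^-1` _.
have CE : C = B `*` [set` `[a ord_max, b ord_max]].
  rewrite /C; apply/seteqP; split => [[v x] /= H|[v x] /= [H1 H2] i].
    split; last by have := H ord_max; rewrite mxE unlift_none.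
    by move=> i; have := H (lift ord_max i); rewrite mxE liftK wE.
  by rewrite mxE; case: unliftP => [j ->|->//]; have := H1 j; rewrite wE.
have -> : (lebesgue_rV R n \x lebesgue_measure)%E C =
    (lebesgue_rV R n \x lebesgue_measure)%E
      (B `*` [set` `[a ord_max, b ord_max]]) by congr (_ _); exact: CE.
etransitivity; first by apply: product_measure1E.
congr (_ * _)%E; apply: etrans (lebesgue_measure_itv _) _ => /=.
by rewrite lte_fin; case: ltgtP (ab ord_max) => // -> _; rewrite subrr.
Qed.

Section sobolev.
Variables (R : realType) (N : nat).
Local Notation V := 'rV[R]_N.
Local Notation mu := (lebesgue_rV R N).
Implicit Types (Omega : set V) (u v phi : V -> R) (G : V -> V) (i : 'I_N).

Definition dotv (xi eta : V) : R := \sum_i xi ord0 i * eta ord0 i.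

Definition partial i phi : V -> R := 'D_(delta_mx ord0 i) phi.

(* All iterated partial derivatives exist and are continuous. *)
Definition smooth phi : Prop := forall s : seq 'I_N,
  let psi := foldr partial phi s in
  continuous psi /\ forall i x, derivable psi x (delta_mx ord0 i).

Definition test_function Omega phi : Prop :=
  let supp := closure [set x | phi x != 0] in
  [/\ smooth phi, compact supp & supp `<=` Omega].

(* L^p(Omega), with Omega measurable: the extension by zero u \_ Omega is
   measurable on R^N with finite L^p norm. *)
Definition Lp Omega (p : \bar R) u : Prop := u \_ Omega \in Lfun mu p.

Definition loc_integrable Omega u : Prop :=
  measurable_fun Omega u /\
  forall K, compact K -> K `<=` Omega -> mu.-integrable K (EFin \o u).

Definition is_weak_grad Omega u G : Prop :=
  [/\ loc_integrable Omega u,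
      forall i, loc_integrable Omega (fun x => G x ord0 i) &
      forall phi, test_function Omega phi -> forall i,
        \int[mu]_(x in Omega) (u x * partial i phi x) =
        - \int[mu]_(x in Omega) (G x ord0 i * phi x)].

(* A representative of the (a.e. unique) distributional gradient of u in
   Omega when it is a locally integrable function, and 0 otherwise. *)
Definition weak_grad Omega u : V -> V :=
  xget (fun=> 0) [set G | is_weak_grad Omega u G].

Definition H1 Omega u : Prop :=
  Lp Omega 2%:E u /\
  exists G, is_weak_grad Omega u G /\
            forall i, Lp Omega 2%:E (fun x => G x ord0 i).

Definition H1norm Omega u : \bar R :=
  ((\int[mu]_(x in Omega)
     ((u x) ^+ 2 + dotv (weak_grad Omega u x) (weak_grad Omega u x))%:E)
   `^ 2^-1)%E.

(* The closure of the test functions in H^1(Omega). *)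
Definition H10 Omega u : Prop :=
  H1 Omega u /\
  exists phi : nat -> V -> R,
    (forall k, test_function Omega (phi k)) /\
    H1norm Omega (phi k \- u) @[k --> \oo] --> 0%E.

(* Vectors are rows, so that the product of a matrix B and a vector xi is
   xi *m B^T. *)
Definition weak_solution Omega (A : V -> 'M[R]_N) (a : nat -> R)
    (g u : V -> R) : Prop :=
  [/\ {ae mu, forall x, Omega x -> 0 <= u x},
      H10 Omega u,
      Lp Omega +oo%E u &
      forall phi, H10 Omega phi ->
        \sum_(1 <= m < n)
          \int[mu]_(x in Omega)
            dotv (weak_grad Omega (fun y => u y ^+ m) x *m (a m *: A x)^T)
                 (weak_grad Omega phi x)
        @[n --> \oo] --> \int[mu]_(x in Omega) (g x * phi x)].

End sobolev.

(* Main.v *)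
(* Let u be a weak solution. The equation is tested with h(u) for smooth h with
   h(0) = 0, which belongs to H^1_0 with gradient h'(u) grad u.

   First, u <= k a.e. for every k > sigma. Take h positive exactly on ]k, +oo[ and
   J the integral of h'(u) A grad u . grad u. The m-th term of the series is at
   least a_m k^(m-1) J, and a_m k^m >= 1 for infinitely many m, so J = 0; thus
   h(u) has zero gradient, and it vanishes by the Poincare inequality. Hence
   u <= sigma a.e.

   Then let G_n(s) be the sum of the a_m s^m with 1 <= m < n, and B the sum of the
   a_m sigma^m. Testing with G_n(u) gives
     int G_n'(u)^2 A grad u . grad u <= lambda int f G_n(u) <= lambda B int f.
   Fix a test function phi with c = int f phi > 0. By Young's inequality for A,
     lambda c = lim_n int G_n'(u) A grad u . grad phi
             <= (t/2) lambda B int f + (2t)^-1 int A grad phi . grad phi,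
   which bounds lambda as soon as t B int f <= c. *)
From HB Require Import structures.
Require Import Defs.
From mathcomp Require Import all_boot all_order all_algebra.
From mathcomp Require Import all_classical all_reals all_analysis.
From mathcomp Require Import measurable_realfun ess_sup_inf ring lra.
Set Implicit Arguments.
Unset Strict Implicit.
Unset Printing Implicit Defensive.
Import Order.TTheory GRing.Theory Num.Theory.
Import numFieldNormedType.Exports.
Local Open Scope classical_set_scope.
Local Open Scope ring_scope.

(** * Lebesgue measure on R^n *)

(** The weak formulation gives a limit of integrals, never the integral of a series, so sum and
    integral are not interchanged. Two consequences of that convergence suffice: consecutive partial
    sums get arbitrarily close, which forces J = 0, and nondecreasing partial sums lie below their
    limit, which gives the energy bound once the series tested with G_n(u) is stopped at index n.
    The bound u <= sigma must precede it, since it makes G_n(u) <= B uniform in n.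

    The usual truncation (u - k)^+ is not smooth. A smooth function flat on ]-oo, k] replaces it:
    composition with it sends test functions to test functions, and what remains is to pass to
    limits in the H^1 norm. As the weak gradient is only a choice of representative, limits are
    taken for pairs (w, G) with an explicit G.

    In the final inequality lambda occurs on both sides. The number t is fixed independently of
    lambda so that half of the left side absorbs the right-hand term containing lambda; what is left
    bounds lambda by the data. *)

Section lebesgue_rV_theory.
Variable R : realType.
Variable n : nat.
Local Notation V := 'rV[R]_n.
Local Notation mu := (lebesgue_rV R n).

Definition box (a b : 'I_n -> R) : set V :=
  [set v | forall i, v ord0 i \in `[a i, b i]].

Lemma boxE (a b : 'I_n -> R) :
  box a b = \bigcap_(i in [set: 'I_n]) (@rV_coord R n i @^-1` `[a i, b i]).
Proof. by apply/seteqP; split => v /= H i; [move=> _|]; exact: H. Qed.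

Lemma measurable_box a b : measurable (box a b).
Proof.
rewrite boxE; apply: fin_bigcap_measurable => // i _.
by rewrite -[X in measurable X]setTI; exact: measurable_rV_coord.
Qed.

Lemma ball_rVE (x : V) (e : R) :
  0 < e -> ball x e = [set y : V | forall i, `|x ord0 i - y ord0 i| < e].
Proof.
move=> e0; apply/seteqP; split => [y [_ H] i|y H]; first exact: H.
by split=> // i j; rewrite (ord1 i); exact: H.
Qed.

Lemma measurable_ball_rV (x : V) (e : R) : 0 < e -> measurable (ball x e).
Proof.
move=> e0; rewrite ball_rVE// (_ : [set _ | _] =
  \bigcap_(i in [set: 'I_n]) (@rV_coord R n i @^-1` ball (x ord0 i) e)).
  apply: fin_bigcap_measurable => // i _.
  rewrite -[X in measurable X]setTI; apply: measurable_rV_coord => //.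
  by rewrite ball_itv; exact: measurable_itv.
by apply/seteqP; split => v /= H i; [move=> _|]; exact: H.
Qed.

Lemma rat_approx (x : V) (e : R) : 0 < e ->
  exists p : 'rV[rat]_n, ball (map_mx ratr p : V) e x.
Proof.
move=> e0.
have H i : exists r : rat, `|ratr r - x ord0 i| < e.
  have : x ord0 i - e < x ord0 i + e by lra.
  move=> /rat_in_itvoo[r]; rewrite in_itv/= => /andP[h1 h2].
  by exists r; rewrite ltr_distl; apply/andP; split; lra.
pose p i := projT1 (cid (H i)).
exists (\row_i p i); rewrite ball_rVE//= => i; rewrite !mxE.
by rewrite /p; case: cid.
Qed.

(** Asking the doubled ball to lie in [U] leaves room for a compact box between the small ball and
    [U]; [test_integral_eq0] localises in that room. *)
Lemma open_bigcup_ball (U : set V) : open U ->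
  U = \bigcup_(q in [set q : 'rV[rat]_n * nat |
         ball (map_mx ratr q.1 : V) (2 * q.2.+1%:R^-1) `<=` U])
        ball (map_mx ratr q.1 : V) (q.2.+1%:R^-1).
Proof.
move=> oU; apply/seteqP; split => [x Ux|x [q /= H]].
  have : nbhs x U by exact: open_nbhs_nbhs.
  move=> /nbhs_ballP[e /= e0 eU].
  (* With radius below e / 3, a centre that close to [x] has its doubled ball inside the ball of
     radius e about [x]. *)
  pose k := Num.truncn (3 / e).
  have k0 : 0 < k.+1%:R :> R by rewrite ltr0n.
  have ke : 3 * k.+1%:R^-1 < e.
    rewrite ltr_pdivrMr// mulrC -ltr_pdivrMr//.
    exact: truncnS_gt.
  have kp : 0 < k.+1%:R^-1 :> R by rewrite invr_gt0.
  have [p px] := rat_approx x kp.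
  exists (p, k) => //= y py; apply: eU.
  apply: (@le_ball _ _ _ (k.+1%:R^-1 + 2 * k.+1%:R^-1)); first by move: ke; set y0 := _^-1 => ke; lra.
  by apply: ball_triangle py; exact: ball_sym.
apply: subset_trans H x; apply: le_ball.
have : 0 < q.2.+1%:R^-1 :> R by rewrite invr_gt0 ltr0n.
by set y0 := _^-1; lra.
Qed.

Lemma open_measurable_rV (U : set V) : open U -> measurable U.
Proof.
move=> /open_bigcup_ball->; rewrite bigcup_mkcond.
apply: countable_bigcupT_measurable => // q.
by case: ifP => // _; apply: measurable_ball_rV; rewrite invr_gt0 ltr0n.
Qed.

Lemma closed_measurable_rV (U : set V) : closed U -> measurable U.
Proof.
move=> cU; rewrite -(setCK U); apply: measurableC.
by apply: open_measurable_rV; exact: closed_openC.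
Qed.

Lemma continuous_measurable_rV (f : V -> R) : continuous f ->
  measurable_fun setT f.
Proof.
move=> /continuousP cf; apply: (measurability _ (RGenOpens.measurableE R)).
move=> _ [_ [a [b ->]] <-]; rewrite setTI; apply: open_measurable_rV.
exact/cf/interval_open.
Qed.

(** A closed half-space x <= v_i is the countable union of the boxes with sides [[-k, k]], the i-th
    one cut to [[x, k]]. This puts the sigma-algebra in the form required for uniqueness of
    measures. *)
Lemma rV_measurableE :
  @measurable _ V = <<s [set C | exists a b, C = box a b] >>.
Proof.
apply/seteqP; split; last first.
  apply: smallest_sub; first exact: sigma_algebra_measurable.
  by move=> _ [a [b ->]]; exact: measurable_box.
apply: smallest_sub; first exact: smallest_sigma_algebra.
set G := [set C | _].
rewrite -bigcup_seq => A [i _ [B mB <-]] /=.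
rewrite setTI.
have : measurable_fun (setT : set (g_sigma_algebraType G)) (@rV_coord R n i).
  apply: (measurability _ (RGenCInfty.measurableE R)).
  move=> _ [_ [x ->] <-]; rewrite setTI.
  rewrite (_ : _ @^-1` _ = \bigcup_(k in [set: nat])
    box (fun j => if j == i then x else - k%:R) (fun=> k%:R)).
    apply: bigcup_measurable => k _; apply: sub_sigma_algebra.
    by exists (fun j => if j == i then x else - k%:R), (fun=> k%:R).
  apply/seteqP; split => [v /=|v /= [k _ /(_ i)]]; last first.
    by rewrite /rV_coord/= eqxx !in_itv/= => /andP[->].
  rewrite /rV_coord/= !in_itv/= andbT => xv.
  exists (Num.truncn `|v|).+1 => //= j.
  have : `|v ord0 j| <= (Num.truncn `|v|).+1%:R.
    apply: (@le_trans _ _ `|v|); last exact/ltW/truncnS_gt.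
    rewrite /Num.norm/= mx_normrE.
    by apply: (le_bigmax (0:R) (fun ij => `|v ij.1 ij.2|) (ord0, j)).
  rewrite ler_norml in_itv/=; case: eqP => [->|_] /andP[h1 h2].
    by rewrite xv h2.
  by rewrite h1 h2.
by move=> /(_ measurableT B mB); rewrite setTI.
Qed.

Lemma box_setI a b c d : box a b `&` box c d =
  box (fun i => Num.max (a i) (c i)) (fun i => Num.min (b i) (d i)).
Proof.
apply/seteqP; split => [v /= [H1 H2] i|v /= H].
  move: (H1 i) (H2 i); rewrite !in_itv/= => /andP[h1 h2] /andP[h3 h4].
  by rewrite ge_max le_min h1 h2 h3 h4.
split=> i; have := H i; rewrite !in_itv/= ge_max le_min;
  by move=> /andP[/andP[h1 h2] /andP[h3 h4]]; apply/andP.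
Qed.

Lemma bigcup_box : \bigcup_k box (fun=> - k%:R) (fun=> k%:R) = setT.
Proof.
apply/seteqP; split => // v _; exists (Num.truncn `|v|).+1 => //= j.
have : `|v ord0 j| <= (Num.truncn `|v|).+1%:R.
  apply: (@le_trans _ _ `|v|); last exact/ltW/truncnS_gt.
  rewrite /Num.norm/= mx_normrE.
  by apply: (le_bigmax (0:R) (fun ij => `|v ij.1 ij.2|) (ord0, j)).
by rewrite ler_norml in_itv/=.
Qed.

(** Boxes form a pi-system of sets of finite measure, and the boxes [[-k, k]^n] exhaust the space.
    Translation invariance and the fundamental lemma are both reduced to boxes in this way. *)
Lemma box_measure_unique (m1 m2 : {measure set V -> \bar R}) :
  (forall a b, (m1 (box a b) < +oo)%E) ->
  (forall a b, m1 (box a b) = m2 (box a b)) ->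
  forall E, measurable E -> m1 E = m2 E.
Proof.
move=> fin1 eq12 E mE.
apply: (measure_unique [set C | exists a b, C = box a b]
  (fun k => box (fun=> - k%:R) (fun=> k%:R))) => //.
- exact: rV_measurableE.
- move=> _ _ [a [b ->]] [c [d ->]]; rewrite box_setI.
  by eexists; eexists.
- by move=> k; eexists; eexists.
- exact: bigcup_box.
- by move=> _ [a [b ->]].
Qed.

Lemma lebesgue_rV_box_lty a b : (mu (box a b) < +oo)%E.
Proof.
have [ab|/existsNP[i /negP]] := pselect (forall i, a i <= b i).
  by rewrite lebesgue_rV_box// ltry.
rewrite -ltNge => ba; rewrite (_ : box a b = set0) ?measure0//.
apply/seteqP; split => // v /= /(_ i); rewrite in_itv/= => /andP[h1 h2].
by have := le_trans h1 h2; rewrite leNgt ba.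
Qed.

Lemma bounded_set_box (B : set V) : bounded_set B ->
  exists r, 0 < r /\ forall x, B x -> forall i, `|x ord0 i| <= r.
Proof.
move=> [M [_ /(_ (Num.max M 0 + 1))]] H; exists (Num.max M 0 + 1).
have M0 : 0 <= Num.max M 0 by rewrite le_max lexx orbT.
split; first lra.
move=> x Bx i; apply: (@le_trans _ _ `|x|); last first.
  apply: H => //; have : M <= Num.max M 0 by rewrite le_max lexx.
  lra.
rewrite /Num.norm/= mx_normrE.
by apply: (le_bigmax (0:R) (fun ij => `|x ij.1 ij.2|) (ord0, i)).
Qed.

Lemma bounded_measure_lty (B : set V) : bounded_set B -> measurable B ->
  (mu B < +oo)%E.
Proof.
move=> /bounded_set_box[r [r0 H]] mB.
apply: (@le_lt_trans _ _ (mu (box (fun=> - r) (fun=> r)))).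
  apply: le_measure; rewrite ?inE//; first exact: measurable_box.
  by move=> x Bx i; rewrite in_itv/= -ler_norml; exact: H.
exact: lebesgue_rV_box_lty.
Qed.

Lemma measurable_translate (c : V) : measurable_fun setT (fun x : V => x + c).
Proof.
apply: measurable_fun_rVP => i.
rewrite (_ : _ \o _ = fun x => rV_coord i x + c ord0 i).
  apply: measurable_funD; first exact: measurable_rV_coord.
  exact: measurable_cst.
by apply/funext => x; rewrite /rV_coord/= mxE.
Qed.



Lemma lebesgue_rV_translate (c : V) (E : set V) : measurable E ->
  mu ((fun x : V => x + c) @^-1` E) = mu E.
Proof.
move=> mE; apply/esym.
apply: (box_measure_unique (m2 := pushforward mu (fun x : V => x + c))) => //.
- exact: measurable_translate.
- exact: lebesgue_rV_box_lty.
move=> ? a b.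
transitivity (mu ((fun x : V => x + c) @^-1` box a b)); last by [].
rewrite (_ : _ @^-1` _ = box (fun i => a i - c ord0 i) (fun i => b i - c ord0 i)).
  (* The volume formula covers ordered sides only; a box with a reversed side is empty before and
     after the translation. *)
  have [ab|/existsNP[i /negP]] := pselect (forall i, a i <= b i).
    rewrite !lebesgue_rV_box//; last by move=> i; rewrite lerD2r.
    by congr EFin; apply: eq_bigr => i _; lra.
  rewrite -ltNge => ba.
  have B0 (a' b' : 'I_n -> R) : b' i < a' i -> box a' b' = set0.
    move=> h; apply/seteqP; split => // v /= /(_ i); rewrite in_itv/=.
    by move=> /andP[h1 h2]; have := le_trans h1 h2; rewrite leNgt h.
  by rewrite !B0// ltrD2r.
apply/seteqP; split => v /= H i; move: (H i);
  rewrite !in_itv/= !mxE => /andP[h1 h2]; apply/andP; split; lra.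
Qed.

End lebesgue_rV_theory.

(** * Smooth functions *)

Section smooth.
Variables (R : realType) (n : nat).
Local Notation V := 'rV[R]_n.
Local Notation e_ i := (delta_mx ord0 i : V).

Lemma is_derive_line (g : V -> R) (x v : V) (t : R) :
  derivable g (t *: v + x) v ->
  is_derive t (1 : R) (fun s : R => g (s *: v + x)) ('D_v g (t *: v + x)).
Proof.
move=> dg.
have E : (fun h : R => h^-1 *: (((fun s : R => g (s *: v + x)) \o shift t) (h *: 1) -
                             g (t *: v + x))) =
         (fun h => h^-1 *: ((g \o shift (t *: v + x)) (h *: v) - g (t *: v + x))).
  by apply/funext => h /=; rewrite scaler1 scalerDl addrA.
by split; [rewrite /derivable E|rewrite /derive E].
Qed.

(** Restriction to the line through [x] with direction [v] reduces this to the one-variable chain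
    rule, so a directional derivative of [f] is enough. *)
Lemma is_derive_comp_dir (h : R -> R) (f : V -> R) (x v : V) (a b : R) :
  is_derive (f x) (1 : R) h a -> is_derive x v f b -> is_derive x v (h \o f) (a * b).
Proof.
move=> hd [df fv].
have lineE (g : V -> R) : derivable g x v ->
    is_derive (0 : R) (1 : R) (fun t : R => g (t *: v + x)) ('D_v g x).
  by move=> dg; have := @is_derive_line g x v 0; rewrite scale0r add0r; exact.
have d1 := lineE _ df.
have d2 : is_derive (0 : R) (1 : R) (h \o (fun t : R => f (t *: v + x)))
    (a * 'D_v f x).
  by apply: is_derive1_comp; rewrite scale0r add0r.
have dhf : derivable (h \o f) x v by apply/(derivable1P (h \o f) x v); case: d2.
split => //; have [_ <-] := lineE _ dhf; case: d2 => _ ->.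
by rewrite fv.
Qed.

Definition smooth1 (h : R -> R) : Prop := forall k x, derivable (derive1n k h) x 1.

Lemma smooth1_derive h : smooth1 h -> smooth1 (derive1 h).
Proof. by move=> sh k x; rewrite -derive1Sn. Qed.

Lemma smooth1_is_derive h (x : R) : smooth1 h -> is_derive x (1 : R) h (derive1 h x).
Proof. by move=> /(_ 0 x) sh; split => //; rewrite derive1E. Qed.

Lemma smooth1_continuous h : smooth1 h -> continuous h.
Proof.
by move=> sh x; apply: differentiable_continuous; apply/derivable1_diffP/(sh 0).
Qed.

(** If every member of a class has its derivative in the class, iteration never leaves it.
    Smoothness is thus proved by exhibiting a stable class, without formulas for higher
    derivatives. *)
Lemma smooth1_family (P : set (R -> R)) :
  (forall f, P f -> exists2 g, P g & forall x : R, is_derive x (1 : R) f (g x)) ->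
  forall f, P f -> smooth1 f.
Proof.
move=> HP f Pf k x; suff /HP[g _ /(_ x)[]] : P (derive1n k f) by [].
elim: k => // k /HP[g Pg dg]; rewrite derive1nS.
suff -> : derive1 (derive1n k f) = g by [].
by apply/funext => y; rewrite derive1E; case: (dg y).
Qed.

Lemma smooth_partial (f : V -> R) i : smooth f -> smooth (partial i f).
Proof. by move=> sf s; rewrite -foldr_rcons; exact: sf. Qed.

Lemma smooth_is_derive (f : V -> R) x i : smooth f ->
  is_derive x (e_ i) f (partial i f x).
Proof. by move=> /(_ [::])[_ /(_ i x)] df; split. Qed.

Lemma smooth_continuous (f : V -> R) : smooth f -> continuous f.
Proof. by move=> /(_ [::])[]. Qed.

(** The principle of [smooth1_family] for iterated partial derivatives. *)
Lemma smooth_family (P : set (V -> R)) :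
  (forall f, P f -> continuous f /\
    forall i, exists2 g, P g & forall x, is_derive x (e_ i) f (g x)) ->
  forall f, P f -> smooth f.
Proof.
move=> HP f Pf s; suff /HP[cf df] : P (foldr (@partial R n) f s).
  by split => // i x; have [g _ /(_ x)[]] := df i.
elim: s => //= i s /HP[_ /(_ i)[g Pg dg]].
suff -> : partial i (foldr (@partial R n) f s) = g by [].
by apply/funext => y; rewrite /partial; case: (dg y).
Qed.

(* Closing smooth functions under composition with one-variable functions, sums
   and products gives a class stable under partial differentiation. *)
Inductive smooth_expr : (V -> R) -> Prop :=
| Smooth_atom f : smooth f -> smooth_expr f
| Smooth_comp h f : smooth1 h -> smooth f -> smooth_expr (h \o f)
| Smooth_add f g : smooth_expr f -> smooth_expr g -> smooth_expr (f + g)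
| Smooth_mul f g : smooth_expr f -> smooth_expr g -> smooth_expr (f * g).

Lemma smooth_exprP f : smooth_expr f -> smooth f.
Proof.
apply: smooth_family => {}f; elim => {f}.
- move=> f sf; split; first exact: smooth_continuous.
  move=> i; exists (partial i f); first exact/Smooth_atom/smooth_partial.
  by move=> x; exact: smooth_is_derive.
- move=> h f sh sf; split.
    move=> x; apply: continuous_comp; first exact: smooth_continuous.
    exact: smooth1_continuous.
  move=> i; exists ((derive1 h \o f) * partial i f).
    apply: Smooth_mul; first exact/Smooth_comp/sf/smooth1_derive.
    exact/Smooth_atom/smooth_partial.
  move=> x; apply: is_derive_comp_dir; first exact: smooth1_is_derive.
  exact: smooth_is_derive.
- move=> f g ef [cf df] eg [cg dg]; split.
    by move=> x; apply: continuousD; [exact: cf|exact: cg].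
  move=> i; have [f' ef' df'] := df i; have [g' eg' dg'] := dg i.
  by exists (f' + g'); [exact: Smooth_add|move=> x; exact: is_deriveD].
- move=> f g ef [cf df] eg [cg dg]; split.
    by move=> x; apply: continuousM; [exact: cf|exact: cg].
  move=> i; have [f' ef' df'] := df i; have [g' eg' dg'] := dg i.
  exists (f * g' + g * f').
    by apply: Smooth_add; exact: Smooth_mul.
  by move=> x; exact: is_deriveM.
Qed.

Lemma smooth_comp h (f : V -> R) : smooth1 h -> smooth f -> smooth (h \o f).
Proof. by move=> sh sf; apply: smooth_exprP; exact: Smooth_comp. Qed.

Lemma smoothD (f g : V -> R) : smooth f -> smooth g -> smooth (f + g).
Proof.
by move=> sf sg; apply: smooth_exprP; apply: Smooth_add; exact: Smooth_atom.
Qed.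

Lemma smoothM (f g : V -> R) : smooth f -> smooth g -> smooth (f * g).
Proof.
by move=> sf sg; apply: smooth_exprP; apply: Smooth_mul; exact: Smooth_atom.
Qed.

Lemma smooth_cst (c : R) : smooth (cst c : V -> R).
Proof.
apply: (@smooth_family [set f | exists c, f = cst c]); last by exists c.
move=> _ [d ->]; split; first by move=> x; exact: cst_continuous.
by move=> i; exists (cst 0); [exists 0|move=> x; exact: is_derive_cst].
Qed.

Lemma is_derive_coord i j (x : V) :
  is_derive x (e_ j) (rV_coord i : V -> R) (j == i)%:R.
Proof.
have H : (fun h : R => h^-1 *: ((rV_coord i \o shift x) (h *: e_ j) - rV_coord i x))
    @ 0^' --> ((j == i)%:R : R).
  apply: cvg_near_cst; near=> h.
  have h0 : h != 0 by near: h; exact: nbhs_dnbhs_neq.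
  rewrite /rV_coord /= !mxE eqxx/= addrK eq_sym.
  by rewrite /GRing.scale/= mulrA mulVf// mul1r.
split; [by apply/cvg_ex; exists (j == i)%:R|exact: cvg_lim].
Unshelve. all: by end_near.
Qed.

Lemma smooth_coord i : smooth (rV_coord i : V -> R).
Proof.
apply: (@smooth_family
  [set f | f = rV_coord i \/ exists c, f = cst c]); last by left.
move=> _ [->|[d ->]]; split; last 2 first.
- by move=> x; exact: cst_continuous.
- by move=> j; exists (cst 0); [right; exists 0|move=> x; exact: is_derive_cst].
- by move=> x; exact: coord_continuous.
move=> j; exists (cst (j == i)%:R); first by right; exists (j == i)%:R.
by move=> x; exact: is_derive_coord.
Qed.

Lemma smooth_prod (I : Type) (r : seq I) (F : I -> V -> R) :
  (forall i, smooth (F i)) -> smooth (fun x => \prod_(i <- r) F i x).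
Proof.
move=> sF; elim: r => [|i r ih].
  rewrite (_ : (fun _ => _) = cst 1); first exact: smooth_cst.
  by apply/funext => x; rewrite big_nil.
rewrite (_ : (fun _ => _) = F i * (fun x => \prod_(j <- r) F j x)).
  exact: smoothM.
by apply/funext => x; rewrite big_cons.
Qed.

End smooth.


(** * A smooth function positive exactly on the positive half-line *)

Section bumpf.
Variable R : realType.

(* The class of the products of [expR (- s^-1)] with a power of [s^-1] is spanned
   by these functions and stable under differentiation. *)
Definition bumpk (k : nat) (s : R) : R :=
  if 0 < s then s^-1 ^+ k * expR (- s^-1) else 0.

(** With m = k + 2 and y = 1/s, the m-th power of y/m <= exp(y/m) gives (y/m)^m <= exp y. The two
    extra powers leave a factor s^2, which makes the derivative at 0 vanish. *)
Lemma bumpk_le k s : 0 <= bumpk k s <= k.+2%:R ^+ k.+2 * s ^+ 2.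
Proof.
rewrite /bumpk; case: ltP => [s0|_]; last first.
  by rewrite lexx mulr_ge0 ?sqr_ge0 ?exprn_ge0.
have si : 0 < s^-1 by rewrite invr_gt0.
apply/andP; split; first by rewrite mulr_ge0 ?expR_ge0// exprn_ge0// ltW.
have m0 : 0 < k.+2%:R :> R by [].
have H : (s^-1 / k.+2%:R) ^+ k.+2 <= expR (s^-1).
  apply: (@le_trans _ _ (expR (s^-1 / k.+2%:R) ^+ k.+2)).
    rewrite lerXn2r// ?nnegrE ?expR_ge0// ?divr_ge0//; first exact: ltW.
    by set y := _ / _; have := expR_ge1Dx y; lra.
  by rewrite -expRM_natl mulrC -mulrA mulVf ?mulr1// gt_eqF.
rewrite expRN -(ler_pM2r (expR_gt0 s^-1)) -mulrA mulVf ?mulr1 ?gt_eqF ?expR_gt0//.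
apply: le_trans (ler_wpM2l _ H); last first.
  by rewrite mulr_ge0// ?exprn_ge0// ?sqr_ge0// ltW.
rewrite expr_div_n; set P := k.+2%:R ^+ k.+2.
have P0 : P != 0 by rewrite expf_neq0// gt_eqF.
have sn : s != 0 by rewrite gt_eqF.
set Q := s^-1 ^+ k; have -> : s^-1 ^+ k.+2 = Q * s^-1 ^+ 2.
  by rewrite -addn2 exprD.
rewrite le_eqVlt; apply/orP; left; apply/eqP; field; by rewrite ?P0 ?sn.
Qed.

Definition bumpk_der (k : nat) (s : R) : R := bumpk k.+2 s - k%:R * bumpk k.+1 s.

Lemma is_derive_bumpk k (s : R) : is_derive s (1 : R) (bumpk k) (bumpk_der k s).
Proof.
have [s0|s0|->] := ltgtP s 0.
- have -> : bumpk_der k s = 0.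
    by rewrite /bumpk_der /bumpk ltNge (ltW s0)/= mulr0 subr0.
  apply: (@near_eq_is_derive _ _ _ (fun=> 0 : R)).
  near=> t; rewrite /bumpk ltNge (_ : t <= 0)//.
  by near: t; exact: lt_le_nbhsl.
- have sn : s != 0 by rewrite gt_eqF.
  have D : is_derive s (1 : R) (fun t : R => t^-1 ^+ k * expR (- t^-1)) (bumpk_der k s).
    have d1 : is_derive s (1 : R) (fun t : R => t^-1) (- s ^- 2 *: 1).
      exact: is_deriveV.
    have d2 : is_derive s (1 : R) (fun t : R => expR (- t^-1)) (expR (- s^-1) * s ^- 2).
      have -> : expR (- s^-1) * s ^- 2 = expR (- s^-1) * - (- s ^- 2 *: 1).
        by rewrite /GRing.scale/= mulr1 opprK.
      exact: is_derive1_comp.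
    have d3 := is_deriveX k d1.
    rewrite (_ : (fun _ => _) =
      (fun t : R => t^-1) ^+ k * (fun t => expR (- t^-1))); last first.
      by apply/funext => t; rewrite !fctE.
    apply: (is_derive_eq (is_deriveM d3 d2)).
    rewrite /bumpk_der /bumpk s0 /GRing.scale/= mulr1.
    rewrite !fctE -!exprVn; set E := expR _; set w := s^-1.
    case: k d3 => [|k] _ /=; rewrite ?exprS ?expr0; by ring.
  apply: (near_eq_is_derive _ D).
  near=> t; rewrite /bumpk (_ : 0 < t)//.
  by near: t; exact: lt_nbhsr.
(* At 0 the quadratic bound makes the difference quotient at most [C * |h|]. *)
- have b0 : bumpk_der k 0 = 0 by rewrite /bumpk_der /bumpk ltxx mulr0 subr0.
  rewrite b0.
  have H : (fun h : R => h^-1 *: ((bumpk k \o shift 0) (h *: 1) - bumpk k 0))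
    @ 0^' --> (0 : R).
    apply/cvgrPdist_le => e e0.
    pose C : R := k.+2%:R ^+ k.+2.
    have C0 : 0 < C by rewrite exprn_gt0.
    near=> h.
    have h0 : h != 0 by near: h; exact: nbhs_dnbhs_neq.
    have hC : `|h| <= e / C.
      near: h; apply: nbhs_dnbhs; apply: (@nbhs0_le _ R).
      exact: divr_gt0.
    rewrite sub0r normrN /= scaler1 addr0 {2}/bumpk ltxx subr0.
    have /andP[h1 h2] := bumpk_le k h.
    rewrite normrM normfV ler_pdivrMl ?normr_gt0// ger0_norm//.
    apply: (le_trans h2); rewrite -/C -real_normK ?num_real// expr2.
    rewrite mulrCA ler_wpM2l// mulrC -ler_pdivlMr//.
  split; [by apply/cvg_ex; exists 0|exact: cvg_lim].
Unshelve. all: by end_near.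
Qed.

Definition bumpf : R -> R := bumpk 0.

Lemma smooth1_bumpf : smooth1 bumpf.
Proof.
apply: (@smooth1_family _ [set f | exists r : seq (nat * R),
  f = fun s => \sum_(p <- r) p.2 * bumpk p.1 s]); last first.
  exists [:: (0%N, 1)]; apply/funext => s.
  by rewrite big_seq1 mul1r.
move=> _ [r ->].
exists (fun s => \sum_(p <- r) p.2 * bumpk_der p.1 s).
  exists (flatten [seq [:: (p.1.+2, p.2); (p.1.+1, - (p.2 * p.1%:R))] | p <- r]).
  apply/funext => s; rewrite big_flatten/= big_map; apply: eq_bigr => p _.
  by rewrite !big_cons big_nil /bumpk_der/=; ring.
move=> s; elim: r => [|p r ih].
  rewrite (_ : (fun _ => _) = cst 0); last by apply/funext => t; rewrite big_nil.
  by rewrite big_nil; exact: is_derive_cst.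
rewrite (_ : (fun _ => _) = (fun t => p.2 *: bumpk p.1 t) +
    (fun t => \sum_(p <- r) p.2 * bumpk p.1 t)); last first.
  by apply/funext => t; rewrite big_cons.
rewrite big_cons; apply: is_deriveD.
by apply: is_deriveZ; exact: is_derive_bumpk.
Qed.

Lemma bump_gt0 s : (0 < bumpf s) = (0 < s).
Proof.
rewrite /bumpf /bumpk; case: (ltP 0 s) => s0; last by rewrite ltxx.
by rewrite expr0 mul1r expR_gt0.
Qed.

Lemma bump_ge0 s : 0 <= bumpf s.
Proof. by have /andP[] := bumpk_le 0 s. Qed.

Lemma bump_le1 s : bumpf s <= 1.
Proof.
rewrite /bumpf /bumpk; case: (ltP 0 s) => // s0; rewrite expr0 mul1r.
by rewrite -[leRHS]expR0 ler_expR oppr_le0 invr_ge0 ltW.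
Qed.

Lemma bump_eq0 s : s <= 0 -> bumpf s = 0.
Proof. by rewrite /bumpf /bumpk leNgt; case: ifP. Qed.


(** For s > 0, 1 - 1/s <= exp(-1/s) <= 1. *)
Lemma bump_cvg1 (u : R^nat) : u @ \oo --> +oo -> bumpf \o u @ \oo --> (1 : R).
Proof.
move=> uy; apply/cvgrPdist_le => e e0.
have /(_ (num_real e^-1)) := @nbhs_pinfty_gt R e^-1.
move=> /uy uk0; near=> k.
have uk : e^-1 < u k by near: k; exact: uk0.
rewrite /=.
have u0 : 0 < u k by apply: lt_trans uk; rewrite invr_gt0.
rewrite ger0_norm ?subr_ge0 ?bump_le1// lerBlDr -lerBlDl.
rewrite /bumpf /bumpk u0 expr0 mul1r.
apply: (@le_trans _ _ (1 - (u k)^-1)); last exact: expR_ge1Dx.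
by rewrite lerB// invf_ple ?posrE// ltW.
Unshelve. all: by end_near.
Qed.

Lemma bump_der_gt0 s : 0 < s -> 0 < derive1 bumpf s.
Proof.
move=> s0; rewrite derive1E; case: (is_derive_bumpk 0 s) => _ ->.
rewrite /bumpk_der mul0r subr0 /bumpk s0 mulr_gt0 ?expR_gt0//.
by rewrite exprn_gt0// invr_gt0.
Qed.

Lemma bump_der_eq0 s : s <= 0 -> derive1 bumpf s = 0.
Proof.
move=> s0; rewrite derive1E; case: (is_derive_bumpk 0 s) => _ ->.
by rewrite /bumpk_der mul0r subr0 /bumpk ltNge s0.
Qed.

End bumpf.

(** * Integration by parts *)

Section integration_rV.
Variables (R : realType) (n : nat).
Local Notation V := 'rV[R]_n.
Local Notation mu := (lebesgue_rV R n).
Local Notation e_ i := (delta_mx ord0 i : V).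

Lemma compact_rV_closed (K : set V) : compact K -> closed K.
Proof. by move=> cK; apply: compact_closed => //; exact: norm_hausdorff. Qed.

Lemma compact_box (a b : 'I_n -> R) : compact (box a b).
Proof.
apply: (@rV_compact R n (fun i => `[a i, b i]%classic)) => i.
exact: segment_compact.
Qed.

Lemma compact_support_bounded (f : V -> R) (K : set V) :
  continuous f -> compact K -> (forall x, ~ K x -> f x = 0) ->
  exists2 M, 0 < M & forall x, `|f x| <= M.
Proof.
move=> cf cK f0.
have /compact_bounded [M [_ HM]] : compact [set f x | x in K].
  apply: continuous_compact => //; exact: continuous_subspaceT.
exists (Num.max M 0 + 1); first by rewrite ltr_wpDl// le_max lexx orbT.
have M0 : 0 <= Num.max M 0 by rewrite le_max lexx orbT.
move=> x; have [Kx|nKx] := pselect (K x).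
  apply: HM; last by exists x.
  by rewrite (@le_lt_trans _ _ (Num.max M 0))// ?le_max ?lexx// ltrDl.
by rewrite f0// normr0 addr_ge0.
Qed.

Lemma compact_support_integrable (f : V -> R) (K : set V) :
  continuous f -> compact K -> (forall x, ~ K x -> f x = 0) ->
  mu.-integrable setT (EFin \o f).
Proof.
move=> cf cK f0.
have mK : measurable K by apply: closed_measurable_rV; exact: compact_rV_closed.
have [M M0 fM] := compact_support_bounded cf cK f0.
rewrite (_ : EFin \o f = (EFin \o f) \_ K); last first.
  apply/funext => x; rewrite patchE; case: ifPn => // /negP xK /=.
  by rewrite f0// => Kx; apply: xK; rewrite inE.
apply/(integrable_mkcond _ mK); apply: measurable_bounded_integrable => //.
- by apply: bounded_measure_lty => //; exact: compact_bounded.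
- by apply: measurable_funTS; exact: continuous_measurable_rV.
- exists M; split; first exact: num_real.
  by move=> r Mr x _ /=; apply: le_trans (fM x) (ltW Mr).
Qed.

Lemma integral_translate (f : V -> R) (c : V) : mu.-integrable setT (EFin \o f) ->
  \int[mu]_x f (x + c) = \int[mu]_x f x.
Proof.
move=> fi; rewrite /Rintegral; congr fine.
have mt := @measurable_translate R n c.
have eqm A : measurable A -> A `<=` [set: V] ->
    mu A = pushforward mu (fun x : V => x + c) A.
  by move=> mA _; rewrite /pushforward lebesgue_rV_translate.
rewrite [RHS](eq_measure_integral (pushforward mu (fun x : V => x + c)))//.
have /integrableP[mf fy] := fi.
have ifc : mu.-integrable ((fun x : V => x + c) @^-1` setT)
    ((EFin \o f) \o (fun x : V => x + c)).
  rewrite preimage_setT; apply/integrableP; split; first exact: measurableT_comp mf mt.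
  move: fy; rewrite (eq_measure_integral (pushforward mu (fun x : V => x + c)))//.
  rewrite (ge0_integral_pushforward mt)//.
  by apply: measurableT_comp => //; exact: measurable_abse.
by rewrite (integral_pushforward mt mf ifc measurableT).
Qed.

Lemma partial_eq0 (f : V -> R) (K : set V) i : closed K ->
  (forall x, ~ K x -> f x = 0) -> forall x, ~ K x -> partial i f x = 0.
Proof.
move=> cK f0 x nKx; rewrite /partial (@near_eq_derive _ _ _ _ (cst 0)).
  by rewrite derive_cst.
have : nbhs x (~` K).
  by apply: open_nbhs_nbhs; split => //; exact: closed_openC.
by apply: filterS => y /f0.
Qed.

(** The integral of the translate y |-> f(y + t e_i) does not depend on t; differentiating it under
    the integral sign at t = 0 gives the claim, with no Fubini argument. *)
Lemma integral_partial (f : V -> R) (K : set V) i : smooth f -> compact K ->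
  (forall x, ~ K x -> f x = 0) -> \int[mu]_x partial i f x = 0.
Proof.
move=> sf cK f0.
have df0 := @partial_eq0 f K i (compact_rV_closed cK) f0.
have sdf := smooth_partial i sf.
have [M M0 dfM] := compact_support_bounded (smooth_continuous sdf) cK df0.
have fi := compact_support_integrable (smooth_continuous sf) cK f0.
have [r [r0 Kr]] := bounded_set_box (compact_bounded cK).
pose F (t : R) (y : V) := f (t *: e_ i + y).
have dF (t : R) y : is_derive t (1 : R) (F ^~ y) (partial i f (t *: e_ i + y)).
  exact/is_derive_line/(@ex_derive _ _ _ _ _ _ _ (smooth_is_derive (t *: e_ i + y) i sf)).
have pF t y : partial1of2 F t y = partial i f (t *: e_ i + y).
  by rewrite /partial1of2 derive1E; case: (dF t y).
(* One unit of margin: for |t| < 1 the translated support stays in [B], so [M] on [B] dominates all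
   the derivatives. *)
pose B : set V := box (fun=> - (r + 1)) (fun=> r + 1).
have mB : measurable B by exact: measurable_box.
have KB t y : - 1 < t -> t < 1 -> K (y + t *: e_ i) -> B y.
  move=> t1 t2 /Kr H1 j.
  have := H1 j; rewrite !mxE !eqxx/= in_itv/= -ler_norml => H2.
  have -> : y ord0 j = (y ord0 j + t * (j == i)%:R) - t * (j == i)%:R by ring.
  apply: (le_trans (ler_normB _ _)); apply: lerD => //.
  rewrite normrM; case: eqP; rewrite ?normr1 ?normr0 ?mulr1 ?mulr0// ler_norml.
  by rewrite !ltW.
have IF t : \int[mu]_y F t y = \int[mu]_y f y.
  rewrite -(integral_translate (t *: e_ i) fi); apply: eq_Rintegral => y _.
  by rewrite /F addrC.
have := @differentiation_under_integral R _ _ mu F setT measurableT 0 (- 1) 1.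
rewrite /= in_itv/= ltrN10 ltr01 => /(_ isT) H.
have {H} := H _ _ (cst M \_ B).
have -> : (fun t : R => \int[mu]_y F t y) = cst (\int[mu]_y f y).
  by apply/funext => t; exact: IF.
rewrite derive1_cst => H; apply/esym.
transitivity (\int[mu]_y partial1of2 F 0 y); last first.
  by apply: eq_Rintegral => y _; rewrite pF scale0r add0r.
apply: H.
- move=> t; rewrite in_itv/= => /andP[t1 t2]; rewrite (_ : F t = (fun y => f (y + t *: e_ i))); last first.
    by apply/funext => y; rewrite /F addrC.
  have cF : continuous (fun y : V => f (y + t *: e_ i)).
    move=> y; apply: continuous_comp; last exact: smooth_continuous.
    by apply: continuousD; [exact: id|exact: cst_continuous].
  have g0 : forall y, ~ B y -> f (y + t *: e_ i) = 0.
    by move=> y nB; apply: f0 => Ky; apply: nB; exact: KB t y t1 t2 Ky.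
  have cB : compact B by exact: compact_box.
  have := compact_support_integrable cF cB g0.
  exact.
- by move=> t y _ _; case: (dF t y).
- by move=> y; rewrite patchE; case: ifP => // _; exact: ltW.
- rewrite (_ : EFin \o _ = (EFin \o cst M) \_ B); last first.
    by apply/funext => y; rewrite /= !patchE; case: ifP.
  apply/(integrable_mkcond _ mB); apply: measurable_bounded_integrable => //.
    exact: lebesgue_rV_box_lty.
  exists M; split; first exact: num_real.
  by move=> u Mu y _ /=; rewrite ger0_norm ltW.
- move=> t y; rewrite in_itv/= => /andP[t1 t2] _; rewrite pF patchE.
  case: ifPn => [_|/negP nB]; first exact: dfM.
  rewrite df0 ?normr0// addrC => Ky; apply: nB; rewrite inE.
  exact: KB t y t1 t2 Ky.
Qed.

Variable Omega : set V.
Hypothesis oO : open Omega.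

Let mO : measurable Omega := open_measurable_rV oO.

Lemma test_function_smooth phi : test_function Omega phi -> smooth phi.
Proof. by case. Qed.

Lemma test_function_supp phi : test_function Omega phi ->
  exists K, [/\ compact K, K `<=` Omega, closed K &
    forall x, ~ K x -> phi x = 0].
Proof.
case=> sp cs sO; exists (closure [set x | phi x != 0]); split => //.
  exact: closed_closure.
move=> x H; apply/eqP/negPn/negP => px; apply: H; exact: subset_closure.
Qed.

Lemma test_functionI phi (K : set V) : smooth phi -> compact K -> K `<=` Omega ->
  (forall x, ~ K x -> phi x = 0) -> test_function Omega phi.
Proof.
move=> sp cK KO p0.
have sub : closure [set x | phi x != 0] `<=` K.
  rewrite [X in _ `<=` X](closure_id K).1; last exact: compact_rV_closed.
  by apply: closure_subset => x /= /eqP px; apply: contrapT => /p0.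
split => //; last exact: subset_trans sub KO.
apply: subclosed_compact sub => //; exact: closed_closure.
Qed.

Lemma test_functionM_l (f phi : V -> R) : smooth f -> test_function Omega phi ->
  test_function Omega (f * phi).
Proof.
move=> sf tp; have [K [cK KO _ p0]] := test_function_supp tp.
apply: (test_functionI _ cK KO); first exact/smoothM/test_function_smooth.
by move=> x /p0 px; rewrite fctE px mulr0.
Qed.

(** [h 0 = 0] keeps the composite zero off the support of [phi]. *)
Lemma test_function_comp (h : R -> R) (phi : V -> R) : smooth1 h -> h 0 = 0 ->
  test_function Omega phi -> test_function Omega (h \o phi).
Proof.
move=> sh h0 tp; have [K [cK KO _ p0]] := test_function_supp tp.
apply: (test_functionI _ cK KO); first exact/smooth_comp/test_function_smooth.
by move=> x /p0 /= ->.
Qed.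

(** This is [integral_partial] for [phi * eta]. The product vanishes off the compact support of
    [eta], for any smooth [phi], and for the same reason integrals over [Omega] are integrals over
    the whole space. *)
Lemma integral_by_parts phi eta i : smooth phi -> test_function Omega eta ->
  \int[mu]_(x in Omega) (phi x * partial i eta x) =
  - \int[mu]_(x in Omega) (partial i phi x * eta x).
Proof.
move=> sp te.
have se := test_function_smooth te.
have [K [cK KO clK e0]] := test_function_supp te.
have de0 := @partial_eq0 eta K i clK e0.
have pe0 x : ~ K x -> (phi * eta) x = 0 by move=> /e0 h; rewrite fctE h mulr0.
have := integral_partial i (smoothM sp se) cK pe0.
have OE (f : V -> R) : (forall x, ~ K x -> f x = 0) ->
    \int[mu]_(x in Omega) f x = \int[mu]_x f x.
  move=> f0; rewrite Rintegral_mkcond; apply: eq_Rintegral => x _.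
  rewrite patchE; case: ifPn => // /negP xO; rewrite f0// => /KO Ox.
  by apply: xO; rewrite inE.
rewrite [X in _ -> X = _]OE; last by move=> x /de0 ->; rewrite mulr0.
rewrite [X in _ -> _ = - X]OE; last by move=> x /e0 ->; rewrite mulr0.
have -> : partial i (phi * eta) =
    (fun x => phi x * partial i eta x + partial i phi x * eta x).
  apply/funext => x; rewrite /partial deriveM.
  - by rewrite /GRing.scale/= [eta x * _]mulrC.
  - exact: (@ex_derive _ _ _ _ _ _ _ (smooth_is_derive x i sp)).
  - exact: (@ex_derive _ _ _ _ _ _ _ (smooth_is_derive x i se)).
rewrite RintegralD//.
- by move=> /eqP; rewrite addr_eq0 => /eqP.
- apply: (@compact_support_integrable (fun x => phi x * partial i eta x) K) => //.
  + exact: (smooth_continuous (smoothM sp (smooth_partial i se))).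
  + by move=> x /de0 ->; rewrite mulr0.
- apply: (@compact_support_integrable (fun x => partial i phi x * eta x) K) => //.
  + exact: (smooth_continuous (smoothM (smooth_partial i sp) se)).
  + by move=> x /e0 ->; rewrite mulr0.
Qed.

End integration_rV.

(** * The fundamental lemma of the calculus of variations *)

Section fundamental_lemma.
Variables (R : realType) (n : nat).
Local Notation V := 'rV[R]_n.
Local Notation mu := (lebesgue_rV R n).

Section density_measure.
Variable f : V -> \bar R.
Hypotheses (mf : measurable_fun setT f) (f0 : forall x, (0 <= f x)%E).

(** Made a measure so that [box_measure_unique] applies to the positive and negative parts of an
    integrand. *)
Definition density_measure (E : set V) : \bar R := (\int[mu]_(x in E) f x)%E.

Let density_measure0 : density_measure set0 = 0%E.
Proof. exact: integral_set0. Qed.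

Let density_measure_ge0 E : (0 <= density_measure E)%E.
Proof. exact: integral_ge0. Qed.

Let density_measure_sigma_additive : semi_sigma_additive density_measure.
Proof.
move=> F mF tF mUF; rewrite /density_measure ge0_integral_bigcup//.
  by apply: is_cvg_nneseries => k _ _; exact: integral_ge0.
exact: measurable_funTS.
Qed.

HB.instance Definition _ := isMeasure.Build _ _ _ density_measure
  density_measure0 density_measure_ge0 density_measure_sigma_additive.

Definition density_of : {measure set V -> \bar R} := density_measure.

End density_measure.

(** The measures with densities g^+ and g^- agree on boxes, hence everywhere; so g^+ = g^- a.e.,
    which forces g = 0. *)
Lemma box_integral_eq0 (g : V -> \bar R) (D : set V) : measurable D ->
  mu.-integrable D g ->
  (forall a b, (\int[mu]_(x in D `&` box a b) g x = 0)%E) ->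
  {ae mu, forall x, D x -> g x = 0%E}.
Proof.
move=> mD ig g0.
have mg := measurable_int _ ig.
pose f1 := g^\+%E \_ D; pose f2 := g^\-%E \_ D.
have mf1 : measurable_fun setT f1.
  by apply/(measurable_restrictT _ mD); exact: measurable_funepos.
have mf2 : measurable_fun setT f2.
  by apply/(measurable_restrictT _ mD); exact: measurable_funeneg.
have f10 x : (0 <= f1 x)%E by rewrite /f1 patchE; case: ifP.
have f20 x : (0 <= f2 x)%E by rewrite /f2 patchE; case: ifP.
have if1 : mu.-integrable setT f1.
  by apply/(integrable_mkcond _ mD); exact: integrable_funepos.
have if2 : mu.-integrable setT f2.
  by apply/(integrable_mkcond _ mD); exact: integrable_funeneg.
have fin1 a b : (density_of mf1 f10 (box a b) < +oo)%E.
  have mB := @measurable_box R n a b.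
  have := integrableS measurableT mB (@subsetT _ _) if1.
  move=> /integrable_fin_num -/(_ mB); rewrite ge0_fin_numE//.
  exact: integral_ge0.
have eqb a b : density_of mf1 f10 (box a b) = density_of mf2 f20 (box a b).
  have mB := @measurable_box R n a b.
  rewrite /density_of/= /density_measure /f1 /f2 -!integral_mkcondr setIC.
  have iDB : mu.-integrable (D `&` box a b) g.
    by apply: integrableS ig => //; exact: measurableI.
  move: (integralE mu (D `&` box a b) g); rewrite g0 => /esym/eqP.
  rewrite sube_eq; last 2 first.
  - apply: integrable_pos_fin_num => //; exact: measurableI.
  - by rewrite fin_num_adde_defr//.
  by rewrite add0e => /eqP.
have eqE := box_measure_unique fin1 eqb.
have : ae_eq mu setT f1 f2.
  by apply: integral_ae_eq => // E _ mE; exact: eqE.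
apply: filterS => x /(_ I); rewrite /f1 /f2 !patchE => + Dx.
rewrite mem_set// => e12.
move: e12; rewrite funeposE funenegE; case: (g x) => [r| |].
- rewrite /= -!EFin_max => -[]; case: (leP r 0); case: (leP (- r) 0) => h1 h2 h3;
  congr EFin; lra.
- by rewrite maxye maxNye.
- by rewrite maxye maxNye.
Qed.

End fundamental_lemma.

(** * Smooth approximation of indicators of boxes *)

Section box_approximation.
Variables (R : realType) (n : nat).
Local Notation V := 'rV[R]_n.
Local Notation mu := (lebesgue_rV R n).

(* Each factor is at least [bumpf d] on the box and vanishes beyond distance
   [d^-1] from it; the product tends to the indicator of the box as [d --> +oo]. *)
Definition box_bump (a b : 'I_n -> R) (d : R) (x : V) : R :=
  \prod_(i < n) (bumpf (d ^+ 2 * (x ord0 i - a i) + d) *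
                 bumpf (d ^+ 2 * (b i - x ord0 i) + d)).

Lemma smooth_box_bump a b d : smooth (box_bump a b d).
Proof.
apply: smooth_prod => i.
have saff (c e : R) : smooth (cst c * rV_coord i + cst e : V -> R).
  by apply: smoothD; [apply: smoothM; [exact: smooth_cst|exact: smooth_coord]
                     |exact: smooth_cst].
rewrite (_ : (fun _ => _) =
  (@bumpf R \o (cst (d ^+ 2) * @rV_coord R n i + cst (d - d ^+ 2 * a i))) *
  (@bumpf R \o (cst (- d ^+ 2) * @rV_coord R n i + cst (d ^+ 2 * b i + d)))).
  by apply: smoothM; apply: smooth_comp => //; exact: smooth1_bumpf.
apply/funext => x; rewrite !fctE /= /rV_coord /cst.
by congr (bumpf _ * bumpf _); ring.
Qed.

Lemma box_bump_ge0 a b d x : 0 <= box_bump a b d x.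
Proof. by apply: prodr_ge0 => i _; rewrite mulr_ge0// bump_ge0. Qed.

Lemma box_bump_le1 a b d x : box_bump a b d x <= 1.
Proof.
apply: prodr_ile1 => i _; rewrite mulr_ge0 ?bump_ge0//=.
by rewrite mulr_ile1 ?bump_ge0 ?bump_le1.
Qed.

Lemma box_bump_eq0 a b d x : 0 < d ->
  ~ box (fun i => a i - d^-1) (fun i => b i + d^-1) x -> box_bump a b d x = 0.
Proof.
move=> d0 /existsNP[i /negP]; rewrite in_itv/= negb_and -!ltNge => H.
rewrite /box_bump (bigD1 i)//=.
have dd : d ^+ 2 * d^-1 = d by rewrite expr2 -mulrA divff ?mulr1// gt_eqF.
have d20 : 0 < d ^+ 2 by rewrite exprn_gt0.
case/orP: H => H.
  rewrite bump_eq0 ?mul0r// -[X in _ + X]dd -mulrDr pmulr_rle0//; lra.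
rewrite [X in _ * X * _]bump_eq0 ?mulr0 ?mul0r//.
by rewrite -[X in _ + X]dd -mulrDr pmulr_rle0//; lra.
Qed.

(** The argument d^2 y + d is at least d for y >= 0, boundary points included, which is why the
    limit is the indicator of the closed box. For y < 0 it is nonpositive as soon as d >= -1/y. *)
Lemma box_bump_cvg a b (d : R^nat) x : (forall k, 0 < d k) -> d @ \oo --> +oo ->
  box_bump a b (d k) x @[k --> \oo] --> (\1_(box a b) x : R).
Proof.
move=> d0 dy.
have far y : y < 0 -> \forall k \near \oo, bumpf (d k ^+ 2 * y + d k) = 0.
  move=> y0; have H := dy _ (nbhs_pinfty_gt (num_real (- y^-1))).
  near=> k; have dk : - y^-1 < d k by near: k; exact: H.
  apply: bump_eq0; rewrite expr2 -mulrA -[X in _ + X]mulr1 -mulrDr.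
  rewrite pmulr_rle0//.
  have : - y^-1 * - y < d k * - y by rewrite ltr_pM2r// oppr_gt0.
  by rewrite mulrNN mulVf ?lt_eqF//; lra.
have close y : 0 <= y -> bumpf (d k ^+ 2 * y + d k) @[k --> \oo] --> (1 : R).
  move=> y0; apply: (@bump_cvg1 R (fun k => d k ^+ 2 * y + d k)).
  apply: ger_cvgy dy; apply: nearW => k.
  by rewrite lerDr mulr_ge0// sqr_ge0.
have [Bx|nB] := pselect (box a b x).
  rewrite indicE mem_set//.
  have -> : (true%:R : R) = \prod_(i < n) 1 by rewrite big1.
  apply: cvg_big; first exact: mul_continuous.
  move=> i _; rewrite -[X in _ --> X]mulr1; apply: cvgM; apply: close;
    by have := Bx i; rewrite in_itv/= => /andP[]; lra.
rewrite indicE memNset//; apply: cvg_near_cst.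
move: nB => /existsNP[i /negP]; rewrite in_itv/= negb_and -!ltNge => /orP[] H.
  have : x ord0 i - a i < 0 by lra.
  move=> /far; apply: filterS => k e; rewrite /box_bump (bigD1 i)//= e.
  by rewrite !mul0r.
have : b i - x ord0 i < 0 by lra.
move=> /far; apply: filterS => k e; rewrite /box_bump (bigD1 i)//= e.
by rewrite mulr0 mul0r.
Unshelve. all: by end_near.
Qed.

End box_approximation.

(** * Vanishing against all test functions, and uniqueness of the weak gradient *)

Section variations.
Variables (R : realType) (n : nat).
Local Notation V := 'rV[R]_n.
Local Notation mu := (lebesgue_rV R n).
Variable Omega : set V.
Hypothesis oO : open Omega.

Let mO : measurable Omega := open_measurable_rV oO.

(** It is enough to treat countably many small balls. On each, box bumps are admissible test
    functions converging boundedly to indicators of boxes, and [box_integral_eq0] concludes. *)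
Lemma test_integral_eq0 (g : V -> R) : loc_integrable Omega g ->
  (forall phi, test_function Omega phi -> \int[mu]_(x in Omega) (g x * phi x) = 0) ->
  {ae mu, forall x, Omega x -> g x = 0}.
Proof.
move=> [mg lg] g0.
pose I := [set q : 'rV[rat]_n * nat |
         ball (map_mx ratr q.1 : V) (2 * q.2.+1%:R^-1) `<=` Omega].
suff H q : I q -> {ae mu, forall x, ball (map_mx ratr q.1 : V) (q.2.+1%:R^-1) x ->
    g x = 0}.
  (* Rational balls are enumerated by their codes, so that the exceptional null sets are indexed by
     [nat]. *)
  have : {ae mu, forall x, forall k : nat, forall q, unpickle k = Some q -> I q ->
      ball (map_mx ratr q.1 : V) (q.2.+1%:R^-1) x -> g x = 0}.
    apply: ae_foralln => k; case: (@unpickle _ k : option ('rV[rat]_n * nat)) => [q|].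
      have [/H|nI] := pselect (I q).
        by apply: filterS => x gx _ [<-].
      by apply: nearW => x _ [<-].
    exact: nearW.
  apply: filterS => x gx; rewrite {1}(open_bigcup_ball oO) => -[q Iq qx].
  by apply: (gx (pickle q) q) => //; exact: pickleK.
move=> Iq; set c := map_mx ratr q.1 : V; set r : R := q.2.+1%:R^-1.
have r0 : 0 < r by rewrite invr_gt0 ltr0n.
(* Balls are cubes here: [K] contains the ball of radius r, and [K2], of half-side 3r/2, still fits
   in the doubled ball, hence in [Omega]. *)
pose K : set V := box (fun i => c ord0 i - r) (fun i => c ord0 i + r).
pose K2 : set V := box (fun i => c ord0 i - 3 / 2 * r) (fun i => c ord0 i + 3 / 2 * r).
have mK : measurable K by exact: measurable_box.
have mK2 : measurable K2 by exact: measurable_box.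
have K2O : K2 `<=` Omega.
  apply: subset_trans Iq; rewrite ball_rVE ?mulr_gt0// => x Kx i /=.
  have := Kx i; rewrite in_itv/= -/c => /andP[h1 h2].
  by rewrite ltr_norml; apply/andP; split; rewrite -/r; lra.
have KK2 : K `<=` K2.
  move=> x Kx i; have := Kx i; rewrite !in_itv/= => /andP[h1 h2].
  by apply/andP; split; lra.
have gK2 : mu.-integrable K2 (EFin \o g) by apply: lg K2O; exact: compact_box.
have gK : mu.-integrable K (EFin \o g) by exact: integrableS gK2.
suff : {ae mu, forall x, K x -> (EFin \o g) x = 0%E}.
  apply: filterS => x gx; rewrite ball_rVE// => Bx.
  suff /gx[] : K x by [].
  move=> i; have := Bx i; rewrite ltr_norml in_itv/= => /andP[h1 h2].
  by apply/andP; split; lra.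
apply: box_integral_eq0 => // a b; rewrite box_setI.
set a' := (fun i => Num.max _ _); set b' := (fun i => Num.min _ _).
have BK : box a' b' `<=` K.
  move=> x Bx i; have := Bx i; rewrite !in_itv/= /a' /b' ge_max le_min.
  by move=> /andP[/andP[-> _] /andP[-> _]].
(* The shift gives 1/d <= r/2, so that every bump around a box inside [K] is supported in [K2]. *)
pose d k : R := k%:R + 2 * q.2.+1%:R.
have q0 : 0 < q.2.+1%:R :> R by rewrite ltr0n.
have d0 k : 0 < d k by rewrite ltr_wpDl// mulr_gt0.
have dr k : (d k)^-1 <= 1 / 2 * r.
  rewrite /r mul1r -invfM lef_pV2 ?posrE ?mulr_gt0//.
  by rewrite /d lerDr.
have dy : d @ \oo --> +oo.
  apply: (@ger_cvgy _ _ _ _ (fun k => k%:R)); last exact: cvgr_idn.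
  by apply: nearW => k; rewrite lerDl mulr_ge0// ltW.
pose phi k := box_bump a' b' (d k).
have phi0 k x : ~ K2 x -> phi k x = 0.
  move=> nK; apply: box_bump_eq0 => // Bx; apply: nK => i.
  have := Bx i; rewrite !in_itv/= /a' /b' => /andP[h1 h2].
  have := dr k; have h3 : c ord0 i - r <= Num.max (c ord0 i - r) (a i).
    by rewrite le_max lexx.
  have h4 : Num.min (c ord0 i + r) (b i) <= c ord0 i + r by rewrite ge_min lexx.
  by move=> h5; apply/andP; split; lra.
have tphi k : test_function Omega (phi k).
  by apply: (test_functionI _ _ K2O (phi0 k)); [exact: smooth_box_bump|exact: compact_box].
have phi1 k x : `|phi k x| <= 1.
  by rewrite ger0_norm ?box_bump_ge0// box_bump_le1.
have mphi k : measurable_fun K2 (phi k).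
  apply: measurable_funTS; apply: continuous_measurable_rV.
  exact/smooth_continuous/smooth_box_bump.
have mgK := measurable_int _ gK2.
have mgK' : measurable_fun K2 g by apply/measurable_EFinP.
have gphiE k : (\int[mu]_(x in K2) (g x * phi k x)%:E = 0)%E.
  have ig : mu.-integrable K2 (EFin \o (fun x => g x * phi k x)).
    apply: le_integrable gK2 => //.
      by apply/measurable_EFinP; exact: measurable_funM.
    by move=> x _ /=; rewrite lee_fin normrM ler_piMr.
  have := g0 _ (tphi k); rewrite /Rintegral.
  have -> : (\int[mu]_(x in Omega) (g x * phi k x)%:E =
             \int[mu]_(x in K2) (g x * phi k x)%:E)%E.
    rewrite integral_mkcond [RHS]integral_mkcond; apply: eq_integral => x _.
    rewrite !patchE; case: ifPn => [_|xO].
      case: ifPn => // /negP xK; rewrite phi0 ?mulr0// => Kx; apply: xK.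
      by rewrite inE.
    case: ifPn => //; rewrite inE => /K2O Ox; move/negP: xO; by rewrite inE.
  have /integrable_fin_num -/(_ mK2) h := ig.
  by move=> e; rewrite -[LHS]fineK// e.
set B := box a' b'.
have BK2 : B `<=` K2 by exact: subset_trans KK2.
have mB : measurable B by exact: measurable_box.
have mf : measurable_fun K2 ((EFin \o g) \_ B).
  apply/measurable_restrict => //; exact: measurable_funS mgK.
have mfk k : measurable_fun K2 (fun x => (g x * phi k x)%:E).
  by apply/measurable_EFinP; exact: measurable_funM.
have cv : {ae mu, forall x, K2 x ->
    (fun k => (g x * phi k x)%:E) @ \oo --> ((EFin \o g) \_ B) x}.
  apply: nearW => x _.
  have -> : ((EFin \o g) \_ B) x = (g x * \1_B x)%:E.
    by rewrite patchE indicE; case: (x \in B); rewrite ?mulr1 ?mulr0.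
  apply: cvg_EFin; first exact: nearW.
  by apply: cvgMr; exact: box_bump_cvg.
have ig : mu.-integrable K2 (fun x => `|(g x)%:E|%E) by exact: integrable_abse.
have bd : {ae mu, forall x, forall k, K2 x ->
    (`|(g x * phi k x)%:E| <= `|(g x)%:E|)%E}.
  by apply: nearW => x k _; rewrite lee_fin normrM ler_piMr.
have [_ _] := dominated_convergence mK2 mfk mf cv ig bd.
rewrite (_ : [sequence _]_k = cst 0%E); last exact/funext.
move=> /cvg_lim; rewrite lim_cst// => e.
have {}e := e (@ereal_hausdorff R).
by rewrite [RHS]e -integral_mkcondr (setIidr BK2).
Qed.

Lemma loc_integrableM (g f : V -> R) (K : set V) : loc_integrable Omega g ->
  continuous f -> compact K -> K `<=` Omega -> (forall x, ~ K x -> f x = 0) ->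
  mu.-integrable Omega (EFin \o (fun x => g x * f x)).
Proof.
move=> [mg lg] cf cK KO f0.
have mK := closed_measurable_rV (compact_rV_closed cK).
have [M M0 fM] := compact_support_bounded cf cK f0.
have mgf : measurable_fun Omega (fun x => g x * f x).
  apply: measurable_funM => //; apply: measurable_funTS.
  exact: continuous_measurable_rV.
have iK : mu.-integrable K (EFin \o (fun x => g x * f x)).
  apply: (@le_integrable _ _ _ mu K mK _ (fun x => M%:E * (g x)%:E)%E).
  - by apply/measurable_EFinP; exact: measurable_funS mgf.
  - move=> x _ /=; rewrite lee_fin normrM [leRHS]normrM mulrC.
    by rewrite ler_wpM2r// (ger0_norm (ltW M0)).
  - by apply: integrableZl => //; exact: lg.
apply/(integrable_mkcond _ mO); move/(integrable_mkcond _ mK) : iK.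
rewrite (_ : _ \_ K = (EFin \o (fun x => g x * f x)) \_ Omega)//.
apply/funext => x; rewrite !patchE.
case: ifPn => [|/negP xK]; first by rewrite inE => /KO Ox; rewrite mem_set.
case: ifP => // _; rewrite /= f0 ?mulr0// => Kx; apply: xK.
by rewrite inE.
Qed.

Lemma loc_integrableM_test (g phi : V -> R) : loc_integrable Omega g ->
  test_function Omega phi ->
  mu.-integrable Omega (EFin \o (fun x => g x * phi x)).
Proof.
move=> lg tp; have [K [cK KO _ p0]] := test_function_supp tp.
apply: loc_integrableM cK KO p0 => //.
exact/smooth_continuous/(test_function_smooth tp).
Qed.

Lemma weak_grad_unique (u : V -> R) (G H : V -> V) :
  is_weak_grad Omega u G -> is_weak_grad Omega u H ->
  {ae mu, forall x, Omega x -> G x = H x}.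
Proof.
move=> [lu lG wG] [_ lH wH].
suff : {ae mu, forall x, forall i, Omega x -> G x ord0 i - H x ord0 i = 0}.
  apply: filterS => x GH Ox; apply/rowP => i; apply/eqP.
  by rewrite -subr_eq0 GH.
apply: filter_forall => i.
apply: (@test_integral_eq0 (fun x => G x ord0 i - H x ord0 i)).
  have [mG iG] := lG i; have [mH iH] := lH i.
  split; first exact: measurable_funB.
  move=> K cK KO; have mK := closed_measurable_rV (compact_rV_closed cK).
  rewrite (_ : EFin \o _ = (fun x => (G x ord0 i)%:E - (H x ord0 i)%:E)%E)//.
  by apply: integrableB => //; [exact: iG|exact: iH].
move=> phi tp.
have -> : (fun x => (G x ord0 i - H x ord0 i) * phi x) =
  (fun x => G x ord0 i * phi x - H x ord0 i * phi x).
  by apply/funext => x; rewrite mulrBl.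
rewrite RintegralB//; last 2 first.
- exact: loc_integrableM_test.
- exact: loc_integrableM_test.
apply/eqP; rewrite subr_eq0 -eqr_opp; apply/eqP.
by rewrite -wG// -wH.
Qed.

End variations.

(** * Weak gradients and H^1_0 *)

Section sobolev_theory.
Variables (R : realType) (n : nat).
Local Notation V := 'rV[R]_n.
Local Notation mu := (lebesgue_rV R n).

Lemma dotv_ge0 (x : V) : 0 <= dotv x x.
Proof. by apply: sumr_ge0 => i _; rewrite -expr2 sqr_ge0. Qed.

Lemma dotv_coord_le (x : V) i : (x ord0 i) ^+ 2 <= dotv x x.
Proof.
rewrite /dotv (bigD1 i)//= -expr2 lerDl sumr_ge0// => j _.
by rewrite -expr2 sqr_ge0.
Qed.

Lemma dotvD_le (x y : V) : dotv (x + y) (x + y) <= 2 * dotv x x + 2 * dotv y y.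
Proof.
rewrite /dotv !mulr_sumr -big_split/=; apply: ler_sum => i _.
rewrite !mxE; have := sqr_ge0 (x ord0 i - y ord0 i); nra.
Qed.

Lemma dotvZ (c : R) (x : V) : dotv (c *: x) (c *: x) = c ^+ 2 * dotv x x.
Proof.
by rewrite /dotv mulr_sumr; apply: eq_bigr => i _; rewrite !mxE; ring.
Qed.

Lemma dotvN (x : V) : dotv (- x) (- x) = dotv x x.
Proof. by apply: eq_bigr => i _; rewrite !mxE mulrNN. Qed.

Lemma dotv0_eq0 (x : V) : dotv x x = 0 -> x = 0.
Proof.
move=> /eqP; rewrite psumr_eq0; last by move=> i _; rewrite -expr2 sqr_ge0.
move=> /allP x0; apply/rowP => i; apply/eqP; rewrite mxE -sqrf_eq0 expr2.
by have := x0 i; rewrite mem_index_enum => /(_ isT).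
Qed.

Lemma measurable_dotv (D : set V) (G H : V -> V) :
  (forall i, measurable_fun D (fun x => G x ord0 i)) ->
  (forall i, measurable_fun D (fun x => H x ord0 i)) ->
  measurable_fun D (fun x => dotv (G x) (H x)).
Proof. by move=> mG mH; apply: measurable_sum => i; exact: measurable_funM. Qed.

Variable Omega : set V.
Hypotheses (oO : open Omega) (bO : bounded_set Omega).

Let mO : measurable Omega := open_measurable_rV oO.
Let fO : (mu Omega < +oo)%E := bounded_measure_lty bO mO.

(** Most later estimates are pointwise bounds of this shape. Extended values let the same statement
    prove finiteness as well as inequalities. *)
Lemma integral_le2 (p q r : V -> R) (a b : R) : 0 <= a -> 0 <= b ->
  measurable_fun Omega p -> measurable_fun Omega q -> measurable_fun Omega r ->
  (forall x, 0 <= p x) -> (forall x, 0 <= q x) -> (forall x, 0 <= r x) ->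
  {ae mu, forall x, Omega x -> p x <= a * q x + b * r x} ->
  (\int[mu]_(x in Omega) (p x)%:E <=
   a%:E * \int[mu]_(x in Omega) (q x)%:E + b%:E * \int[mu]_(x in Omega) (r x)%:E)%E.
Proof.
move=> a0 b0 mp mq mr p0 q0 r0 pqr.
rewrite -ge0_integralZl//; last 2 first.
- exact/measurable_EFinP.
- by move=> x _; rewrite lee_fin.
rewrite -ge0_integralZl//; last 2 first.
- exact/measurable_EFinP.
- by move=> x _; rewrite lee_fin.
rewrite -ge0_integralD//; last 4 first.
- by move=> x _; rewrite -EFinM lee_fin mulr_ge0.
- by apply/measurable_EFinP; exact: measurable_funM.
- by move=> x _; rewrite -EFinM lee_fin mulr_ge0.
- by apply/measurable_EFinP; exact: measurable_funM.
apply: ae_ge0_le_integral => //.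
- by move=> x _; rewrite lee_fin.
- exact/measurable_EFinP.
- by move=> x _; rewrite -!EFinM -EFinD lee_fin addr_ge0// mulr_ge0.
- by apply/measurable_EFinP; apply: measurable_funD; exact: measurable_funM.
Qed.

Lemma integral_cst1 : (\int[mu]_(x in Omega) (1 : R)%:E = mu Omega)%E.
Proof. by rewrite integral_cst// mul1e. Qed.

(** |w| <= w^2 + 1, and [Omega] has finite measure. *)
Lemma sqr_integrable (w : V -> R) : measurable_fun Omega w ->
  (\int[mu]_(x in Omega) (w x ^+ 2)%:E < +oo)%E ->
  mu.-integrable Omega (EFin \o w).
Proof.
move=> mw wy; apply/integrableP; split; first exact/measurable_EFinP.
have := @integral_le2 (fun x => `|w x|) (fun x => w x ^+ 2) (cst 1) 1 1 ler01 ler01.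
rewrite !mul1e integral_cst1 => /(_ _ _ _ _ _ _ _) h.
apply: le_lt_trans (h _ _ _ _ _ _ _) _ => //.
- by apply: measurableT_comp => //.
- exact: measurable_funX.
- by move=> x; rewrite sqr_ge0.
- apply: nearW => x _; rewrite !mul1r /cst.
  have := sqr_ge0 (`|w x| - 2^-1); rewrite -(real_normK (num_real (w x))); nra.
- exact: lte_add_pinfty.
Qed.

Lemma Lp2P (w : V -> R) : Lp Omega 2%:E w <->
  measurable_fun Omega w /\ (\int[mu]_(x in Omega) (w x ^+ 2)%:E < +oo)%E.
Proof.
have E : (\int[mu]_(x in Omega) (w x ^+ 2)%:E =
    \int[mu]_x (((w \_ Omega) x) ^+ 2)%:E)%E.
  rewrite integral_mkcond; apply: eq_integral => x _; rewrite !patchE.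
  by case: ifP => // _; rewrite expr0n.
split=> [w2|[mw wy]].
  have := Lfun2_integrable_sqr w2; rewrite /Lp in w2.
  have /set_mem/= mw := sub_Lfun_mfun w2.
  move=> /integrableP[_ H]; split; first by apply/(measurable_restrictT _ mO).
  move: H; rewrite E; under eq_integral do rewrite /= ger0_norm ?sqr_ge0//.
  by [].
rewrite /Lp inE /=; apply/andP; split.
  by rewrite inE/=; apply/(measurable_restrictT _ mO).
rewrite inE/= /finite_norm unlock /=.
apply: poweR_lty; move: wy; rewrite E.
under eq_integral do rewrite -(real_normK (num_real _)) -powR_mulrn//.
by [].
Qed.

Lemma continuous_loc_integrable (f : V -> R) : continuous f ->
  loc_integrable Omega f.
Proof.
move=> cf; have mf := continuous_measurable_rV cf.
split; first exact: measurable_funTS.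
move=> K cK KO; have mK := closed_measurable_rV (compact_rV_closed cK).
apply: measurable_bounded_integrable => //.
- by apply: bounded_measure_lty => //; exact: compact_bounded.
- exact: measurable_funTS.
- have /compact_bounded [M [Mr HM]] : compact [set f x | x in K].
    by apply: continuous_compact => //; exact: continuous_subspaceT.
  by exists M; split => // r Mr' x Kx /=; apply: HM => //; exists x.
Qed.

Definition grad (phi : V -> R) (x : V) : V := \row_i partial i phi x.

Lemma test_partial phi i : test_function Omega phi ->
  test_function Omega (partial i phi).
Proof.
move=> tp; have [K [cK KO clK p0]] := test_function_supp tp.
apply: (test_functionI _ cK KO).
- exact/smooth_partial/(test_function_smooth tp).
- exact: partial_eq0 clK p0.
Qed.

Lemma test_continuous phi : test_function Omega phi -> continuous phi.
Proof. by move=> tp; exact/smooth_continuous/(test_function_smooth tp). Qed.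

Lemma is_weak_grad_test phi : test_function Omega phi ->
  is_weak_grad Omega phi (grad phi).
Proof.
move=> tp; have sp := test_function_smooth tp; split.
- exact/continuous_loc_integrable/test_continuous.
- move=> i; rewrite (_ : (fun x => _) = partial i phi).
    exact/continuous_loc_integrable/test_continuous/test_partial.
  by apply/funext => x; rewrite mxE.
- move=> eta te i; rewrite (integral_by_parts i sp te); congr (- _).
  by apply: eq_Rintegral => x _; rewrite mxE.
Qed.

Lemma loc_integrableB (u v : V -> R) : loc_integrable Omega u ->
  loc_integrable Omega v -> loc_integrable Omega (fun x => u x - v x).
Proof.
move=> [mu_ iu] [mv iv]; split; first exact: measurable_funB.
move=> K cK KO; have mK := closed_measurable_rV (compact_rV_closed cK).
rewrite (_ : EFin \o _ = (fun x => (u x)%:E - (v x)%:E)%E)//.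
by apply: integrableB => //; [exact: iu|exact: iv].
Qed.

Lemma is_weak_gradB u v G H : is_weak_grad Omega u G -> is_weak_grad Omega v H ->
  is_weak_grad Omega (u \- v) (fun x => G x - H x).
Proof.
move=> [lu lG wG] [lv lH wH].
have GHE i : (fun x => (G x - H x) ord0 i) = (fun x => G x ord0 i - H x ord0 i).
  by apply/funext => x; rewrite !mxE.
split; first exact: loc_integrableB.
  by move=> i; rewrite GHE; exact: loc_integrableB.
move=> phi tp i.
have -> : (fun x => (u \- v) x * partial i phi x) =
    (fun x => u x * partial i phi x - v x * partial i phi x).
  by apply/funext => x; rewrite mulrBl.
have -> : (fun x => (G x - H x) ord0 i * phi x) =
    (fun x => G x ord0 i * phi x - H x ord0 i * phi x).
  by apply/funext => x; rewrite !mxE mulrBl.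
have tpi := test_partial i tp.
rewrite !RintegralB//; try exact: loc_integrableM_test.
by rewrite wG// wH// opprB opprK addrC.
Qed.

Lemma weak_gradP u G : is_weak_grad Omega u G ->
  is_weak_grad Omega u (weak_grad Omega u).
Proof. by move=> uG; rewrite /weak_grad; apply: xgetPex; exists G. Qed.

Lemma weak_gradE u G : is_weak_grad Omega u G ->
  {ae mu, forall x, Omega x -> weak_grad Omega u x = G x}.
Proof. by move=> uG; exact: weak_grad_unique (weak_gradP uG) uG. Qed.

(** [G] stands for a gradient of [w], but only measurability is recorded; [test_approx] supplies the
    link between them. *)
Definition sobolev_pair (w : V -> R) (G : V -> V) :=
  measurable_fun Omega w /\ forall i, measurable_fun Omega (fun x => G x ord0 i).

Definition sobolev_density (w : V -> R) (G : V -> V) (x : V) : R :=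
  w x ^+ 2 + dotv (G x) (G x).

(** The square of the H^1 norm, with the gradient as an argument in place of the representative
    picked by [weak_grad]. *)
Definition sobolev_energy (w : V -> R) (G : V -> V) : \bar R :=
  (\int[mu]_(x in Omega) (sobolev_density w G x)%:E)%E.

Lemma sobolev_density_ge0 w G x : 0 <= sobolev_density w G x.
Proof. by rewrite addr_ge0 ?sqr_ge0 ?dotv_ge0. Qed.

Lemma measurable_sobolev_density w G : sobolev_pair w G ->
  measurable_fun Omega (sobolev_density w G).
Proof.
move=> [mw mG]; apply: measurable_funD; first exact: measurable_funX.
exact: measurable_dotv.
Qed.

Lemma sobolev_pairB w1 G1 w2 G2 : sobolev_pair w1 G1 -> sobolev_pair w2 G2 ->
  sobolev_pair (w1 \- w2) (fun x => G1 x - G2 x).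
Proof.
move=> [mw1 mG1] [mw2 mG2]; split; first exact: measurable_funB.
move=> i; rewrite (_ : (fun _ => _) = (fun x => G1 x ord0 i - G2 x ord0 i)).
  exact: measurable_funB.
by apply/funext => x; rewrite !mxE.
Qed.

Lemma sobolev_pair_weak u G : is_weak_grad Omega u G -> sobolev_pair u G.
Proof. by move=> [[mu_ _] lG _]; split => // i; have [] := lG i. Qed.

Lemma sobolev_pair_test phi : test_function Omega phi ->
  sobolev_pair phi (grad phi).
Proof. by move=> /is_weak_grad_test /sobolev_pair_weak. Qed.

Lemma sobolev_energyB_lty w1 G1 w2 G2 :
  sobolev_pair w1 G1 -> sobolev_pair w2 G2 ->
  (sobolev_energy w1 G1 < +oo)%E ->
  (sobolev_energy (w1 \- w2)%R (fun x => G1 x - G2 x)%R < +oo)%E ->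
  (sobolev_energy w2 G2 < +oo)%E.
Proof.
move=> p1 p2 y1 y2; have p12 := sobolev_pairB p1 p2.
apply: le_lt_trans (integral_le2 (a := 2) (b := 2) _ _ _
  (measurable_sobolev_density p1) (measurable_sobolev_density p12) _ _ _ _) _ => //.
- exact: measurable_sobolev_density.
- exact: sobolev_density_ge0.
- exact: sobolev_density_ge0.
- exact: sobolev_density_ge0.
- apply: nearW => x _; rewrite /sobolev_density.
  have := dotvD_le (G1 x) (- (G1 x - G2 x)); rewrite dotvN opprB addrC subrK.
  have := sqr_ge0 (2 * w1 x - w2 x) => /=; nra.
- by apply: lte_add_pinfty; apply: lte_mul_pinfty.
Qed.

Lemma test_energy_lty phi : test_function Omega phi ->
  (sobolev_energy phi (grad phi) < +oo)%E.
Proof.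
move=> tp.
have bnd psi : test_function Omega psi -> exists2 M, 0 < M & forall x, `|psi x| <= M.
  move=> tps; have [K [cK KO clK p0]] := test_function_supp tps.
  exact: compact_support_bounded (test_continuous tps) cK p0.
have [M M0 HM] := bnd _ tp.
have /choice[N HN] : forall i, exists N, forall x, `|partial i phi x| <= N.
  by move=> i; have [N _ HN] := bnd _ (test_partial i tp); exists N.
have := @integral_le2 (sobolev_density phi (grad phi)) (cst 1) (cst 1)
  (M ^+ 2 + \sum_i N i ^+ 2) 0.
rewrite mul0e adde0 integral_cst1 => h.
have c0 : 0 <= M ^+ 2 + \sum_i N i ^+ 2.
  by rewrite addr_ge0 ?sqr_ge0// sumr_ge0// => i _; rewrite sqr_ge0.
apply: le_lt_trans (h _ _ _ _ _ _ _ _ _) _ => //.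
- by apply: measurable_sobolev_density; exact: sobolev_pair_test.
- exact: sobolev_density_ge0.
- apply: nearW => x _; rewrite mul0r addr0 mulr1; apply: lerD.
    by rewrite -(real_normK (num_real (phi x))) lerXn2r ?nnegrE// ltW.
  apply: ler_sum => i _; rewrite mxE -expr2 -(real_normK (num_real _)).
  by rewrite lerXn2r ?nnegrE// (le_trans _ (HN i x)).
- by apply: lte_mul_pinfty.
Qed.

(* [w] belongs to the closure of the test functions, with gradient [G]. *)
Definition test_approx (w : V -> R) (G : V -> V) : Prop :=
  sobolev_pair w G /\
  forall e : R, 0 < e -> exists phi, test_function Omega phi /\
    (sobolev_energy (phi \- w)%R (fun x => grad phi x - G x)%R < e%:E)%E.

Lemma test_approx_lty w G : test_approx w G -> (sobolev_energy w G < +oo)%E.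
Proof.
move=> [p /(_ 1 ltr01)[phi [tp h]]].
apply: (sobolev_energyB_lty (sobolev_pair_test tp) p (test_energy_lty tp)).
by apply: lt_trans h _; rewrite ltry.
Qed.

(** The squared triangle inequality costs a factor 2 on each of two terms, whence the quarters of
    [e]. It serves [test_approx_comp], which approximates in two stages. *)
Lemma test_approx_closed w G : sobolev_pair w G ->
  (forall e : R, 0 < e -> exists w' G', test_approx w' G' /\
    (sobolev_energy (w' \- w)%R (fun x => G' x - G x)%R < e%:E)%E) ->
  test_approx w G.
Proof.
move=> p H; split => // e e0; have e4 : 0 < e / 4 by rewrite divr_gt0.
have [w' [G' [[p' /(_ _ e4)[phi [tp h1]]] h2]]] := H _ e4.
exists phi; split => //; have pp := sobolev_pair_test tp.
have p1 := sobolev_pairB pp p'; have p2 := sobolev_pairB p' p.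
apply: le_lt_trans (integral_le2 (a := 2) (b := 2) _ _ _
  (measurable_sobolev_density p1) (measurable_sobolev_density p2) _ _ _ _) _ => //.
- exact: (measurable_sobolev_density (sobolev_pairB pp p)).
- exact: sobolev_density_ge0.
- exact: sobolev_density_ge0.
- exact: sobolev_density_ge0.
- apply: nearW => x _; rewrite /sobolev_density.
  have := dotvD_le (grad phi x - G' x) (G' x - G x); rewrite addrA subrK => h.
  have := sqr_ge0 ((phi x - w' x) - (w' x - w x)) => /=; nra.
- have -> : e%:E = (2%:E * (e / 4)%:E + 2%:E * (e / 4)%:E)%E.
    by rewrite -!EFinM -EFinD; congr EFin; field.
  by apply: lteD; rewrite lte_pmul2l.
Qed.

End sobolev_theory.

(** * Membership in H^1_0 as approximation by test functions *)

Section H10_characterization.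
Variables (R : realType) (n : nat).
Local Notation V := 'rV[R]_n.
Local Notation mu := (lebesgue_rV R n).
Variable Omega : set V.
Hypotheses (oO : open Omega) (bO : bounded_set Omega).

Let mO : measurable Omega := open_measurable_rV oO.
Let fO : (mu Omega < +oo)%E := bounded_measure_lty bO mO.
Local Notation energy := (sobolev_energy Omega).

Lemma energy_coord_le (f : V -> R) w G : measurable_fun Omega f ->
  sobolev_pair Omega w G ->
  (forall x, f x ^+ 2 <= sobolev_density w G x) ->
  (\int[mu]_(x in Omega) (f x ^+ 2)%:E <= energy w G)%E.
Proof.
move=> mf p fw; apply: ge0_le_integral => //.
- by move=> x _; rewrite lee_fin sqr_ge0.
- by apply/measurable_EFinP; exact: measurable_funX.
- by apply/measurable_EFinP; exact: measurable_sobolev_density.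
- by move=> x _; rewrite lee_fin.
Qed.

Lemma energy_fun_le w G : sobolev_pair Omega w G ->
  (\int[mu]_(x in Omega) (w x ^+ 2)%:E <= energy w G)%E.
Proof.
move=> p; apply: energy_coord_le => //; first by case: p.
by move=> x; rewrite lerDl dotv_ge0.
Qed.

Lemma energy_grad_le w G i : sobolev_pair Omega w G ->
  (\int[mu]_(x in Omega) (G x ord0 i ^+ 2)%:E <= energy w G)%E.
Proof.
move=> p; apply: energy_coord_le => //; first by case: p.
by move=> x; rewrite (le_trans (dotv_coord_le _ i))// lerDr sqr_ge0.
Qed.

Lemma integrable_loc (w : V -> R) : mu.-integrable Omega (EFin \o w) ->
  loc_integrable Omega w.
Proof.
move=> iw; split; first by have := measurable_int _ iw; move/measurable_EFinP.
move=> K cK KO; apply: integrableS iw => //.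
by apply: closed_measurable_rV; exact: compact_rV_closed.
Qed.

Lemma test_approx_Lp w G : test_approx Omega w G ->
  Lp Omega 2%:E w /\ forall i, Lp Omega 2%:E (fun x => G x ord0 i).
Proof.
move=> wG; have p := wG.1; have y := test_approx_lty oO bO wG.
split; first by apply/(Lp2P oO); split; [case: p|exact: le_lt_trans (energy_fun_le p) y].
move=> i; apply/(Lp2P oO); split; first by case: p.
exact: le_lt_trans (energy_grad_le i p) y.
Qed.

Lemma Lp2_integrable w : Lp Omega 2%:E w -> mu.-integrable Omega (EFin \o w).
Proof. by move=> /(Lp2P oO)[mw wy]; exact: sqr_integrable. Qed.

Lemma le_normr_integral (h : V -> R) : mu.-integrable Omega (EFin \o h) ->
  ((`|\int[mu]_(x in Omega) h x|)%:E <= \int[mu]_(x in Omega) (`|h x|)%:E)%E.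
Proof.
move=> ih; have H := le_abse_integral mu mO (measurable_int _ ih).
by rewrite -(fineK (integrable_fin_num mO ih)) in H; exact: H.
Qed.

(** Integration by parts is exact for an approximating test function, so the defect [A] only sees
    the approximation error. It is bounded by a constant times an arbitrary [d], hence is zero. *)
Lemma test_approx_weak w G : test_approx Omega w G -> is_weak_grad Omega w G.
Proof.
move=> wG; have [L2w L2G] := test_approx_Lp wG; have p := wG.1.
have lw := integrable_loc (Lp2_integrable L2w).
have lG i := integrable_loc (Lp2_integrable (L2G i)).
split => // eta te i.
have tei := test_partial i te.
have bnd psi : test_function Omega psi -> exists2 M, 0 < M & forall x, `|psi x| <= M.
  move=> tps; have [K [cK KO clK p0]] := test_function_supp tps.
  exact: compact_support_bounded (test_continuous tps) cK p0.
have [M1 M10 HM1] := bnd _ te; have [M2 M20 HM2] := bnd _ tei.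
pose M := M1 + M2; have M0 : 0 < M by rewrite addr_gt0.
have e1 x : `|eta x| <= M by rewrite (le_trans (HM1 x))// lerDl ltW.
have e2 x : `|partial i eta x| <= M by rewrite (le_trans (HM2 x))// lerDr ltW.
apply/eqP; rewrite -addr_eq0 -normr_eq0; set A := _ + _.
pose m : R := fine (mu Omega).
have m0 : 0 <= m by exact: fine_ge0.
have mE : mu Omega = m%:E by rewrite fineK// ge0_fin_numE.
suff H d : 0 < d -> `|A| <= d * (M * (2 * m + 1)).
  have c0 : 0 < M * (2 * m + 1) by rewrite mulr_gt0// ltr_wpDl// mulr_ge0.
  rewrite eq_le normr_ge0 andbT; apply/ler_addgt0Pl => e e0; rewrite addr0.
  have := H (e / (M * (2 * m + 1))) (divr_gt0 e0 c0).
  by rewrite divfK// gt_eqF.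
move=> d0; have dd0 : 0 < d ^+ 2 by rewrite exprn_gt0.
have [phi [tp hphi]] := wG.2 _ dd0.
have sp := test_function_smooth tp.
have lphi := @continuous_loc_integrable R n Omega _ (test_continuous tp).
have ldphi := @continuous_loc_integrable R n Omega _ (test_continuous (test_partial i tp)).
pose h x := (w x - phi x) * partial i eta x + (G x ord0 i - partial i phi x) * eta x.
have i1 := loc_integrableM_test oO (loc_integrableB lw lphi) tei.
have i2 := loc_integrableM_test oO (loc_integrableB (lG i) ldphi) te.
have Ah : A = \int[mu]_(x in Omega) h x.
  rewrite /h RintegralD//.
  have -> : (fun x => (w x - phi x) * partial i eta x) =
      (fun x => w x * partial i eta x - phi x * partial i eta x).
    by apply/funext => x; rewrite mulrBl.
  have -> : (fun x => (G x ord0 i - partial i phi x) * eta x) =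
      (fun x => G x ord0 i * eta x - partial i phi x * eta x).
    by apply/funext => x; rewrite mulrBl.
  rewrite !RintegralB//; try exact: loc_integrableM_test.
  rewrite (integral_by_parts i sp te) /A; ring.
have ih : mu.-integrable Omega (EFin \o h).
  rewrite (_ : EFin \o h =
    (fun x => ((w x - phi x)%R * partial i eta x)%:E +
              ((G x ord0 i - partial i phi x)%R * eta x)%:E)%E)//.
  exact: integrableD.
have mh : measurable_fun Omega h by have := measurable_int _ ih; move/measurable_EFinP.
have pB := sobolev_pairB (sobolev_pair_test tp) p.
rewrite -lee_fin Ah.
apply: (@le_trans _ _ (\int[mu]_(x in Omega) (`|h x|)%:E)%E).
  exact: le_normr_integral.
apply: le_trans (integral_le2 (a := M / d) (b := 2 * M * d) oO _ _ _
  (measurable_sobolev_density pB) (measurable_cst (1 : R)) _ _ _ _) _.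
- by rewrite divr_ge0// ltW.
- by rewrite !mulr_ge0// ltW.
- exact: measurableT_comp.
- by [].
- exact: sobolev_density_ge0.
- by [].
- apply: nearW => x _; rewrite mulr1.
  set a := phi x - w x; set b := partial i phi x - G x ord0 i.
  have hab : `|h x| <= M * (`|a| + `|b|).
    rewrite /h; apply: le_trans (ler_normD _ _) _; rewrite !normrM mulrDr.
    by apply: lerD; rewrite mulrC; apply: ler_pM => //; rewrite distrC.
  have dab : a ^+ 2 + b ^+ 2 <= sobolev_density (phi \- w) (fun x => grad phi x - G x) x.
    rewrite lerD2l; have := dotv_coord_le (grad phi x - G x) i.
    by rewrite !mxE.
  (* Replaces the Cauchy-Schwarz inequality: since the energy is below d^2, the term c^2 / d
     integrates to order d. *)
  have key (c : R) : `|c| <= c ^+ 2 / d + d.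
    rewrite -(ler_pM2r d0) mulrDl divfK ?gt_eqF//.
    by have := sqr_ge0 (`|c| - d); rewrite -(real_normK (num_real c)); nra.
  apply: (le_trans hab).
  have := key a; have := key b => ka kb.
  apply: (@le_trans _ _ (M * ((a ^+ 2 + b ^+ 2) / d + 2 * d))).
    rewrite ler_wpM2l ?(ltW M0)//; rewrite mulrDl; lra.
  rewrite mulrDr; apply: lerD; last by rewrite le_eqVlt; apply/orP; left; apply/eqP; ring.
  rewrite mulrA mulrAC ler_wpM2l// divr_ge0// ltW//.
- rewrite (integral_cst1 oO) mE.
  have -> : (d * (M * (2 * m + 1)))%:E =
    ((M / d)%:E * (d ^+ 2)%:E + (2 * M * d)%:E * m%:E)%E.
    by rewrite -!EFinM -EFinD; congr EFin; field; rewrite gt_eqF.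
  apply: leeD => //; apply: lee_wpmul2l; first by rewrite lee_fin divr_ge0// ltW.
  exact: ltW.
Qed.

(** Two weak gradients of one function agree a.e., so the representative inside [H1norm] may be
    exchanged for an explicit one. *)
Lemma H1norm_energy u G phi : is_weak_grad Omega u G -> test_function Omega phi ->
  H1norm Omega (phi \- u) =
  (energy (phi \- u)%R (fun x => grad phi x - G x)%R `^ 2^-1)%E.
Proof.
move=> uG tp; have tG := is_weak_grad_test tp.
have dG := is_weak_gradB oO tG uG.
rewrite /H1norm; congr (_ `^ _)%E; apply: ge0_ae_eq_integral => //.
- apply/measurable_EFinP.
  exact: measurable_sobolev_density (sobolev_pair_weak (weak_gradP dG)).
- apply/measurable_EFinP.
  exact: measurable_sobolev_density (sobolev_pair_weak dG).
- by move=> x _; rewrite lee_fin sobolev_density_ge0.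
- by move=> x _; rewrite lee_fin sobolev_density_ge0.
- by apply: filterS (weak_gradE oO dG) => x H Ox; rewrite /sobolev_density H.
Qed.

Lemma test_approx_H10 w G : test_approx Omega w G -> H10 Omega w.
Proof.
move=> wG; have [L2w L2G] := test_approx_Lp wG; have wk := test_approx_weak wG.
split; first by split => //; exists G.
have /choice[phi Hphi] : forall k : nat, exists phi, test_function Omega phi /\
    (energy (phi \- w)%R (fun x => grad phi x - G x)%R < (k.+1%:R^-1 ^+ 2)%:E)%E.
  by move=> k; apply: wG.2; rewrite exprn_gt0// invr_gt0.
exists phi; split=> [k|]; first by case: (Hphi k).
apply: (@squeeze_cvge _ _ _ _ (cst 0%E) _ (fun k => (k.+1%:R^-1)%:E)).
- apply: nearW => k; have [tk ek] := Hphi k.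
  rewrite (H1norm_energy wk tk) poweR_ge0/=.
  have -> : (k.+1%:R^-1 : R)%:E = ((k.+1%:R^-1 ^+ 2)%:E `^ 2^-1)%E.
    rewrite poweR_EFin; congr EFin.
    by rewrite -powR_mulrn// -powRrM divff ?powRr1.
  apply: gt0_ler_poweR => //; last exact: ltW.
  + rewrite in_itv/= leey andbT; apply: integral_ge0 => x _.
    by rewrite lee_fin sobolev_density_ge0.
  + by rewrite in_itv/= leey lee_fin sqr_ge0.
- exact: cvg_cst.
- exact: cvge_harmonic.
Qed.

Lemma H10_test_approx u : H10 Omega u -> test_approx Omega u (weak_grad Omega u).
Proof.
move=> [[L2u [G [uG L2G]]] [phi [tphi cphi]]].
have wu := weak_gradP uG.
split => [|e e0]; first exact: sobolev_pair_weak.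
(* The energy is the square of the norm, so the threshold [e] becomes its square root. *)
have s0 : (0 < (e `^ 2^-1)%:E)%E by rewrite lte_fin powR_gt0.
have nb : nbhs (0%E : \bar R) [set y | (y < (e `^ 2^-1)%:E)%E].
  by apply: open_nbhs_nbhs; split => //; exact: open_ereal_lt_ereal.
have [k _ /(_ k (leqnn k)) /= hk] := cphi _ nb.
exists (phi k); split => //; rewrite ltNge; apply/negP => ek.
move: hk; rewrite (H1norm_energy wu (tphi k)) ltNge => /negP; apply.
rewrite -poweR_EFin; apply: gt0_ler_poweR => //.
- by rewrite in_itv/= leey lee_fin ltW.
- rewrite in_itv/= leey andbT; apply: integral_ge0 => x _.
  by rewrite lee_fin sobolev_density_ge0.
Qed.

End H10_characterization.

(** * Composition with functions of one variable *)

Section smooth1_theory.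
Variable R : realType.
Implicit Types f g h : R -> R.

(** A smooth [f] enters as [f \o id], so composition also plays the part of the atoms. *)
Inductive smooth1_expr : (R -> R) -> Prop :=
| Smooth1_comp h f : smooth1 h -> smooth1 f -> smooth1_expr (h \o f)
| Smooth1_add f g : smooth1_expr f -> smooth1_expr g -> smooth1_expr (f + g)
| Smooth1_mul f g : smooth1_expr f -> smooth1_expr g -> smooth1_expr (f * g).

Lemma smooth1_cst (c : R) : smooth1 (cst c).
Proof.
apply: (@smooth1_family _ [set f | exists c, f = cst c]); last by exists c.
by move=> _ [d ->]; exists (cst 0); [exists 0|move=> x; exact: is_derive_cst].
Qed.

Lemma smooth1_id : smooth1 (@id R).
Proof.
apply: (@smooth1_family _ [set f | f = id \/ exists c, f = cst c]); last by left.
move=> _ [->|[d ->]].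
  by exists (cst 1); [right; exists 1|move=> x; exact: is_derive_id].
by exists (cst 0); [right; exists 0|move=> x; exact: is_derive_cst].
Qed.

Lemma smooth1_exprP f : smooth1_expr f -> smooth1 f.
Proof.
apply: smooth1_family => {}f; elim => {f}.
- move=> h f sh sf; exists ((derive1 h \o f) * (derive1 f \o id)).
    exact: Smooth1_mul (Smooth1_comp (smooth1_derive sh) sf)
                       (Smooth1_comp (smooth1_derive sf) smooth1_id).
  move=> x; apply: is_derive1_comp; exact: smooth1_is_derive.
- move=> f g ef [f' ef' df] eg [g' eg' dg].
  by exists (f' + g'); [exact: Smooth1_add|move=> x; exact: is_deriveD].
- move=> f g ef [f' ef' df] eg [g' eg' dg].
  exists (f * g' + g * f'); last by move=> x; exact: is_deriveM.
  by apply: Smooth1_add; exact: Smooth1_mul.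
Qed.

Lemma smooth1_comp h f : smooth1 h -> smooth1 f -> smooth1 (h \o f).
Proof. by move=> sh sf; exact/smooth1_exprP/Smooth1_comp. Qed.

Lemma smooth1_exprI f : smooth1 f -> smooth1_expr f.
Proof. by move=> sf; exact: (Smooth1_comp sf smooth1_id). Qed.

Lemma smooth1D f g : smooth1 f -> smooth1 g -> smooth1 (f + g).
Proof. by move=> /smooth1_exprI ef /smooth1_exprI eg; exact/smooth1_exprP/Smooth1_add. Qed.

Lemma smooth1M f g : smooth1 f -> smooth1 g -> smooth1 (f * g).
Proof. by move=> /smooth1_exprI ef /smooth1_exprI eg; exact/smooth1_exprP/Smooth1_mul. Qed.

Lemma smooth1_sin : smooth1 (@sin R).
Proof.
apply: (@smooth1_family _ [set f | exists a b, f = (fun s => a * sin s + b * cos s)]);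
  last by exists 1, 0; apply/funext => s; rewrite mul1r mul0r addr0.
move=> _ [a [b ->]]; exists (fun s => - b * sin s + a * cos s); first by exists (- b), a.
move=> s.
rewrite (_ : (fun _ => _) = a \*: @sin R + b \*: @cos R); last first.
  by apply/funext => t; rewrite fctE.
have -> : - b * sin s + a * cos s = a *: cos s + b *: (- sin s).
  by rewrite /GRing.scale/=; ring.
by apply: is_deriveD; apply: is_deriveZ.
Qed.

Lemma derive1_bounded_lipschitz h (L : R) : smooth1 h ->
  (forall s, `|derive1 h s| <= L) -> forall s t, `|h s - h t| <= L * `|s - t|.
Proof.
move=> sh hL s t; wlog st : s t / t <= s.
  move=> H; have [/H//|/ltW/H] := leP t s; by rewrite distrC [`|s - t|]distrC.
have [c _ ->] := MVT_segment st (fun x _ => smooth1_is_derive x sh)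
  (continuous_subspaceT (smooth1_continuous sh)).
by rewrite normrM ler_wpM2r.
Qed.

Lemma continuous_bounded_segment h (M : R) : continuous h ->
  exists2 B, 0 <= B & forall s, `|s| <= M -> `|h s| <= B.
Proof.
move=> ch.
have /compact_bounded [C [_ HC]] : compact [set h x | x in `[- M, M]%classic].
  apply: continuous_compact; last exact: segment_compact.
  exact: continuous_subspaceT.
have C0 : 0 <= Num.max C 0 by rewrite le_max lexx orbT.
exists (Num.max C 0 + 1); first by rewrite addr_ge0.
move=> s; rewrite ler_norml => sM; apply: HC; last by exists s; rewrite //= in_itv.
by rewrite (@le_lt_trans _ _ (Num.max C 0))// ?le_max ?lexx// ltrDl.
Qed.

(* A bounded smooth reparametrization of the line tending to the identity as [e]
   tends to 0; it replaces a cut-off function. *)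
Definition sinc (e s : R) : R := e^-1 * sin (e * s).

Lemma smooth1_sinc e : smooth1 (sinc e).
Proof.
rewrite (_ : sinc e = cst e^-1 * (@sin R \o (cst e * @id R))).
  by apply: smooth1M; [exact: smooth1_cst|];
    apply: smooth1_comp; [exact: smooth1_sin|];
    apply: smooth1M; [exact: smooth1_cst|exact: smooth1_id].
by apply/funext => s; rewrite !fctE.
Qed.

Lemma is_derive_sinc e (s : R) : e != 0 ->
  is_derive s (1 : R) (sinc e) (cos (e * s)).
Proof.
move=> e0.
have d1 : is_derive s (1 : R) (fun t : R => e *: t) (e *: 1).
  by apply: is_deriveZ; exact: is_derive_id.
have d2 := is_derive1_comp (is_derive_sin (e *: s)) d1.
have d3 := is_deriveZ e^-1 d2.
rewrite (_ : sinc e = e^-1 \*: (@sin R \o (fun t => e *: t)))//.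
apply: is_derive_eq d3 _; rewrite /GRing.scale/= mulr1 mulrCA mulVf// mulr1//.
Qed.

Lemma derive1_sinc e s : e != 0 -> derive1 (sinc e) s = cos (e * s).
Proof. by move=> e0; rewrite derive1E; case: (is_derive_sinc s e0). Qed.

Lemma sinc_le e s : e != 0 -> `|sinc e s| <= `|s|.
Proof.
move=> e0; have := @derive1_bounded_lipschitz (sinc e) 1 (@smooth1_sinc e).
have H t : `|derive1 (sinc e) t| <= 1.
  by rewrite derive1_sinc// ler_norml cos_geN1 cos_le1.
move=> /(_ H s 0); rewrite {2}/sinc mulr0 sin0 mulr0 !subr0 mul1r.
exact.
Qed.

Lemma sinc_bounded e s : 0 < e -> `|sinc e s| <= e^-1.
Proof.
move=> e0; rewrite /sinc normrM [`|e^-1|]gtr0_norm ?invr_gt0//.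
rewrite -[leRHS]mulr1 ler_wpM2l ?invr_ge0//; first exact: ltW.
by rewrite ler_norml sin_geN1 sin_le1.
Qed.

(** sin(s e) / e is the difference quotient at 0 of t |-> sin(s t), whose derivative there is s. *)
Lemma sinc_cvg (e : R^nat) s : (forall k, e k != 0) -> e @ \oo --> (0 : R) ->
  sinc (e k) s @[k --> \oo] --> s.
Proof.
move=> e0 ec.
have d : is_derive (0 : R) (1 : R) (fun t : R => sin (s * t)) s.
  have [->|sn] := eqVneq s 0.
    rewrite (_ : (fun _ => _) = cst 0); first exact: is_derive_cst.
    by apply/funext => t; rewrite mul0r sin0.
  have d := @is_derive_sinc s 0 sn; rewrite (_ : (fun _ => _) = s \*: sinc s).
    apply: is_derive_eq (is_deriveZ s d) _.
    by rewrite mulr0 cos0 /GRing.scale/= mulr1.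
  apply/funext => t; change (sin (s * t) = s * (s^-1 * sin (s * t))).
  by rewrite mulrA divff// mul1r.
case: d => /cvg_ex[l hl] dE.
have ls : l = s by rewrite -dE; apply/esym/cvg_lim.
move: hl; rewrite ls => /cvgr_dnbhsP /(_ e (conj e0 ec)).
apply: cvg_trans; apply: near_eq_cvg; apply: nearW => k /=.
by rewrite scaler1 addr0 mulr0 sin0 subr0 /sinc [s * _]mulrC.
Qed.

(** [sinc e] takes values in [-1/e, 1/e], where the derivatives of [h] are bounded; composition thus
    makes the first two derivatives globally bounded. *)
Lemma bounded_comp_sinc h e : smooth1 h -> 0 < e -> let g := h \o sinc e in
  [/\ smooth1 g, exists L, forall s, `|derive1 g s| <= L
    & exists L, forall s, `|derive1 (derive1 g) s| <= L].
Proof.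
move=> sh e0 g; have en : e != 0 by rewrite gt_eqF.
have sg : smooth1 g by exact: smooth1_comp sh (@smooth1_sinc e).
have g1 : derive1 g = (fun s => derive1 h (sinc e s) * cos (e * s)).
  apply/funext => s; rewrite derive1_comp.
  - by rewrite derive1_sinc.
  - exact: (@smooth1_sinc e 0%N s).
  - exact: (sh 0%N).
have sh1 := smooth1_derive sh; have sh2 := smooth1_derive sh1.
have [B1 B10 HB1] := continuous_bounded_segment e^-1 (smooth1_continuous sh1).
have [B2 B20 HB2] := continuous_bounded_segment e^-1 (smooth1_continuous sh2).
have c1 s : `|cos (e * s)| <= 1 by rewrite ler_norml cos_geN1 cos_le1.
have s1 s : `|sin (e * s)| <= 1 by rewrite ler_norml sin_geN1 sin_le1.
split => //.
  exists B1 => s; rewrite g1 normrM -[leRHS]mulr1.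
  by apply: ler_pM => //; apply: HB1; exact: sinc_bounded.
exists (B2 + B1 * e) => s.
have -> : derive1 (derive1 g) s =
    derive1 h (sinc e s) * (- (e * sin (e * s))) +
    cos (e * s) * (derive1 (derive1 h) (sinc e s) * cos (e * s)).
  rewrite derive1E g1.
  have d1 : is_derive s (1 : R) (fun t : R => derive1 h (sinc e t))
      (derive1 (derive1 h) (sinc e s) * cos (e * s)).
    apply: is_derive1_comp; first exact: smooth1_is_derive.
    exact: is_derive_sinc.
  have d2 : is_derive s (1 : R) (fun t : R => cos (e * t)) (- (e * sin (e * s))).
    have d3 : is_derive s (1 : R) (fun t : R => e *: t) (e *: 1).
      by apply: is_deriveZ; exact: is_derive_id.
    have := is_derive1_comp (is_derive_cos (e *: s)) d3.
    by rewrite /GRing.scale/= mulr1 mulNr mulrC.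
  by case: (is_deriveM d1 d2) => _ ->.
rewrite addrC; apply: le_trans (ler_normD _ _) _; apply: lerD.
  rewrite !normrM -[leRHS]mul1r; apply: ler_pM => //.
  by rewrite -[leRHS]mulr1; apply: ler_pM => //; apply: HB2; exact: sinc_bounded.
rewrite normrM normrN normrM; apply: ler_pM => //.
  by apply: HB1; exact: sinc_bounded.
by rewrite (gtr0_norm e0) -[leRHS]mulr1 ler_wpM2l// ltW.
Qed.

End smooth1_theory.

(** * Chain rule in H^1_0 and the Poincare inequality *)

Section composition.
Variables (R : realType) (n : nat).
Local Notation V := 'rV[R]_n.
Local Notation mu := (lebesgue_rV R n).
Variable Omega : set V.
Hypotheses (oO : open Omega) (bO : bounded_set Omega).

Let mO : measurable Omega := open_measurable_rV oO.
Let fO : (mu Omega < +oo)%E := bounded_measure_lty bO mO.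
Local Notation energy := (sobolev_energy Omega).

(** Dominated convergence in the form used below: one index at which the integral is small. *)
Lemma dominated_small (f : nat -> V -> R) (g : V -> R) (e : R) :
  (forall k, measurable_fun Omega (f k)) -> measurable_fun Omega g ->
  (forall k x, 0 <= f k x) -> (forall x, 0 <= g x) ->
  (\int[mu]_(x in Omega) (g x)%:E < +oo)%E ->
  {ae mu, forall x, Omega x -> f ^~ x @ \oo --> (0 : R)} ->
  {ae mu, forall x, forall k, Omega x -> f k x <= g x} -> 0 < e ->
  exists k, (\int[mu]_(x in Omega) (f k x)%:E < e%:E)%E.
Proof.
move=> mf mg f0 g0 gy fc fg e0.
have ig : mu.-integrable Omega (EFin \o g).
  apply/integrableP; split; first exact/measurable_EFinP.
  by under eq_integral do rewrite /= ger0_norm//.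
have mfE k : measurable_fun Omega (EFin \o f k) by exact/measurable_EFinP.
have cE : {ae mu, forall x, Omega x -> (fun k => (f k x)%:E) @ \oo --> 0%E}.
  by apply: filterS fc => x h Ox; apply: cvg_EFin; [exact: nearW|exact: h].
have bE : {ae mu, forall x, forall k, Omega x -> (`|(f k x)%:E| <= (g x)%:E)%E}.
  by apply: filterS fg => x h k Ox; rewrite lee_fin ger0_norm// h.
have [_ _] := dominated_convergence mO mfE (measurable_cst 0%E) cE ig bE.
rewrite integral0 => c.
have nb : nbhs (0%E : \bar R) [set y | (y < e%:E)%E].
  by apply: open_nbhs_nbhs; split; [exact: open_ereal_lt_ereal|rewrite /= lte_fin].
by have [k _ /(_ k (leqnn k)) /= hk] := c _ nb; exists k.
Qed.

Lemma sobolev_pair_comp (h k : R -> R) u G : continuous h -> continuous k ->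
  sobolev_pair Omega u G ->
  sobolev_pair Omega (h \o u) (fun x => k (u x) *: G x).
Proof.
move=> ch ck [mu_ mG]; split.
  by apply: measurableT_comp => //; exact: continuous_measurable_fun.
move=> i; rewrite (_ : (fun _ => _) = (fun x => k (u x) * G x ord0 i)).
  apply: measurable_funM => //.
  by apply: measurableT_comp => //; exact: continuous_measurable_fun.
by apply/funext => x; rewrite mxE.
Qed.

Lemma grad_comp (h : R -> R) (phi : V -> R) x : smooth1 h -> smooth phi ->
  grad (h \o phi) x = derive1 h (phi x) *: grad phi x.
Proof.
move=> sh sp; apply/rowP => i; rewrite !mxE.
have := is_derive_comp_dir (smooth1_is_derive (phi x) sh) (smooth_is_derive x i sp).
by case=> _; rewrite /partial => ->.
Qed.

Lemma measurable_dotvv u G : sobolev_pair Omega u G ->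
  measurable_fun Omega (fun x => dotv (G x) (G x)).
Proof. by case=> _ mG; exact: measurable_dotv. Qed.

Lemma dotv_integral_lty u G : sobolev_pair Omega u G -> (energy u G < +oo)%E ->
  (\int[mu]_(x in Omega) (dotv (G x) (G x))%:E < +oo)%E.
Proof.
move=> p; apply: le_lt_trans; apply: ge0_le_integral => //.
- by move=> x _; rewrite lee_fin dotv_ge0.
- by apply/measurable_EFinP; exact: measurable_dotvv p.
- by apply/measurable_EFinP; exact: measurable_sobolev_density.
- by move=> x _; rewrite lee_fin lerDr sqr_ge0.
Qed.

(** The gradient error is h'(phi)(grad phi - G) + (h'(phi) - h'(u)) G. In the second term phi - u is
    small only in L^2 and G is only in L^2, so |G|^2 is split as at most k + r_k. On k the Lipschitz
    bound of h' is used; on r_k, of small integral, the crude bound 2 L1. No a.e. convergent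
    subsequence has to be extracted. *)
Lemma test_approx_comp_lipschitz (h : R -> R) (L1 L2 : R) u G : smooth1 h -> h 0 = 0 ->
  (forall s, `|derive1 h s| <= L1) -> (forall s, `|derive1 (derive1 h) s| <= L2) ->
  test_approx Omega u G ->
  test_approx Omega (h \o u) (fun x => derive1 h (u x) *: G x).
Proof.
move=> sh h0 hL1 hL2 uG; have p := uG.1; have [mu_ mG] := p.
have sh1 := smooth1_derive sh.
have ch := smooth1_continuous sh; have ch1 := smooth1_continuous sh1.
have L10 : 0 <= L1 by exact: le_trans (hL1 0).
have lip := derive1_bounded_lipschitz sh hL1.
have lip1 := derive1_bounded_lipschitz sh1 hL2.
have ph := sobolev_pair_comp ch ch1 p.
split => // e e0.
pose q x := dotv (G x) (G x).
have mq : measurable_fun Omega q by exact: measurable_dotvv p.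
pose r (k : nat) x := Num.max (q x - k%:R) 0.
have r0 k x : 0 <= r k x by rewrite le_max lexx orbT.
have mr k : measurable_fun Omega (r k).
  by apply: measurable_maxr => //; exact: measurable_funB.
(* Factor of [r k]: 2 (2 L1)^2, plus 1 to be positive. *)
pose c := 8 * L1 ^+ 2 + 1; have c0 : 0 < c by rewrite ltr_wpDl// mulr_ge0// sqr_ge0.
have e2 : 0 < e / 2 / c by rewrite !divr_gt0.
have [k rk] : exists k, (\int[mu]_(x in Omega) (r k x)%:E < (e / 2 / c)%:E)%E.
  apply: (dominated_small mr mq r0 _ (dotv_integral_lty p (test_approx_lty oO bO uG))) => //.
  - by move=> x; exact: dotv_ge0.
  - apply: nearW => x _; apply: cvg_near_cst.
    exists (Num.truncn (q x)).+1 => // k /= hk; apply/max_idPr.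
    rewrite subr_le0 ltW// (lt_le_trans (truncnS_gt _))// ler_nat//.
  - by apply: nearW => x k _; rewrite ge_max dotv_ge0 gerBl andbT.
(* Dominates both the factor L1^2 + 2 k L2^2 of (phi - u)^2 and the factor 2 L1^2 of |grad phi -
   G|^2. *)
pose d := 3 * L1 ^+ 2 + 2 * k%:R * L2 ^+ 2 + 1.
have d0 : 0 < d.
  have k0 : 0 <= k%:R * L2 ^+ 2 by rewrite mulr_ge0// sqr_ge0.
  by have := sqr_ge0 L1; rewrite /d; lra.
have ed : 0 < e / 2 / d by rewrite !divr_gt0.
have [phi [tp hphi]] := uG.2 _ ed.
exists (h \o phi); split; first exact: test_function_comp.
have sp := test_function_smooth tp.
have pB := sobolev_pairB (sobolev_pair_test tp) p.
apply: le_lt_trans (integral_le2 (a := d) (b := c) oO _ _ _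
  (measurable_sobolev_density pB) (mr k) _ _ _ _) _ => //.
- exact: ltW.
- exact: ltW.
- apply: measurable_sobolev_density; apply: sobolev_pairB ph.
  exact/sobolev_pair_test/test_function_comp.
- exact: sobolev_density_ge0.
- exact: sobolev_density_ge0.
- apply: nearW => x _; rewrite /sobolev_density grad_comp//=.
  set a := phi x; set b := u x; set X := grad phi x; set Y := G x.
  have -> : derive1 h a *: X - derive1 h b *: Y =
      derive1 h a *: (X - Y) + (derive1 h a - derive1 h b) *: Y.
    by rewrite scalerBr scalerBl addrA subrK.
  have := dotvD_le (derive1 h a *: (X - Y)) ((derive1 h a - derive1 h b) *: Y).
  rewrite !dotvZ -/(q x).
  set D := dotv (X - Y) (X - Y); set D' := dotv _ _ => hD.
  have D0 : 0 <= D by exact: dotv_ge0.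
  have q0 : 0 <= q x by exact: dotv_ge0.
  have sqle (y z : R) : `|y| <= z -> y ^+ 2 <= z ^+ 2.
    by move=> yz; rewrite -(real_normK (num_real y)) lerXn2r ?nnegrE// (le_trans _ yz).
  have s1 : (h a - h b) ^+ 2 <= L1 ^+ 2 * (a - b) ^+ 2.
    rewrite -exprMn -(real_normK (num_real (L1 * _))) normrM (ger0_norm L10).
    exact/sqle/lip.
  have s2 : derive1 h a ^+ 2 <= L1 ^+ 2 by exact/sqle/hL1.
  have s3 : (derive1 h a - derive1 h b) ^+ 2 <= L2 ^+ 2 * (a - b) ^+ 2.
    have L20 : 0 <= L2 by exact: le_trans (hL2 0).
    rewrite -exprMn -(real_normK (num_real (L2 * _))) normrM (ger0_norm L20).
    exact/sqle/lip1.
  have s4 : (derive1 h a - derive1 h b) ^+ 2 <= 4 * L1 ^+ 2.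
    have -> : 4 * L1 ^+ 2 = (L1 + L1) ^+ 2 by ring.
    by apply: sqle; apply: le_trans (ler_normB _ _) _; exact: lerD.
  have qr : q x <= k%:R + r k x.
    by rewrite -lerBlDl le_max lexx.
  have ab0 := sqr_ge0 (a - b).
  have r0k := r0 k x.
  move: hD s1 s2 s3 s4; rewrite /d /c.
  set S1 := (h a - h b) ^+ 2; set S2 := derive1 h a ^+ 2.
  set S3 := (derive1 h a - derive1 h b) ^+ 2; set T := (a - b) ^+ 2.
  move=> hD s1 s2 s3 s4.
  have S30 : 0 <= S3 by exact: sqr_ge0.
  have T0 : 0 <= T by exact: sqr_ge0.
  have t1 : S2 * D <= L1 ^+ 2 * D by rewrite ler_wpM2r.
  have t2 : S3 * q x <= S3 * (k%:R + r k x) by rewrite ler_wpM2l.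
  have t3 : S3 * k%:R <= L2 ^+ 2 * T * k%:R by rewrite ler_wpM2r.
  have t4 : S3 * r k x <= 4 * L1 ^+ 2 * r k x by rewrite ler_wpM2r.
  have p1 : 0 <= L1 ^+ 2 * T by rewrite mulr_ge0 ?sqr_ge0.
  have p2 : 0 <= L1 ^+ 2 * D by rewrite mulr_ge0 ?sqr_ge0.
  have p3 : 0 <= k%:R * L2 ^+ 2 * D by rewrite mulr_ge0// mulr_ge0// sqr_ge0.
  lra.
- have -> : e%:E = (d%:E * (e / 2 / d)%:E + c%:E * (e / 2 / c)%:E)%E.
    rewrite -!EFinM -EFinD; congr EFin; field.
    by rewrite !gt_eqF.
  by apply: lteD; rewrite lte_pmul2l.
Qed.

(** Here [h] may have unbounded derivatives. [h \o sinc e] falls under the Lipschitz case, and e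
    tends to 0 by dominated convergence: |sinc e (u)| <= |u| <= M keeps all values where h and h'
    are bounded. *)
Lemma test_approx_comp (h : R -> R) (M : R) u G : smooth1 h -> h 0 = 0 ->
  {ae mu, forall x, Omega x -> `|u x| <= M} ->
  test_approx Omega u G ->
  test_approx Omega (h \o u) (fun x => derive1 h (u x) *: G x).
Proof.
move=> sh h0 uM uG; have p := uG.1.
have sh1 := smooth1_derive sh.
have ch := smooth1_continuous sh; have ch1 := smooth1_continuous sh1.
have ph := sobolev_pair_comp ch ch1 p.
pose e_ (k : nat) : R := k.+1%:R^-1.
have e_0 k : 0 < e_ k by rewrite invr_gt0.
have e_n k : e_ k != 0 by rewrite gt_eqF.
have e_c : e_ @ \oo --> (0 : R) by exact: cvg_harmonic.
pose g k := h \o sinc (e_ k).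
have sg k : smooth1 (g k) by have [] := bounded_comp_sinc sh (e_0 k).
have apg k : test_approx Omega (g k \o u) (fun x => derive1 (g k) (u x) *: G x).
  have [_ [L1 hL1] [L2 hL2]] := bounded_comp_sinc sh (e_0 k).
  have gk0 : g k 0 = 0 by rewrite /g /comp /sinc mulr0 sin0 mulr0.
  exact: (test_approx_comp_lipschitz (sg k) gk0 hL1 hL2 uG).
have g1 k s : derive1 (g k) s = derive1 h (sinc (e_ k) s) * cos (e_ k * s).
  rewrite /g derive1_comp.
  - by rewrite derive1_sinc.
  - exact: (@smooth1_sinc _ (e_ k) 0%N s).
  - exact: (sh 0%N).
have [B0 B00 HB0] := continuous_bounded_segment M ch.
have [B1 B10 HB1] := continuous_bounded_segment M ch1.
apply: (test_approx_closed oO) => // e e0.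
pose f k := sobolev_density ((g k \o u) \- (h \o u))
  (fun x => derive1 (g k) (u x) *: G x - derive1 h (u x) *: G x).
have pf k := sobolev_pairB (apg k).1 ph.
(* Each difference of two values bounded by B0 or B1 is at most twice that bound, hence the squared
   factors 4. *)
pose bnd x := 4 * B0 ^+ 2 + 4 * B1 ^+ 2 * dotv (G x) (G x).
have B02 : 0 <= 4 * B0 ^+ 2 by rewrite mulr_ge0// sqr_ge0.
have B12 : 0 <= 4 * B1 ^+ 2 by rewrite mulr_ge0// sqr_ge0.
have [k fk] : exists k, (\int[mu]_(x in Omega) (f k x)%:E < e%:E)%E.
  apply: (@dominated_small f bnd) => //.
  - by move=> k; exact: measurable_sobolev_density.
  - apply: measurable_funD => //; apply: measurable_funM => //.
    exact: measurable_dotvv p.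
  - by move=> k x; exact: sobolev_density_ge0.
  - by move=> x; rewrite addr_ge0// mulr_ge0// dotv_ge0.
  - apply: le_lt_trans (integral_le2 (a := 4 * B0 ^+ 2) (b := 4 * B1 ^+ 2) oO _ _ _
      (measurable_cst (1 : R)) (measurable_dotvv p) _ _ _ _) _ => //.
    + apply: measurable_funD => //; apply: measurable_funM => //.
      exact: measurable_dotvv p.
    + by move=> x; rewrite addr_ge0// mulr_ge0// dotv_ge0.
    + by move=> x; exact: dotv_ge0.
    + by apply: nearW => x _; rewrite mulr1.
    + rewrite (integral_cst1 oO); apply: lte_add_pinfty.
        by apply: lte_mul_pinfty => //; rewrite lee_fin mulr_ge0// sqr_ge0.
      apply: lte_mul_pinfty => //.
      exact: dotv_integral_lty p (test_approx_lty oO bO uG).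
  - apply: nearW => x _; rewrite /f /sobolev_density.
    have cs := @sinc_cvg R e_ (u x) e_n e_c.
    have c1 : g k (u x) @[k --> \oo] --> h (u x).
      by apply: (continuous_cvg _ _ cs); exact: ch.
    have c2 : derive1 (g k) (u x) @[k --> \oo] --> derive1 h (u x).
      have cc : cos (e_ k * u x) @[k --> \oo] --> (1 : R).
        have ce : e_ k * u x @[k --> \oo] --> (0 : R).
          have := cvgM e_c (cvg_cst (u x)); rewrite mul0r; exact.
        have := continuous_cvg _ (@continuous_cos R 0) ce; rewrite cos0; exact.
      have chs : derive1 h (sinc (e_ k) (u x)) @[k --> \oo] --> derive1 h (u x).
        by apply: (continuous_cvg _ _ cs); exact: ch1.
      rewrite (_ : (fun k => _) =
        (fun k => derive1 h (sinc (e_ k) (u x)) * cos (e_ k * u x))).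
        have := cvgM chs cc; rewrite mulr1; exact.
      by apply/funext => k; rewrite g1.
    have c3 : g k (u x) - h (u x) @[k --> \oo] --> (0 : R).
      by rewrite -(subrr (h (u x))); apply: cvgB => //; exact: cvg_cst.
    have c4 : derive1 (g k) (u x) - derive1 h (u x) @[k --> \oo] --> (0 : R).
      by rewrite -(subrr (derive1 h (u x))); apply: cvgB => //; exact: cvg_cst.
    pose q := dotv (G x) (G x).
    have c5 : (g k (u x) - h (u x)) ^+ 2 +
        (derive1 (g k) (u x) - derive1 h (u x)) ^+ 2 * q @[k --> \oo] --> (0 : R).
      have -> : (0 : R) = 0 ^+ 2 + 0 ^+ 2 * q by rewrite expr0n/= mul0r addr0.
      apply: cvgD; first exact: (cvgM c3 c3).
      by apply: cvgM; [exact: (cvgM c4 c4)|exact: cvg_cst].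
    apply: cvg_trans c5; apply: near_eq_cvg.
    by apply: nearW => k; rewrite -scalerBl dotvZ.
  - apply: filterS uM => x uM k Ox; rewrite /f /sobolev_density -scalerBl dotvZ /bnd.
    have su : `|sinc (e_ k) (u x)| <= M.
      by apply: le_trans (sinc_le _ (e_n k)) (uM Ox).
    have sqle (y z : R) : `|y| <= z -> y ^+ 2 <= z ^+ 2.
      by move=> yz; rewrite -(real_normK (num_real y)) lerXn2r ?nnegrE// (le_trans _ yz).
    apply: lerD.
      have -> : 4 * B0 ^+ 2 = (B0 + B0) ^+ 2 by ring.
      apply: sqle; apply: le_trans (ler_normB _ _) _.
      by apply: lerD; apply: HB0 => //; exact: uM.
    rewrite ler_wpM2r ?dotv_ge0//.
    have -> : 4 * B1 ^+ 2 = (B1 + B1) ^+ 2 by ring.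
    apply: sqle; apply: le_trans (ler_normB _ _) _; apply: lerD.
      rewrite g1 normrM -[leRHS]mulr1; apply: ler_pM => //; first exact: HB1.
      by rewrite ler_norml cos_geN1 cos_le1.
    by apply: HB1; exact: uM.
by exists (g k \o u), (fun x => derive1 (g k) (u x) *: G x).
Qed.

(** Since the i-th partial derivative of x_i phi is x_i d_i phi + phi, integration by parts against
    phi gives int phi^2 = -2 int x_i phi d_i phi. With |x_i| <= r, half of int phi^2 is absorbed. *)
Lemma test_poincare (r : R) (i : 'I_n) phi : 0 <= r ->
  (forall x, Omega x -> forall i, `|x ord0 i| <= r) -> test_function Omega phi ->
  (\int[mu]_(x in Omega) (phi x ^+ 2)%:E <=
   (4 * r ^+ 2)%:E * \int[mu]_(x in Omega) (partial i phi x ^+ 2)%:E)%E.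
Proof.
move=> r0 hr tp; have sp := test_function_smooth tp.
have tdp := test_partial i tp.
have lint (f : V -> R) psi : continuous f -> test_function Omega psi ->
    mu.-integrable Omega (EFin \o (fun x => f x * psi x)).
  by move=> cf tps; apply: loc_integrableM_test => //; exact: continuous_loc_integrable.
pose xi : V -> R := @rV_coord R n i.
have sxi : smooth xi by exact: smooth_coord.
have sxp := smoothM sxi sp.
have dxp x : partial i (xi * phi) x = xi x * partial i phi x + phi x.
  have [_] := is_deriveM (is_derive_coord i i x) (smooth_is_derive x i sp).
  by rewrite /partial => ->; rewrite eqxx /GRing.scale/= mulr1.
have cphi := test_continuous tp; have cdp := test_continuous tdp.
have cxi := smooth_continuous sxi.
have cxp := smooth_continuous sxp.
have cxdp := smooth_continuous (smoothM sxi (smooth_partial i sp)).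
have i1 : mu.-integrable Omega (EFin \o (fun x => phi x * phi x)) by exact: lint.
have i2 : mu.-integrable Omega (EFin \o (fun x => (xi x * phi x) * partial i phi x)).
  exact: (lint _ _ cxp tdp).
have i3 : mu.-integrable Omega (EFin \o (fun x => partial i phi x * partial i phi x)).
  exact: lint.
have i4 : mu.-integrable Omega (EFin \o (fun x => (xi x * partial i phi x) * phi x)).
  exact: (lint _ _ cxdp tp).
have := integral_by_parts i sxp tp.
have -> : (fun x => (xi * phi) x * partial i phi x) =
    (fun x => (xi x * phi x) * partial i phi x) by [].
have -> : (fun x => partial i (xi * phi) x * phi x) =
    (fun x => (xi x * partial i phi x) * phi x + phi x * phi x).
  by apply/funext => x; rewrite dxp mulrDl.
rewrite RintegralD//.
have -> : (fun x => xi x * partial i phi x * phi x) =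
    (fun x => (xi x * phi x) * partial i phi x) by apply/funext => x; rewrite mulrAC.
set I2 := Rintegral _ _ _; set I1 := Rintegral _ _ _ => E12.
have I1E : I1 = - (2 * I2) by lra.
have sq (f : V -> R) : (fun x => (f x ^+ 2)%:E) = (EFin \o (fun x => f x * f x)).
  by apply/funext => x; rewrite /= expr2.
have mphi : measurable_fun Omega phi.
  by apply: measurable_funTS; exact: continuous_measurable_rV.
have mdp : measurable_fun Omega (partial i phi).
  by apply: measurable_funTS; exact: continuous_measurable_rV.
have fin1 : (\int[mu]_(x in Omega) (phi x ^+ 2)%:E)%E \is a fin_num.
  by rewrite sq; exact: integrable_fin_num.
have fin3 : (\int[mu]_(x in Omega) (partial i phi x ^+ 2)%:E)%E \is a fin_num.
  by rewrite sq; exact: integrable_fin_num.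
have I1F : (\int[mu]_(x in Omega) (phi x ^+ 2)%:E)%E = I1%:E.
  rewrite /I1 /Rintegral fineK; last exact: integrable_fin_num i1.
  by apply: eq_integral => x _; rewrite expr2.
have H : (I1%:E <= (1 / 2)%:E * \int[mu]_(x in Omega) (phi x ^+ 2)%:E +
    (2 * r ^+ 2)%:E * \int[mu]_(x in Omega) (partial i phi x ^+ 2)%:E)%E.
  have i22 : mu.-integrable Omega (EFin \o (fun x => 2 * ((xi x * phi x) * partial i phi x))).
    rewrite (_ : EFin \o _ = (fun x => 2%:E * ((xi x * phi x) * partial i phi x)%:E)%E)//.
    exact: integrableZl.
  apply: (@le_trans _ _ (\int[mu]_(x in Omega)
      (`|2 * ((xi x * phi x) * partial i phi x)|)%:E)%E).
    apply: le_trans (le_normr_integral oO i22).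
    by rewrite RintegralZl// -/I2 lee_fin I1E ler_normr lexx orbT.
  apply: integral_le2 => //.
  - by rewrite mulr_ge0// sqr_ge0.
  - by apply: measurableT_comp => //; apply/measurable_EFinP; exact: measurable_int i22.
  - exact: measurable_funX.
  - exact: measurable_funX.
  - by move=> x; rewrite sqr_ge0.
  - by move=> x; rewrite sqr_ge0.
  - apply: nearW => x Ox; have := hr x Ox i.
    rewrite !normrM (ger0_norm (ler0n _ 2)) -/(xi x).
    rewrite -(real_normK (num_real (phi x))) -(real_normK (num_real (partial i phi x))).
    rewrite (_ : x ord0 i = xi x)//.
    move: `|phi x| `|xi x| `|partial i phi x| (normr_ge0 (phi x)) (normr_ge0 (xi x))
      (normr_ge0 (partial i phi x)) => a b c a0 b0 c0 br.
    apply: (@le_trans _ _ (2 * (r * a * c))).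
      by rewrite ler_wpM2l// ler_wpM2r// ler_wpM2r.
    (* 2 r a c <= a^2 / 2 + 2 r^2 c^2. *)
    by have := sqr_ge0 (a - 2 * r * c); nra.
move: H; rewrite I1F -(fineK fin3) -!EFinM -EFinD !lee_fin => H.
lra.
Qed.

(** As G = 0 a.e., the derivative of an approximating phi is itself an approximation error. Poincare
    then makes phi small in L^2, and w with it. One coordinate direction is enough. *)
Lemma poincare_eq0 (i : 'I_n) w G : test_approx Omega w G ->
  {ae mu, forall x, Omega x -> G x = 0} -> {ae mu, forall x, Omega x -> w x = 0}.
Proof.
move=> wG G0; have p := wG.1; have [mw mG] := p.
have [r [r0 hr]] := bounded_set_box bO.
(* From w^2 <= 2 (phi - w)^2 + 2 phi^2 and the Poincare constant 4 r^2. *)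
pose c : R := 2 + 8 * r ^+ 2.
have c0 : 0 < c by rewrite ltr_wpDr// mulr_ge0// sqr_ge0.
have H (e : R) : 0 < e -> (\int[mu]_(x in Omega) (w x ^+ 2)%:E <= (c * e)%:E)%E.
  move=> e0; have [phi [tp hphi]] := wG.2 _ e0.
  have pp := sobolev_pair_test tp; have [mphi mdphi] := pp.
  have pB := sobolev_pairB pp p.
  have mdp : measurable_fun Omega (partial i phi).
    apply: measurable_funTS; apply: continuous_measurable_rV.
    exact: (test_continuous (test_partial i tp)).
  have h1 := le_lt_trans (energy_fun_le oO pB) hphi.
  have h2 := le_lt_trans (energy_grad_le oO i pB) hphi.
  have h3 : (\int[mu]_(x in Omega) (partial i phi x ^+ 2)%:E < e%:E)%E.
    rewrite (_ : (\int[mu]_(x in Omega) _)%E =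
      (\int[mu]_(x in Omega) ((grad phi x - G x)%R ord0 i ^+ 2)%:E)%E)//.
    apply: ae_eq_integral => //.
    - by apply/measurable_EFinP; exact: measurable_funX.
    - by apply/measurable_EFinP; apply: measurable_funX; case: pB.
    - by apply: filterS G0 => x g0 Ox; rewrite g0// !mxE subr0.
  apply: le_trans (integral_le2 (a := 2) (b := 2) oO _ _ _
    (measurable_funX 2 pB.1) (measurable_funX 2 mphi) _ _ _ _) _ => //.
  - exact: measurable_funX.
  - by move=> x; rewrite sqr_ge0.
  - by move=> x; rewrite sqr_ge0.
  - by move=> x; rewrite sqr_ge0.
  - apply: nearW => x _ /=; have := sqr_ge0 (2 * phi x - w x); nra.
  - have -> : (c * e)%:E = (2%:E * e%:E + 2%:E * ((4 * r ^+ 2)%:E * e%:E))%E.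
      by rewrite -!EFinM -EFinD; congr EFin; rewrite /c; ring.
    apply: leeD; first by rewrite lee_pmul2l// ltW.
    rewrite lee_pmul2l//; apply: le_trans (test_poincare i (ltW r0) hr tp) _.
    apply: lee_wpmul2l; last exact: ltW.
    by rewrite lee_fin mulr_ge0// sqr_ge0.
have w0 : (\int[mu]_(x in Omega) (w x ^+ 2)%:E = 0)%E.
  apply/eqP; rewrite eq_le; apply/andP; split; last first.
    by apply: integral_ge0 => x _; rewrite lee_fin sqr_ge0.
  apply/lee_addgt0Pr => e e0; rewrite add0e.
  by have := H (e / c) (divr_gt0 e0 c0); rewrite mulrC divfK// gt_eqF.
have : ae_eq mu Omega (fun x => (w x ^+ 2)%:E) (cst 0%E).
  apply/ae_eq_integral_abs => //; first by apply/measurable_EFinP; exact: measurable_funX.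
  by under eq_integral do rewrite /= ger0_norm ?sqr_ge0//.
by apply: filterS => x h Ox; have [/eqP] := h Ox; rewrite sqrf_eq0 => /eqP.
Qed.

End composition.

(** * The power series *)

Section series.
Variable R : realType.

Lemma limn_esup_gt (v : nat -> \bar R) (c : \bar R) (m0 : nat) :
  (c < limn_esup v)%E -> exists2 m, (m0 <= m)%N & (c < v m)%E.
Proof.
move=> cv; have : (c < esups v m0)%E.
  apply: lt_le_trans cv _; rewrite limn_esup_lim.
  have := @nonincreasing_esups R v; move=> /ereal_nonincreasing_cvgn h.
  rewrite (cvg_lim _ h)//; exact: ereal_inf_lbound.
by move=> /ereal_sup_gt [_ [m /= mm0 <-] cm]; exists m.
Qed.

Variable a : nat -> R.
Hypothesis a_ge0 : forall m, (1 <= m)%N -> 0 <= a m.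

(** 1/k lies strictly below the upper limit 1/s, so a_m^(1/m) > 1/k for arbitrarily large m. For s =
    0 that limit is [+oo]. *)
Lemma radius_infinitely_often (s k : R) (m0 : nat) : 0 <= s -> s < k ->
  limn_esup (fun m => (a m `^ (m%:R)^-1)%:E) = ((s%:E)^-1)%E ->
  exists2 m, (m0 <= m)%N & 1 <= a m * k ^+ m.
Proof.
move=> s0 sk rad; have k0 : 0 < k by exact: le_lt_trans sk.
have lt1 : ((k^-1)%:E < limn_esup (fun m => (a m `^ (m%:R)^-1)%:E))%E.
  rewrite rad; have [->|sn] := eqVneq s 0; first by rewrite inve0 ltry.
  have sp : 0 < s by rewrite lt_neqAle eq_sym sn.
  by rewrite inver (negPf sn) lte_fin ltf_pV2 ?posrE.
(* Index 0 is avoided: its exponent is [0^-1 = 0], and [a 0] has no prescribed sign. *)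
have [m mm0] := limn_esup_gt (maxn m0 1) lt1.
rewrite lte_fin; move: mm0; rewrite geq_max => /andP[mm0 m1] h.
exists m => //.
have m0' : (m%:R : R) != 0 by rewrite pnatr_eq0 -lt0n.
have am : a m = (a m `^ (m%:R)^-1) ^+ m.
  by rewrite -powR_mulrn ?powR_ge0// -powRrM mulVf// powRr1// a_ge0.
rewrite am -exprMn exprn_ege1// -ler_pdivrMr// mul1r; exact: ltW.
Qed.

(** At [+oo] the first term alone, with coefficient [a 1 > 0], is already infinite. *)
Lemma radius_lty (s : \bar R) : a 1%N != 0 -> (0 <= s)%E ->
  (\sum_(1 <= m <oo) (a m)%:E * s ^+ m < +oo)%E -> exists2 r, s = r%:E & 0 <= r.
Proof.
move=> a1 s0 sy; case: s s0 sy => [r|_ sy|//]; first by exists r.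
have a10 : 0 < a 1%N by rewrite lt_neqAle eq_sym a1 a_ge0.
have t0 m : (1 <= m)%N -> true -> (0 <= (a m)%:E * +oo ^+ m)%E.
  by move=> m1 _; rewrite mule_ge0 ?lee_fin ?a_ge0// expe_ge0.
have := @nneseries_lim_ge R (fun m => (a m)%:E * +oo ^+ m)%E xpredT 1 2 t0.
have y1 : (+oo ^+ 1 = +oo :> \bar R)%E by [].
rewrite big_nat1 y1 mulry gtr0_sg// mul1e.
by rewrite leye_eq => /eqP e; rewrite e ltxx in sy.
Qed.

Lemma partial_sum_le (s : R) (n : nat) : 0 <= s ->
  (\sum_(1 <= m <oo) (a m)%:E * s%:E ^+ m < +oo)%E ->
  \sum_(1 <= m < n) a m * s ^+ m <= fine (\sum_(1 <= m <oo) (a m)%:E * s%:E ^+ m)%E.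
Proof.
move=> s0 sy.
have t0 m : (1 <= m)%N -> true -> (0 <= (a m)%:E * s%:E ^+ m)%E.
  by move=> m1 _; rewrite -EFin_expe -EFinM lee_fin mulr_ge0 ?a_ge0// exprn_ge0.
have S0 : (0 <= \sum_(1 <= m <oo) (a m)%:E * s%:E ^+ m)%E by exact: nneseries_ge0.
rewrite -lee_fin fineK ?ge0_fin_numE//.
apply: le_trans (nneseries_lim_ge n t0).
by rewrite -sumEFin; under eq_bigr do rewrite EFinM EFin_expe.
Qed.

End series.

(** * Partial sums of the series as smooth functions *)

Section powers.
Variable R : realType.
Variable a : nat -> R.

(** The G_n of the overview; [dpsum] is its derivative in closed form. *)
Definition psum (n : nat) (s : R) : R := \sum_(1 <= m < n) a m * s ^+ m.

Definition dpsum (n : nat) (s : R) : R :=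
  \sum_(1 <= m < n) a m * (m%:R * s ^+ m.-1).

Lemma smooth1X (m : nat) : smooth1 (fun s : R => s ^+ m).
Proof.
elim: m => [|m ih].
  by rewrite (_ : (fun _ => _) = cst 1); [exact: smooth1_cst|apply/funext => s].
rewrite (_ : (fun _ => _) = @id R * (fun s => s ^+ m)).
  exact: (smooth1M (@smooth1_id R) ih).
by apply/funext => s; rewrite exprS.
Qed.

Lemma derive1X (m : nat) (s : R) :
  derive1 (fun s : R => s ^+ m) s = m%:R * s ^+ m.-1.
Proof.
have := is_deriveX m (is_derive_id s (1 : R)); rewrite derive1E.
have -> : @id R ^+ m = (fun s : R => s ^+ m) by apply/funext => t; rewrite fctE.
by case=> _ ->; rewrite /GRing.scale/= mulr1.
Qed.

Lemma psumS n s : (1 <= n)%N -> psum n.+1 s = psum n s + a n * s ^+ n.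
Proof. by move=> n1; rewrite /psum big_nat_recr. Qed.

Lemma dpsumS n s : (1 <= n)%N -> dpsum n.+1 s = dpsum n s + a n * (n%:R * s ^+ n.-1).
Proof. by move=> n1; rewrite /dpsum big_nat_recr. Qed.

Lemma psum_lt2 n s : (n <= 1)%N -> psum n s = 0.
Proof. by move=> n1; rewrite /psum big_geq. Qed.

Lemma dpsum_lt2 n s : (n <= 1)%N -> dpsum n s = 0.
Proof. by move=> n1; rewrite /dpsum big_geq. Qed.

Lemma smooth1_psum n : smooth1 (psum n).
Proof.
elim: n => [|n ih].
  by rewrite (_ : psum 0 = cst 0); [exact: smooth1_cst|apply/funext => s; exact: psum_lt2].
have [n0|n1] := leqP n 0.
  rewrite (_ : psum n.+1 = cst 0); first exact: smooth1_cst.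
  by apply/funext => s; rewrite psum_lt2.
rewrite (_ : psum n.+1 = psum n + cst (a n) * (fun s => s ^+ n)).
  have := smooth1D ih (smooth1M (@smooth1_cst R (a n)) (@smooth1X n)); exact.
by apply/funext => s; rewrite psumS.
Qed.

Lemma derive1_psum n s : derive1 (psum n) s = dpsum n s.
Proof.
have cst0 (g : R -> R) : (forall t, g t = 0) -> derive1 g s = 0.
  by move=> g0; rewrite (_ : g = cst 0) ?derive1_cst//; exact/funext.
elim: n => [|n ih].
  by rewrite dpsum_lt2// cst0// => t; rewrite psum_lt2.
have [n0|n1] := leqP n 0.
  by rewrite dpsum_lt2// cst0// => t; rewrite psum_lt2.
rewrite (_ : psum n.+1 = psum n + cst (a n) * (fun s => s ^+ n)); last first.
  by apply/funext => t; rewrite psumS.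
have d1 := smooth1_is_derive s (@smooth1_psum n).
have d2 := smooth1_is_derive s (@smooth1X n).
have d3 := is_deriveM (is_derive_cst (a n) s (1 : R)) d2.
rewrite derive1E; case: (is_deriveD d1 d3) => _ ->.
by rewrite scaler0 addr0 ih dpsumS// derive1X.
Qed.

Lemma dpsum_continuous n : continuous (dpsum n).
Proof.
rewrite (_ : dpsum n = derive1 (psum n)); last first.
  by apply/funext => s; rewrite derive1_psum.
exact/smooth1_continuous/smooth1_derive/smooth1_psum.
Qed.

Hypothesis a_ge0 : forall m, (1 <= m)%N -> 0 <= a m.

Lemma dpsum_ge0 n s : 0 <= s -> 0 <= dpsum n s.
Proof.
move=> s0; rewrite /dpsum big_nat_cond; apply: sumr_ge0 => m /andP[/andP[m1 _] _].
by rewrite mulr_ge0 ?a_ge0// mulr_ge0// exprn_ge0.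
Qed.

Lemma psum_le n s t : 0 <= s -> s <= t -> psum n s <= psum n t.
Proof.
move=> s0 st; rewrite /psum big_nat_cond [leRHS]big_nat_cond.
apply: ler_sum => m /andP[/andP[m1 _] _].
by rewrite ler_wpM2l ?a_ge0// lerXn2r ?nnegrE// (le_trans s0).
Qed.

End powers.

(** * The bilinear form *)

Section bilinear_form.
Variables (R : realType) (n : nat).
Local Notation V := 'rV[R]_n.
Local Notation mu := (lebesgue_rV R n).
Variable Omega : set V.
Hypotheses (oO : open Omega) (bO : bounded_set Omega).
Variables (A : V -> 'M[R]_n) (alpha beta : R).
Hypothesis A_meas : forall i j, measurable_fun setT (fun x => A x i j).
Hypothesis A_sym : forall x, (A x)^T = A x.
Hypothesis alpha_gt0 : 0 < alpha.
Hypothesis A_coercive : {ae mu, forall x, Omega x ->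
  forall xi : V, xi != 0 -> alpha * dotv xi xi <= dotv (xi *m (A x)^T) xi}.
Hypothesis A_bounded : {ae mu, forall x, Omega x -> `|A x| <= beta}.

Let mO : measurable Omega := open_measurable_rV oO.

Definition bil (x xi eta : V) : R := dotv (xi *m (A x)^T) eta.

Lemma dotvDl (u v w : V) : dotv (u + v) w = dotv u w + dotv v w.
Proof. by rewrite /dotv -big_split; apply: eq_bigr => i _; rewrite !mxE mulrDl. Qed.

Lemma dotvZl c (u w : V) : dotv (c *: u) w = c * dotv u w.
Proof. by rewrite /dotv mulr_sumr; apply: eq_bigr => i _; rewrite !mxE mulrA. Qed.

Lemma bilE x xi eta : bil x xi eta = \sum_i \sum_j xi ord0 j * A x i j * eta ord0 i.
Proof.
apply: eq_bigr => i _; rewrite mxE mulr_suml; apply: eq_bigr => j _.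
by rewrite mxE.
Qed.

Lemma bilC x xi eta : bil x xi eta = bil x eta xi.
Proof.
rewrite !bilE exchange_big; apply: eq_bigr => i _; apply: eq_bigr => j _.
by rewrite -{1}(A_sym x) mxE; ring.
Qed.

Lemma bilZl x c xi eta : bil x (c *: xi) eta = c * bil x xi eta.
Proof. by rewrite /bil -scalemxAl dotvZl. Qed.

Lemma bilZr x c xi eta : bil x xi (c *: eta) = c * bil x xi eta.
Proof. by rewrite bilC bilZl bilC. Qed.

Lemma bilDl x xi xi' eta : bil x (xi + xi') eta = bil x xi eta + bil x xi' eta.
Proof. by rewrite /bil mulmxDl dotvDl. Qed.

Lemma bilDr x xi eta eta' : bil x xi (eta + eta') = bil x xi eta + bil x xi eta'.
Proof. by rewrite bilC bilDl bilC [bil x eta' _]bilC. Qed.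

Lemma bil_coercive : {ae mu, forall x, Omega x ->
  forall xi, alpha * dotv xi xi <= bil x xi xi}.
Proof.
apply: filterS A_coercive => x H Ox xi; have [->|/(H Ox)//] := eqVneq xi 0.
by rewrite /bil mul0mx /dotv !big1 ?mulr0// => i _; rewrite mxE mul0r.
Qed.

Lemma bil_ge0 : {ae mu, forall x, Omega x -> forall xi, 0 <= bil x xi xi}.
Proof.
apply: filterS bil_coercive => x H Ox xi; apply: le_trans (H Ox xi).
by rewrite mulr_ge0 ?dotv_ge0// ltW.
Qed.

(* Positivity of [bil x (t *: xi - eta) (t *: xi - eta)]. *)
Lemma bil_young (t : R) : 0 < t -> {ae mu, forall x, Omega x -> forall xi eta,
  bil x xi eta <= t / 2 * bil x xi xi + (2 * t)^-1 * bil x eta eta}.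
Proof.
move=> t0; apply: filterS bil_ge0 => x H Ox xi eta.
have := H Ox (t *: xi + (- 1) *: eta).
rewrite bilDl !bilDr !bilZl !bilZr [bil x eta xi]bilC.
move: (bil x xi xi) (bil x xi eta) (bil x eta eta) => p q r h.
rewrite -subr_ge0.
have -> : t / 2 * p + (2 * t)^-1 * r - q =
    (t * (t * p) + t * (-1 * q) + (-1 * (t * q) + -1 * (-1 * r))) * (2 * t)^-1.
  by field; rewrite gt_eqF.
by rewrite mulr_ge0// invr_ge0 mulr_ge0// ltW.
Qed.

(** The matrix norm is the largest entry, so each of the n^2 products is bounded separately; summing
    the squares over the free index produces the factor n. *)
Lemma bil_le : {ae mu, forall x, Omega x -> forall xi eta,
  `|bil x xi eta| <= (`|beta| * n%:R) * (dotv xi xi + dotv eta eta)}.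
Proof.
apply: filterS A_bounded => x H Ox xi eta.
have Aij i j : `|A x i j| <= `|beta|.
  apply: (@le_trans _ _ `|A x|); last by apply: le_trans (H Ox) _; exact: ler_norm.
  rewrite [leRHS]/Num.norm/= mx_normrE.
  by apply: (le_bigmax (0:R) (fun ij => `|A x ij.1 ij.2|) (i, j)).
rewrite bilE; apply: le_trans (ler_norm_sum _ _ _) _.
apply: (@le_trans _ _ (\sum_(i < n) \sum_(j < n)
    `|beta| * (xi ord0 j ^+ 2 + eta ord0 i ^+ 2))).
  apply: ler_sum => i _; apply: le_trans (ler_norm_sum _ _ _) _.
  apply: ler_sum => j _; rewrite !normrM.
  rewrite -(real_normK (num_real (xi ord0 j))) -(real_normK (num_real (eta ord0 i))).
  apply: (@le_trans _ _ (`|xi ord0 j| * `|beta| * `|eta ord0 i|)).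
    by rewrite ler_wpM2r// ler_wpM2l.
  move: `|xi ord0 j| `|eta ord0 i| `|beta| (normr_ge0 beta) => p q b b0.
  rewrite mulrAC mulrC ler_wpM2l//.
  by have := sqr_ge0 (p - q); have := sqr_ge0 (p + q); nra.
rewrite le_eqVlt; apply/orP; left; apply/eqP.
under eq_bigr do rewrite -mulr_sumr big_split/= sumr_const card_ord.
rewrite -mulr_sumr big_split/= sumr_const card_ord -mulrA; congr (_ * _).
have sqE (v : V) : \sum_i v ord0 i ^+ 2 = dotv v v.
  by apply: eq_bigr => i _; rewrite expr2.
by rewrite -!sqE mulrDr !mulr_natl sumrMnl.
Qed.

Lemma measurable_bil (G H : V -> V) :
  (forall i, measurable_fun Omega (fun x => G x ord0 i)) ->
  (forall i, measurable_fun Omega (fun x => H x ord0 i)) ->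
  measurable_fun Omega (fun x => bil x (G x) (H x)).
Proof.
move=> mG mH; rewrite (_ : (fun _ => _) = (fun x => \sum_i \sum_j
    G x ord0 j * A x i j * H x ord0 i)); last by apply/funext => x; rewrite bilE.
apply: measurable_sum => i; apply: measurable_sum => j.
by apply: measurable_funM => //; apply: measurable_funM => //; exact: measurable_funTS.
Qed.

(** Passing to |h| changes nothing a.e., and [fine] of a nonnegative extended integral is
    nonnegative, also at [+oo]. *)
Lemma Rintegral_ge0_ae (h : V -> R) : measurable_fun Omega h ->
  {ae mu, forall x, Omega x -> 0 <= h x} -> 0 <= \int[mu]_(x in Omega) h x.
Proof.
move=> mh h0; rewrite /Rintegral.
rewrite (_ : (\int[mu]_(x in Omega) (h x)%:E = \int[mu]_(x in Omega) `|(h x)%:E|)%E).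
  by apply: fine_ge0; exact: integral_ge0.
apply: ae_eq_integral => //; first exact/measurable_EFinP.
  by apply: measurableT_comp => //; exact/measurable_EFinP.
by apply: filterS h0 => x hx Ox; rewrite /= ger0_norm// hx.
Qed.

Lemma Rintegral_le_ae (h k : V -> R) :
  mu.-integrable Omega (EFin \o h) -> mu.-integrable Omega (EFin \o k) ->
  {ae mu, forall x, Omega x -> h x <= k x} ->
  \int[mu]_(x in Omega) h x <= \int[mu]_(x in Omega) k x.
Proof.
move=> ih ik hk; rewrite -subr_ge0 -RintegralB//; apply: Rintegral_ge0_ae.
  have /measurable_EFinP mh := measurable_int _ ih.
  have /measurable_EFinP mk := measurable_int _ ik.
  exact: measurable_funB.
by apply: filterS hk => x h1 Ox; rewrite subr_ge0 h1.
Qed.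

Lemma Rintegral_eq_ae (h k : V -> R) :
  measurable_fun Omega h -> measurable_fun Omega k ->
  {ae mu, forall x, Omega x -> h x = k x} ->
  \int[mu]_(x in Omega) h x = \int[mu]_(x in Omega) k x.
Proof.
move=> mh mk hk; congr fine; apply: ae_eq_integral => //.
- exact/measurable_EFinP.
- exact/measurable_EFinP.
- by apply: filterS hk => x h1 Ox; rewrite h1.
Qed.

Lemma bounded_comp_integrable (k : R -> R) (M : R) (u f : V -> R) : continuous k ->
  measurable_fun Omega u -> {ae mu, forall x, Omega x -> `|u x| <= M} ->
  mu.-integrable Omega (EFin \o f) ->
  mu.-integrable Omega (EFin \o (fun x => k (u x) * f x)).
Proof.
move=> ck mu_ uM If; have [B B0 HB] := continuous_bounded_segment M ck.
have /measurable_EFinP mf := measurable_int _ If.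
have mkf : measurable_fun Omega (fun x => k (u x) * f x).
  apply: measurable_funM => //.
  by apply: measurableT_comp => //; exact: continuous_measurable_fun.
apply/integrableP; split; first exact/measurable_EFinP.
have iB : mu.-integrable Omega (fun x => B%:E * (f x)%:E)%E by exact: integrableZl.
have /integrableP[mB By] := iB.
apply: le_lt_trans By; apply: ae_ge0_le_integral => //.
- by apply: measurableT_comp => //; exact/measurable_EFinP.
- by apply: measurableT_comp.
- apply: filterS uM => x h Ox; rewrite /= lee_fin !normrM (ger0_norm B0).
  by rewrite ler_wpM2r// HB// h.
Qed.

Lemma bil_integrable (u w : V -> R) (G H : V -> V) :
  test_approx Omega u G -> test_approx Omega w H ->
  mu.-integrable Omega (EFin \o (fun x => bil x (G x) (H x))).
Proof.
move=> uG wH; have [_ mG] := uG.1; have [_ mH] := wH.1.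
have yG := dotv_integral_lty oO uG.1 (test_approx_lty oO bO uG).
have yH := dotv_integral_lty oO wH.1 (test_approx_lty oO bO wH).
pose c := `|beta| * n%:R; have c0 : 0 <= c by rewrite mulr_ge0.
have mb := measurable_bil mG mH.
apply/integrableP; split; first exact/measurable_EFinP.
apply: (@le_lt_trans _ _ (c%:E * \int[mu]_(x in Omega) (dotv (G x) (G x))%:E +
  c%:E * \int[mu]_(x in Omega) (dotv (H x) (H x))%:E)%E).
  apply: (integral_le2 (p := fun x => `|bil x (G x) (H x)|) oO) => //.
  - exact: measurableT_comp.
  - exact: measurable_dotv.
  - exact: measurable_dotv.
  - by move=> x; exact: dotv_ge0.
  - by move=> x; exact: dotv_ge0.
  - by apply: filterS bil_le => x h Ox; rewrite -mulrDr; exact: h.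
by apply: lte_add_pinfty; apply: lte_mul_pinfty => //; rewrite lee_fin.
Qed.

End bilinear_form.

(** * Weak solutions *)

Section weak_solutions.
Variables (R : realType) (n : nat).
Local Notation V := 'rV[R]_n.
Local Notation mu := (lebesgue_rV R n).
Variable Omega : set V.
Hypotheses (oO : open Omega) (bO : bounded_set Omega).

Let mO : measurable Omega := open_measurable_rV oO.
Let fO : (mu Omega < +oo)%E := bounded_measure_lty bO mO.

Lemma Lpy_bounded u : Lp Omega +oo%E u ->
  exists M, {ae mu, forall x, Omega x -> `|u x| <= M}.
Proof.
rewrite /Lp inE/= => /andP[_]; rewrite inE/= /finite_norm unlock /=.
case: ifPn => [_|]; last first.
  (* The L^oo norm is 0 by convention when the whole space is null; then every bound holds a.e. *)
  rewrite -leNgt => m0 _; exists 0.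
  exists setT; split => //; apply/eqP; rewrite eq_le m0; exact: measure_ge0.
move=> /ereal_inf_lt[y /= uy yy].
have [M yM] : exists M : R, (y <= M%:E)%E.
  by case: y yy uy => [r _ _|//|_ _]; [exists r|exists 0; rewrite leNye].
exists M; apply: filterS uy => x h Ox.
by have := le_trans h yM; rewrite /= patchE mem_set//= lee_fin.
Qed.

(** |f| <= |f|^q + 1 on a set of finite measure. *)
Lemma Lp_integrable (q : R) f : 1 <= q -> Lp Omega q%:E f ->
  mu.-integrable Omega (EFin \o f).
Proof.
move=> q1 fq; have := Lfun_integrable q1 fq.
have /set_mem/= /(measurable_restrictT _ mO) mf := sub_Lfun_mfun fq.
move=> /integrableP[_ fqy].
have mfq : measurable_fun Omega (fun x => `|f x| `^ q).
  apply: (measurableT_comp (@measurable_powR R q)).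
  exact: measurableT_comp.
have Fy : (\int[mu]_(x in Omega) (`|f x| `^ q)%:E < +oo)%E.
  apply: le_lt_trans fqy; rewrite [leLHS]integral_mkcond.
  apply: ge0_le_integral => //.
  - by move=> x _; rewrite patchE; case: ifP => // _; rewrite lee_fin powR_ge0.
  - apply/(measurable_restrictT _ mO); exact/measurable_EFinP.
  - apply: measurableT_comp => //; apply/measurable_EFinP.
    apply: (measurableT_comp (@measurable_powR R q)).
    by apply: measurableT_comp => //; apply/(measurable_restrictT _ mO).
  - move=> x _; rewrite !patchE; case: ifP => _ /=; last by rewrite lee_fin.
    by rewrite lee_fin ler_norm.
apply/integrableP; split; first exact/measurable_EFinP.
apply: (@le_lt_trans _ _ (1%:E * \int[mu]_(x in Omega) (`|f x| `^ q)%:E +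
  1%:E * \int[mu]_(x in Omega) (cst (1 : R) x)%:E)%E).
  apply: (integral_le2 (p := fun x => `|f x|) oO) => //.
  - exact: measurableT_comp.
  - apply: nearW => x _; rewrite !mul1r.
    have [f1|f1] := leP `|f x| 1.
      by rewrite -[leLHS]add0r lerD// powR_ge0.
    rewrite -[leLHS]addr0 lerD// -[leLHS]powRr1//.
    by rewrite ler_powR// ltW.
by rewrite (integral_cst1 oO) !mul1e; exact: lte_add_pinfty.
Qed.

(** Otherwise phi and -phi would both give nonpositive integrals, all of them would vanish, and [f]
    would be zero a.e. by the fundamental lemma. *)
Lemma exists_test_integral_gt0 f : mu.-integrable Omega (EFin \o f) ->
  ~ {ae mu, forall x, Omega x -> f x = 0} ->
  exists2 phi, test_function Omega phi & 0 < \int[mu]_(x in Omega) (f x * phi x).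
Proof.
move=> If fn; apply: contrapT => H; apply: fn.
have lf := integrable_loc oO If.
apply: (test_integral_eq0 oO lf) => phi tp.
have le0 psi : test_function Omega psi -> \int[mu]_(x in Omega) (f x * psi x) <= 0.
  by move=> tps; rewrite leNgt; apply/negP => h; apply: H; exists psi.
apply/eqP; rewrite eq_le le0//=.
have tN : test_function Omega (cst (- 1) * phi).
  by apply: test_functionM_l => //; exact: smooth_cst.
have := le0 _ tN.
have -> : (fun x => f x * (cst (- 1) * phi) x) = (fun x => - 1 * (f x * phi x)).
  by apply/funext => x; rewrite fctE /cst; ring.
rewrite RintegralZl//; last exact: loc_integrableM_test.
by rewrite mulN1r oppr_le0.
Qed.

Lemma Rintegral_eq0_ae (h : V -> R) : mu.-integrable Omega (EFin \o h) ->
  {ae mu, forall x, Omega x -> 0 <= h x} -> \int[mu]_(x in Omega) h x = 0 ->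
  {ae mu, forall x, Omega x -> h x = 0}.
Proof.
move=> ih h0 e; have mh := measurable_int _ ih.
have : ae_eq mu Omega (EFin \o h) (cst 0%E).
  apply/ae_eq_integral_abs => //.
  rewrite -[RHS](_ : (\int[mu]_(x in Omega) (h x)%:E = 0)%E); last first.
    by rewrite -[LHS](fineK (integrable_fin_num mO ih)); congr EFin.
  apply: ae_eq_integral => //; first exact: measurableT_comp.
  by apply: filterS h0 => x hx Ox; rewrite /= ger0_norm// hx.
by apply: filterS => x hx Ox; have [] := hx Ox.
Qed.

Variables (A : V -> 'M[R]_n) (alpha beta : R).
Hypothesis A_meas : forall i j, measurable_fun setT (fun x => A x i j).
Hypothesis A_sym : forall x, (A x)^T = A x.
Hypothesis alpha_gt0 : 0 < alpha.
Hypothesis A_coercive : {ae mu, forall x, Omega x ->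
  forall xi : V, xi != 0 -> alpha * dotv xi xi <= dotv (xi *m (A x)^T) xi}.
Hypothesis A_bounded : {ae mu, forall x, Omega x -> `|A x| <= beta}.
Variable a : nat -> R.
Hypothesis a_ge0 : forall m, (1 <= m)%N -> 0 <= a m.

Local Notation form x xi eta := (bil A x xi eta).
Local Notation G u := (weak_grad Omega u).

Let continuous_scaleX (c d : R) m : continuous (fun s : R => c * (d * s ^+ m)).
Proof.
move=> s; apply: cvgM; first exact: cvg_cst.
by apply: cvgM; [exact: cvg_cst|exact: exprn_continuous].
Qed.

(** * Consequences of the equation for a fixed solution *)

Section solution.
Variables (g u : V -> R).
Hypothesis sol : weak_solution Omega A a g u.

Lemma solution_approx : test_approx Omega u (G u).
Proof. by case: sol => _ Hu _ _; exact: H10_test_approx. Qed.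

Lemma solution_bounded : exists M, {ae mu, forall x, Omega x -> `|u x| <= M}.
Proof. by case: sol => _ _ uy _; exact: Lpy_bounded. Qed.

Lemma form_integrable (k : R -> R) w H : continuous k -> test_approx Omega w H ->
  mu.-integrable Omega (EFin \o (fun x => k (u x) * form x (G u x) (H x))).
Proof.
move=> ck wH; have [M uM] := solution_bounded.
apply: (bounded_comp_integrable oO ck _ uM); first by case: solution_approx => -[].
exact: (bil_integrable oO bO A_meas A_bounded solution_approx wH).
Qed.

Lemma solution_comp (h : R -> R) : smooth1 h -> h 0 = 0 ->
  test_approx Omega (h \o u) (fun x => derive1 h (u x) *: G u x).
Proof.
move=> sh h0; have [M uM] := solution_bounded.
exact: test_approx_comp sh h0 uM solution_approx.
Qed.

(** Trades the chosen weak gradients for explicit ones: m u^(m-1) grad u by the chain rule, and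
    [H]. *)
Lemma solution_term w H m : test_approx Omega w H -> (1 <= m)%N ->
  \int[mu]_(x in Omega) dotv (G (fun y => u y ^+ m) x *m (a m *: A x)^T) (G w x) =
  \int[mu]_(x in Omega) (a m * (m%:R * u x ^+ m.-1) * form x (G u x) (H x)).
Proof.
move=> wH m1.
have um : test_approx Omega (fun y => u y ^+ m)
    (fun x => derive1 (fun s : R => s ^+ m) (u x) *: G u x).
  apply: (@solution_comp (fun s : R => s ^+ m)); first exact: smooth1X.
  by rewrite expr0n; case: m m1.
have wum := test_approx_weak oO bO um; have ww := test_approx_weak oO bO wH.
have [_ m1G] := sobolev_pair_weak (weak_gradP wum).
have [_ m2G] := sobolev_pair_weak (weak_gradP ww).
have E x : dotv (G (fun y => u y ^+ m) x *m (a m *: A x)^T) (G w x) =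
    a m * form x (G (fun y => u y ^+ m) x) (G w x).
  by rewrite linearZ/= -scalemxAr dotvZl.
have cm : continuous (fun s : R => a m * (m%:R * s ^+ m.-1)).
  exact: continuous_scaleX.
apply: Rintegral_eq_ae => //.
- rewrite (funext E : (fun x => _) = _).
  by apply: measurable_funM => //; exact: measurable_bil.
- have := measurable_int _ (form_integrable cm wH).
  by move/measurable_EFinP.
- apply: filterS2 (weak_gradE oO wum) (weak_gradE oO ww) => x e1 e2 Ox.
  by rewrite E e1// e2// derive1X bilZl mulrA.
Qed.

(** The partial sums collapse to a single integral with coefficient G_k'(u), the form in which the
    equation is tested from here on. *)
Lemma solution_weak_form w H : test_approx Omega w H ->
  (fun k => \int[mu]_(x in Omega) (dpsum a k (u x) * form x (G u x) (H x)))
    @ \oo --> \int[mu]_(x in Omega) (g x * w x).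
Proof.
move=> wH; have [_ _ _ /(_ w (test_approx_H10 oO bO wH))] := sol.
apply: cvg_trans; apply: near_eq_cvg; apply: nearW => k.
elim: k => [|k ih].
  rewrite big_geq//; apply/esym.
  rewrite (_ : (fun _ => _) = cst 0); first by rewrite /Rintegral integral0.
  by apply/funext => x; rewrite dpsum_lt2// mul0r.
have [k0|k1] := leqP k 0.
  rewrite big_geq//; apply/esym.
  rewrite (_ : (fun _ => _) = cst 0); first by rewrite /Rintegral integral0.
  by apply/funext => x; rewrite dpsum_lt2// mul0r.
rewrite big_nat_recr//= ih (solution_term wH k1) -RintegralD//.
- by apply: eq_Rintegral => x _; rewrite dpsumS// mulrDl.
- by apply: form_integrable wH; exact: dpsum_continuous.
- by apply: (@form_integrable (fun s => a k * (k%:R * s ^+ k.-1)) _ _ _ wH);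
    exact: continuous_scaleX.
Qed.

Lemma solution_le (i : 'I_n) (k : R) : 0 < k ->
  (forall m0, exists2 m, (m0 <= m)%N & 1 <= a m * k ^+ m) ->
  {ae mu, forall x, Omega x -> u x <= k}.
Proof.
move=> k0 ak.
(* A smooth substitute for (s - k)^+; h(0) = 0 because k > 0. *)
pose h := @bumpf R \o (@id R + cst (- k)).
have sh : smooth1 h.
  apply: smooth1_comp; first exact: smooth1_bumpf.
  by apply: smooth1D; [exact: smooth1_id|exact: smooth1_cst].
have h0 : h 0 = 0 by rewrite /h /= bump_eq0// fctE /cst add0r oppr_le0 ltW.
have dh s : derive1 h s = derive1 (@bumpf R) (s - k).
  have d1 := is_deriveD (is_derive_id s (1 : R)) (is_derive_cst (- k) s (1 : R)).
  have d2 := is_derive1_comp (smooth1_is_derive _ (@smooth1_bumpf R)) d1.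
  by rewrite derive1E; case: d2 => _ ->; rewrite addr0 mulr1.
have ch1 : continuous (derive1 h) by exact/smooth1_continuous/smooth1_derive.
have hu := solution_comp sh h0.
have L := solution_weak_form hu.
set Vn := (fun k => _) in L.
pose Q x := derive1 h (u x) * form x (G u x) (G u x).
have iQ : mu.-integrable Omega (EFin \o Q).
  exact: form_integrable ch1 solution_approx.
have Qge0 : {ae mu, forall x, Omega x -> 0 <= Q x}.
  apply: filterS (bil_ge0 alpha_gt0 A_coercive) => x H Ox.
  rewrite /Q mulr_ge0 ?H// dh.
  by have [/bump_der_eq0->|/bump_der_gt0/ltW] := leP (u x - k) 0.
have iTQ m c : mu.-integrable Omega (EFin \o (fun x => c * (m%:R * u x ^+ m.-1) * Q x)).
  have ck : continuous (fun s : R => c * (m%:R * s ^+ m.-1) * derive1 h s).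
    by move=> s; apply: cvgM; [exact: continuous_scaleX|exact: ch1].
  have := form_integrable ck solution_approx.
  by under eq_fun do rewrite -mulrA.
pose J := \int[mu]_(x in Omega) Q x.
have J0 : 0 <= J.
  have /measurable_EFinP mQ := measurable_int _ iQ.
  exact: Rintegral_ge0_ae.
(* h'(u) vanishes unless u > k, and there m u^(m-1) >= k^(m-1). *)
have step m : (1 <= m)%N -> a m * k ^+ m.-1 * J <= Vn m.+1 - Vn m.
  move=> m1; rewrite /J -RintegralZl// /Vn -RintegralB//; last 2 first.
  - by apply: form_integrable hu; exact: dpsum_continuous.
  - by apply: form_integrable hu; exact: dpsum_continuous.
  have -> : (fun x => dpsum a m.+1 (u x) * form x (G u x) (derive1 h (u x) *: G u x) -
      dpsum a m (u x) * form x (G u x) (derive1 h (u x) *: G u x)) =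
      (fun x => a m * (m%:R * u x ^+ m.-1) * Q x).
    by apply/funext => x; rewrite -mulrBl dpsumS// addrAC subrr add0r (bilZr A_sym).
  apply: Rintegral_le_ae => //.
    rewrite (_ : EFin \o _ = (fun x => (a m * k ^+ m.-1)%:E * (Q x)%:E)%E)//.
    exact: integrableZl.
  apply: filterS Qge0 => x Q0 Ox.
  have [uk|uk] := leP (u x) k.
    by rewrite /Q dh bump_der_eq0 ?mul0r ?mulr0// subr_le0.
  rewrite ler_wpM2r ?Q0// ler_wpM2l ?a_ge0//.
  rewrite -[leLHS]mul1r; apply: ler_pM => //.
  - exact/exprn_ge0/ltW.
  - by rewrite ler1n.
  - by rewrite lerXn2r ?nnegrE// ltW// (lt_trans k0).
have JE : J = 0.
  apply/eqP; rewrite eq_le J0 andbT leNgt; apply/negP => Jp.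
  have D0 : (fun m => Vn m.+1 - Vn m) @ \oo --> (0 : R).
    rewrite -(subrr (\int[mu]_(x in Omega) (g x * (h \o u) x))).
    by apply: cvgB => //; rewrite (cvg_shiftS Vn).
  (* Increments tend to 0, yet a_m k^m >= 1 makes them at least J / k for arbitrarily large m. *)
  have /cvgrPdist_lt/(_ _ (divr_gt0 Jp k0)) [N _ HN] := D0.
  have [m mN am] := ak (maxn N 1).
  move: mN; rewrite geq_max => /andP[mN m1].
  have := HN m mN; rewrite /= sub0r normrN => /ltr_normlW; apply/negP; rewrite -leNgt.
  apply: le_trans (step m m1).
  rewrite ler_pdivrMr//.
  have -> : a m * k ^+ m.-1 * J * k = a m * k ^+ m * J.
    by rewrite (_ : k ^+ m = k ^+ m.-1 * k); [ring|rewrite -exprSr prednK].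
  by rewrite ler_peMl.
have QE := Rintegral_eq0_ae iQ Qge0 JE.
(* Where [Q] vanishes, either h'(u) = 0 or, by coercivity, grad u = 0. *)
have hG0 : {ae mu, forall x, Omega x -> derive1 h (u x) *: G u x = 0}.
  apply: filterS2 QE (bil_coercive A_coercive) => x q0 co Ox.
  have := q0 Ox; rewrite /Q => /eqP; rewrite mulf_eq0 => /orP[/eqP->|/eqP f0].
    by rewrite scale0r.
  have := co Ox (G u x); rewrite f0 pmulr_rle0// => d0.
  have /dotv0_eq0 -> : dotv (G u x) (G u x) = 0.
    by apply/eqP; rewrite eq_le d0 dotv_ge0.
  by rewrite scaler0.
have := poincare_eq0 oO bO i hu hG0.
apply: filterS => x hx Ox; rewrite leNgt; apply/negP => ku.
have := hx Ox; rewrite /h /= fctE /cst => e.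
by have := bump_gt0 (u x - k); rewrite e ltxx subr_gt0 ku.
Qed.

(** The test function G_k(u) is frozen while the index m of the partial sums runs. Since u >= 0
    these sums are nondecreasing in m; the left side is the one at m = k, hence lies below the limit
    int g G_k(u). *)
Lemma solution_energy (s B : R) (k : nat) : 0 <= s ->
  {ae mu, forall x, Omega x -> 0 <= u x} ->
  {ae mu, forall x, Omega x -> u x <= s} ->
  {ae mu, forall x, Omega x -> 0 <= g x} ->
  mu.-integrable Omega (EFin \o g) -> psum a k s <= B ->
  \int[mu]_(x in Omega) (dpsum a k (u x) ^+ 2 * form x (G u x) (G u x)) <=
  B * \int[mu]_(x in Omega) g x.
Proof.
move=> s0 u0 us g0 ig sB.
have p0 : psum a k 0 = 0.
  rewrite /psum big_nat_cond big1// => m /andP[/andP[m1 _] _].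
  by rewrite expr0n; case: m m1 => // m _; rewrite mulr0.
have pu : test_approx Omega (psum a k \o u)
    (fun x => derive1 (psum a k) (u x) *: G u x).
  by apply: solution_comp p0; exact: smooth1_psum.
have c := solution_weak_form pu; set Vn := (fun k => _) in c.
have dE : (fun x => derive1 (psum a k) (u x) *: G u x) =
    (fun x => dpsum a k (u x) *: G u x).
  by apply/funext => x; rewrite derive1_psum.
have Vnd : nondecreasing_seq Vn.
  apply/nondecreasing_seqP => m; apply: Rintegral_le_ae => //.
  - by apply: form_integrable pu; exact: dpsum_continuous.
  - by apply: form_integrable pu; exact: dpsum_continuous.
  - apply: filterS2 u0 (bil_ge0 alpha_gt0 A_coercive) => x u0 b0 Ox.
    rewrite derive1_psum (bilZr A_sym); apply: ler_wpM2r.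
      by rewrite mulr_ge0 ?b0// dpsum_ge0// u0.
    have [m0|m1] := leqP m 0; first by rewrite !dpsum_lt2// ltnW.
    rewrite dpsumS// lerDl mulr_ge0 ?a_ge0// mulr_ge0// exprn_ge0// u0//.
have -> : \int[mu]_(x in Omega) (dpsum a k (u x) ^+ 2 * form x (G u x) (G u x)) = Vn k.
  apply: eq_Rintegral => x _; rewrite derive1_psum (bilZr A_sym) mulrA.
  by rewrite expr2.
apply: (@le_trans _ _ (\int[mu]_(x in Omega) (g x * (psum a k \o u) x))).
  rewrite -(cvg_lim _ c)//; apply: nondecreasing_cvgn_le => //.
  by apply/cvg_ex; eexists; exact: c.
rewrite -RintegralZl//; apply: Rintegral_le_ae => //.
- have [M uM] := solution_bounded.
  have cp : continuous (psum a k) by exact/smooth1_continuous/smooth1_psum.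
  have mu_ : measurable_fun Omega u by case: solution_approx => -[].
  have := bounded_comp_integrable oO cp mu_ uM ig.
  by under eq_fun do rewrite mulrC.
- rewrite (_ : EFin \o _ = (fun x => B%:E * (g x)%:E)%E)//.
  exact: integrableZl.
- near=> x => Ox.
  have u0x : 0 <= u x by move: Ox; near: x; exact: u0.
  have usx : u x <= s by move: (Ox); near: x; exact: us.
  have g0x : 0 <= g x by move: (Ox); near: x; exact: g0.
  rewrite mulrC ler_wpM2r//; apply: le_trans sB.
  exact: psum_le.
Unshelve. all: by end_near.
Qed.

End solution.

(** With F = int f, c = int f phi and C2 = int A grad phi . grad phi, Young's inequality gives
    lambda c <= (t/2) B lambda F + C2 / (2t). The condition t B F <= c turns the first term into at
    most half of the left side. The resulting bound does not involve [u]. *)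
Lemma solution_parameter_bound (f phi : V -> R) (s B t lambda : R) u :
  0 <= s -> 0 <= B -> (forall k, psum a k s <= B) -> 0 < lambda ->
  mu.-integrable Omega (EFin \o f) -> {ae mu, forall x, Omega x -> 0 <= f x} ->
  test_function Omega phi -> 0 < \int[mu]_(x in Omega) (f x * phi x) ->
  weak_solution Omega A a (fun x => lambda * f x) u ->
  {ae mu, forall x, Omega x -> u x <= s} -> 0 < t ->
  t * (B * \int[mu]_(x in Omega) f x) <= \int[mu]_(x in Omega) (f x * phi x) ->
  lambda <= \int[mu]_(x in Omega) form x (grad phi x) (grad phi x) /
    (t * \int[mu]_(x in Omega) (f x * phi x)).
Proof.
move=> s0 B0 sB l0 If f0 tp; set c := \int[mu]_(x in Omega) (f x * phi x).
move=> c0 sol us t0 tBF.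
(* A test function approximates itself with zero error. *)
have tphi : test_approx Omega phi (grad phi).
  split; first exact: sobolev_pair_test.
  move=> e e0; exists phi; split => //.
  rewrite /sobolev_energy (_ : (\int[mu]_(x in Omega) _)%E = 0%E); first by rewrite lte_fin.
  apply: integral0_eq => x _; rewrite /sobolev_density /= !subrr expr0n/= add0r.
  by rewrite /dotv big1// => i _; rewrite mxE mul0r.
have u0 : {ae mu, forall x, Omega x -> 0 <= u x} by case: sol.
pose F := \int[mu]_(x in Omega) f x.
have F0 : 0 <= F.
  have /measurable_EFinP mf := measurable_int _ If.
  exact: Rintegral_ge0_ae.

pose C2 := \int[mu]_(x in Omega) form x (grad phi x) (grad phi x).
have ig : mu.-integrable Omega (EFin \o (fun x => lambda * f x)).
  rewrite (_ : EFin \o _ = (fun x => lambda%:E * (f x)%:E)%E)//.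
  exact: integrableZl.
have g0 : {ae mu, forall x, Omega x -> 0 <= lambda * f x}.
  by apply: filterS f0 => x h Ox; rewrite mulr_ge0 ?h// ltW.
have iphi : mu.-integrable Omega (EFin \o (fun x => form x (grad phi x) (grad phi x))).
  exact: (bil_integrable oO bO A_meas A_bounded tphi tphi).
have key k : \int[mu]_(x in Omega) (dpsum a k (u x) * form x (G u x) (grad phi x)) <=
    t / 2 * (B * (lambda * F)) + (2 * t)^-1 * C2.
  have cd2 : continuous (fun r => dpsum a k r ^+ 2).
    by move=> r; apply: cvgM; exact: dpsum_continuous.
  have i1 := form_integrable sol cd2 (solution_approx sol).
  have E1 := solution_energy sol s0 u0 us g0 ig (sB k).
  rewrite RintegralZl// -/F in E1.
  apply: (@le_trans _ _ (t / 2 * \int[mu]_(x in Omega)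
      (dpsum a k (u x) ^+ 2 * form x (G u x) (G u x)) + (2 * t)^-1 * C2)); last first.
    by rewrite lerD2r ler_wpM2l// divr_ge0// ltW.
  have j1 : mu.-integrable Omega (EFin \o (fun x => t / 2 *
      (dpsum a k (u x) ^+ 2 * form x (G u x) (G u x)))).
    rewrite (_ : EFin \o _ = (fun x => (t / 2)%:E *
      (dpsum a k (u x) ^+ 2 * form x (G u x) (G u x))%:E)%E)//.
    exact: integrableZl.
  have j2 : mu.-integrable Omega (EFin \o (fun x => (2 * t)^-1 *
      form x (grad phi x) (grad phi x))).
    rewrite (_ : EFin \o _ = (fun x => ((2 * t)^-1)%:E *
      (form x (grad phi x) (grad phi x))%:E)%E)//.
    exact: integrableZl.
  rewrite /C2 -RintegralZl// -RintegralZl// -RintegralD//.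
  apply: Rintegral_le_ae => //.
  - by apply: (form_integrable sol _ tphi); exact: dpsum_continuous.
  - rewrite (_ : EFin \o _ = (fun x => (t / 2 *
      (dpsum a k (u x) ^+ 2 * form x (G u x) (G u x)))%:E +
      ((2 * t)^-1 * form x (grad phi x) (grad phi x))%:E)%E)//.
    exact: integrableD.
  - apply: filterS (bil_young A_sym alpha_gt0 A_coercive t0) => x H Ox.
    have := H Ox (dpsum a k (u x) *: G u x) (grad phi x).
    by rewrite !bilZl (bilZr A_sym) (mulrA (dpsum a k (u x))) -expr2.
have cv := solution_weak_form sol tphi.
have : \int[mu]_(x in Omega) (lambda * f x * phi x) <=
    t / 2 * (B * (lambda * F)) + (2 * t)^-1 * C2.
  rewrite -(cvg_lim _ cv)//; apply: limr_le; last by apply: nearW => k; exact: key.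
  by apply/cvg_ex; eexists; exact: cv.
have -> : (fun x => lambda * f x * phi x) = (fun x => lambda * (f x * phi x)).
  by apply/funext => x; rewrite mulrA.
rewrite RintegralZl//; last first.
  by apply: loc_integrableM_test => //; exact: integrable_loc.
rewrite -/c -/C2 => H.

rewrite ler_pdivlMr ?mulr_gt0//.
(* The condition on [t] is spent here. *)
have H2 : lambda * c <= lambda * c / 2 + (2 * t)^-1 * C2.
  apply: (le_trans H); rewrite lerD2r.
  have -> : t / 2 * (B * (lambda * F)) = (t * (B * F)) * (lambda / 2) by ring.
  have -> : lambda * c / 2 = c * (lambda / 2) by ring.
  by rewrite ler_wpM2r// divr_ge0// ltW.
have H3 : lambda * c / 2 <= (2 * t)^-1 * C2 by lra.
have H4 : lambda * c / 2 * (2 * t) <= (2 * t)^-1 * C2 * (2 * t).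
  by rewrite ler_wpM2r// mulr_ge0// ltW.
have e4 : (2 * t)^-1 * C2 * (2 * t) = C2 by field; rewrite gt_eqF.
rewrite e4 in H4.
have <- : lambda * c / 2 * (2 * t) = lambda * (t * c) by field.
exact: H4.
Qed.

End weak_solutions.

Theorem theorem2p6 (R : realType) (N : nat) (hN : (1 <= N)%N)
    (Omega : set 'rV[R]_N) (Omega_open : open Omega)
    (Omega_bounded : bounded_set Omega)
    (A : 'rV[R]_N -> 'M[R]_N) (alpha beta : R)
    (A_meas : forall i j, measurable_fun setT (fun x => A x i j))
    (A_sym : forall x, (A x)^T = A x)
    (alpha_gt0 : 0 < alpha) (alpha_le_beta : alpha <= beta)
    (A_coercive : {ae lebesgue_rV R N, forall x, Omega x ->
       forall xi : 'rV[R]_N, xi != 0 ->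
         alpha * dotv xi xi <= dotv (xi *m (A x)^T) xi})
    (* `|A x| is the largest modulus of an entry; another matrix norm would only
       change the constant beta *)
    (A_bounded : {ae lebesgue_rV R N, forall x, Omega x -> `|A x| <= beta})
    (a : nat -> R) (a_ge0 : forall m, (1 <= m)%N -> 0 <= a m)
    (a1_neq0 : a 1%N != 0)
    (a_inf : infinite_set [set m | (1 < m)%N /\ a m != 0])
    (q : R) (q_ge1 : 1 <= q) (hq : N%:R / 2 < q)
    (f : 'rV[R]_N -> R) (f_Lq : Lp Omega q%:E f)
    (f_ge0 : {ae lebesgue_rV R N, forall x, Omega x -> 0 <= f x})
    (f_neq0 : ~ {ae lebesgue_rV R N, forall x, Omega x -> f x = 0})
    (sigma : \bar R) (sigma_ge0 : (0 <= sigma)%E)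
    (* in \bar R, 0^-1 = +oo and +oo^-1 = 0 *)
    (sigma_radius :
       limn_esup (fun m => (a m `^ (m%:R)^-1)%:E) = (sigma^-1)%E)
    (* this excludes sigma = +oo, since a 1 > 0 *)
    (sum_sigma : (\sum_(1 <= m <oo) (a m)%:E * sigma ^+ m < +oo)%E) :
  exists Lambda : R, 0 < Lambda /\
    forall lambda : R, Lambda < lambda ->
      ~ exists u : 'rV[R]_N -> R,
          weak_solution Omega A a (fun x => lambda * f x) u.
Proof.
have mO := open_measurable_rV Omega_open.
have [s sE s0] := radius_lty a_ge0 a1_neq0 sigma_ge0 sum_sigma.
rewrite sE in sigma_radius sum_sigma.
pose B := fine (\sum_(1 <= m <oo) (a m)%:E * s%:E ^+ m)%E.
have psB k : psum a k s <= B by exact: partial_sum_le.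
have B0 : 0 <= B by rewrite (le_trans _ (psB 0%N))// /psum big_geq.
have If := Lp_integrable Omega_open Omega_bounded q_ge1 f_Lq.
have [phi tphi c0] := exists_test_integral_gt0 Omega_open If f_neq0.
set c := \int[_]_(x in Omega) (f x * phi x) in c0.
pose F := \int[lebesgue_rV R N]_(x in Omega) f x.
have F0 : 0 <= F.
  have /measurable_EFinP mf := measurable_int _ If.
  exact: Rintegral_ge0_ae.
have BF0 : 0 < B * F + 1 by rewrite ltr_wpDl// mulr_ge0.
(* The 1 keeps the denominator positive if B F = 0, while t B F <= c still holds. Nothing here
   depends on lambda. *)
pose t := c / (B * F + 1).
have t0 : 0 < t by rewrite divr_gt0.
have tBF : t * (B * F) <= c.
  by rewrite /t mulrAC ler_pdivrMr// ler_wpM2l ?(ltW c0)// lerDl.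
pose D := \int[lebesgue_rV R N]_(x in Omega) bil A x (grad phi x) (grad phi x).
(* The absolute value and the 1 make the constant positive without knowing the sign of [D]. *)
exists (`|D / (t * c)| + 1); split; first by rewrite ltr_wpDl.
move=> lambda lL [u sol].
have l0 : 0 < lambda by apply: lt_trans lL; rewrite ltr_wpDl.
have us : {ae lebesgue_rV R N, forall x, Omega x -> u x <= s}.
  (* The bound u <= k is available only for k strictly above the radius; it is applied along s +
     1/(j+1), and countably many null sets are joined. The coordinate [Ordinal hN] feeds the
     Poincare inequality. *)
  have usj (j : nat) : {ae lebesgue_rV R N, forall x, Omega x -> u x <= s + j.+1%:R^-1}.
    have sj : s < s + j.+1%:R^-1 by rewrite ltrDl invr_gt0.
    apply: (solution_le Omega_open Omega_bounded A_meas A_sym alpha_gt0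
      A_coercive A_bounded a_ge0 sol (Ordinal hN)).
      exact: le_lt_trans sj.
    by move=> m0; exact: (radius_infinitely_often a_ge0 m0 s0 sj sigma_radius).
  apply: filterS (ae_foralln usj) => x H Ox; apply/ler_addgt0Pr => e e0.
  apply: (le_trans (H (Num.truncn e^-1) Ox)); rewrite lerD2l.
  by rewrite invf_ple ?posrE// ltW// truncnS_gt.
have := solution_parameter_bound Omega_open Omega_bounded A_meas A_sym alpha_gt0
  A_coercive A_bounded a_ge0 s0 B0 psB l0 If f_ge0 tphi c0 sol us t0 tBF.
rewrite -/D -/c => H; move: lL; apply/negP; rewrite -leNgt.
by apply: (le_trans H); rewrite (le_trans (ler_norm _))// lerDl.
Qed.
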